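(* Let $(\xi^*,\zeta^* )\in\mathcal A^\circ_0(\mathbb F^1)\times\mathcal A^\circ_0(\mathbb F^2)$ be an optimal pair and let $\mathbf M^0=\{M^0(\theta),\theta\in\mathcal T_0(\mathbb F^1)\}$, $\mathbf N^0=\{N^0(\gamma),\gamma\in\mathcal T_0(\mathbb F^2)\}$ with $$M^0(\theta)=\mathsf E\Big[\int_{[0,\theta)}g_t\,d\zeta^*_t\Big|\mathcal F^1_\theta\Big]+\mathsf E[1-\zeta^*_{\theta-}|\mathcal F^1_\theta]\,V^{*,1}(\theta),\qquad N^0(\gamma)=\mathsf E\Big[\int_{[0,\gamma)}f_t\,d\xi^*_t\Big|\mathcal F^2_\gamma\Big]+\mathsf E[1-\xi^*_{\gamma-}|\mathcal F^2_\gamma]\,V^{*,2}(\gamma).$$ The family $\mathbf M^0$ is a $\mathcal T_0(\mathbb F^1)$-submartingale system and the family $\mathbf N^0$ is a $\mathcal T_0(\mathbb F^2)$-supermartingale system. Both families are right-continuous in expectation and of class $(D)$. Thus, they can be aggregated (uniquely up to indistinguishability) into a càdlàg submartingale $(M^0_t)_{t\in[0,T]}$ with respect to $(\mathbb F^1,\mathsf P)$ and a càdlàg supermartingale $(N^0_t)_{t\in[0,T]}$ with respect to $(\mathbb F^2,\mathsf P)$, respectively.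
   Context: Let $T\in(0,\infty)$ and let $(\Omega,\mathcal F,\mathsf P)$ be a complete probability space with a right-continuous filtration $\mathbb F=(\mathcal F_t)_{t\in[0,T]}$ completed with $\mathsf P$-null sets, $\mathcal F_T\subsetneq\mathcal F$. Right-continuous filtrations $\mathbb F^i=(\mathcal F^i_t)_{t\in[0,T]}$, $i=1,2$, completed with null sets, satisfy $\mathcal F^1_t\vee\mathcal F^2_t\subseteq\mathcal F_t$. Equalities/inequalities between random variables are $\mathsf P$-a.s. $\mathcal L_b(\mathsf P)$ is the space of càdlàg $\mathcal B([0,T])\times\mathcal F$-measurable $X$ with $\mathsf E[\sup_{0\le t\le T}|X_t|]<\infty$. The payoff processes $f,g,h\in\mathcal L_b(\mathsf P)$ are $\mathbb F$-adapted with $f_t\ge h_t\ge g_t$ for all $t\in[0,T]$ a.s. For a filtration $\mathbb G\subseteq\mathbb F$ and a $\mathbb G$-stopping time $\theta\in[0,T]$: $\mathcal T_\theta(\mathbb G)$ is the set of $\mathbb G$-stopping times with values in $[\theta,T]$; $\mathcal A^\circ_\theta(\mathbb G)$ is the set of $\mathbb G$-adapted càdlàg non-decreasing $\rho$ with $\rho_{\theta-}=0$, $\rho_T=1$ (for $\theta=0$, $\rho_{0-}:=0$, so $d\rho$ may charge $\{0\}$); $\Delta\rho_t=\rho_t-\rho_{t-}$. The $\mathbb G$-randomised stopping time generated by $\rho\in\mathcal A^\circ_\theta(\mathbb G)$ is $\eta=\inf\{t\in[0,T]:\rho_t>Z\}$ with $Z\sim U([0,1])$ independent of $\mathcal F_T$;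 the class of these is $\mathcal T^R_\theta(\mathbb G)$. The randomisation devices $Z$ of the two players are independent. Game: $\mathcal P(\tau,\sigma)=f_\tau\mathbf 1_{\{\tau<\sigma\}}+h_\tau\mathbf 1_{\{\tau=\sigma\}}+g_\sigma\mathbf 1_{\{\sigma<\tau\}}$; Player 1 picks $\tau\in\mathcal T^R_0(\mathbb F^1)$ to minimise, Player 2 picks $\sigma\in\mathcal T^R_0(\mathbb F^2)$ to maximise $\mathsf E[\mathcal P(\tau,\sigma)]$. A pair $(\xi^*,\zeta^* )\in\mathcal A^\circ_0(\mathbb F^1)\times\mathcal A^\circ_0(\mathbb F^2)$ is optimal if it generates a saddle point $(\tau_*,\sigma_* )$: $\mathsf E[\mathcal P(\tau_*,\sigma)]\le\mathsf E[\mathcal P(\tau_*,\sigma_* )]\le\mathsf E[\mathcal P(\tau,\sigma_* )]$ for all $(\tau,\sigma)\in\mathcal T^R_0(\mathbb F^1)\times\mathcal T^R_0(\mathbb F^2)$. Truncated controls: for a stopping time $\eta$, $\xi^{*;\eta}_t=\frac{\xi^*_t-\xi^*_{\eta-}}{1-\xi^*_{\eta-}}\mathbf 1_{\{t\ge\eta\}}$, $\zeta^{*;\eta}_t=\frac{\zeta^*_t-\zeta^*_{\eta-}}{1-\zeta^*_{\eta-}}\mathbf 1_{\{t\ge\eta\}}$, with $0/0=1$ and $\xi^{*;\eta}_{\eta-}=\zeta^{*;\eta}_{\eta-}=0$. Set $\Pi^{*,1}_\theta=\frac{1-\zeta^*_{\theta-}}{\mathsf E[1-\zeta^*_{\theta-}|\mathcal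 F^1_\theta]}$, $\Pi^{*,2}_\gamma=\frac{1-\xi^*_{\gamma-}}{\mathsf E[1-\xi^*_{\gamma-}|\mathcal F^2_\gamma]}$, ratios being $1$ where the denominator is $0$. For a random variable $\Pi\ge0$, a $\sigma$-algebra $\mathcal G$, and $\xi,\zeta$ started at $\theta$, $$J^\Pi(\xi,\zeta|\mathcal G)=\mathsf E\Big[\Pi\Big(\int_{[\theta,T)}f_t(1-\zeta_t)d\xi_t+\int_{[\theta,T)}g_t(1-\xi_t)d\zeta_t+\sum_{t\in[\theta,T]}h_t\Delta\zeta_t\Delta\xi_t\Big)\Big|\mathcal G\Big].$$ Equilibrium values: $V^{*,1}(\theta)=\operatorname*{ess\,inf}_{\xi\in\mathcal A^\circ_\theta(\mathbb F^1)}J^{\Pi^{*,1}_\theta}(\xi,\zeta^{*;\theta}|\mathcal F^1_\theta)$ for $\theta\in\mathcal T_0(\mathbb F^1)$, $V^{*,2}(\gamma)=\operatorname*{ess\,sup}_{\zeta\in\mathcal A^\circ_\gamma(\mathbb F^2)}J^{\Pi^{*,2}_\gamma}(\xi^{*;\gamma},\zeta|\mathcal F^2_\gamma)$ for $\gamma\in\mathcal T_0(\mathbb F^2)$. A family $\{X(\theta),\theta\in\mathcal T_0(\mathbb G)\}$ is a $\mathcal T_0(\mathbb G)$-system if $X(\theta)$ is $\mathcal G_\theta$-measurable and $X(\theta_1)=X(\theta_2)$ on $\{\theta_1=\theta_2\}$; it is a sub- (super-) martingale system if moreover $\mathsf E|X(\theta)|<\infty$ and $\mathsf E[X(\theta_2)|\mathcal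 G_{\theta_1}]\ge X(\theta_1)$ (resp. $\le$) whenever $\theta_1\le\theta_2$. It is right-continuous in expectation if $\mathsf E[X(\theta_n)]\to\mathsf E[X(\theta)]$ for every decreasing sequence $\theta_n\downarrow\theta$ in $\mathcal T_0(\mathbb G)$; of class $(D)$ if it is uniformly integrable. A $\mathbb G$-optional process $(X_t)$ aggregates it if $\mathsf P(X(\theta)=X_\theta)=1$ for every $\theta\in\mathcal T_0(\mathbb G)$. *)

(* Defs.v *)
From HB Require Import structures.
From mathcomp Require Import all_boot all_order all_algebra.
From mathcomp Require Import all_classical all_reals all_analysis measurable_realfun.

Set Implicit Arguments.
Unset Strict Implicit.
Unset Printing Implicit Defensive.

Import Order.TTheory GRing.Theory Num.Theory.
Import numFieldNormedType.Exports.

Local Open Scope classical_set_scope.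
Local Open Scope ring_scope.

(* Time is R and only the values on [0, T] of a path, a process or a
   filtration matter.  A process is a map [X : R -> Omega -> R] (time first), a
   random time is a map [theta : Omega -> R], and sub-sigma-algebras are
   sets of subsets of Omega. *)

Section Paths.
Context {R : realType}.
Implicit Types (T t : R) (r : R -> R).

Definition cadlag_path T r : Prop :=
  (forall t, 0 <= t < T -> r s @[s --> t^'+] --> r t) /\
  (forall t, 0 < t <= T -> cvg (r s @[s --> t^'-])).

(* Left limit r_{t-}, with the convention r_{0-} = 0. *)
Definition left_lim r t : R :=
  if t <= 0 then 0 else lim (r s @[s --> t^'-]).

Definition jump r t : R := r t - left_lim r t.

(* Extension of a path on [0, T] to R: it vanishes before 0, so that
   the Stieltjes measure has an atom r_0 at 0, and is constant after T. *)
Definition extend_path T r (t : R) : R :=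
  if t < 0 then 0 else r (Num.min t T).

(* The measure dr on [0, T]; it is the zero measure (a junk value) when the
   extended path is not non-decreasing and right-continuous. *)
Definition stieltjes T r : {measure set (measurableTypeR R) -> \bar R} :=
  match pselect ({homo extend_path T r : s t / s <= t} /\
                 right_continuous (extend_path T r)) with
  | left H =>
      lebesgue_stieltjes_measure
        (HB.pack_for (cumulative R R) (extend_path T r)
          (isCumulative.Build R _ R (extend_path T r) (proj1 H) (proj2 H)))
  | right _ => mzero
  end.

(* Unordered sum of an absolutely summable real family. *)
Definition real_sum (A : set R) (a : R -> R) : R :=
  fine (\esum_(t in A) (EFin \o a)^\+ t - \esum_(t in A) (EFin \o a)^\- t)%E.

(* The quotient x / y with the convention x / 0 = 1. *)
Definition div_or1 (x y : R) : R := if y == 0 then 1 else x / y.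

End Paths.

Section Stochastics.
Context {R : realType} {d : measure_display} {Omega : measurableType d}.
Variables (P : probability Omega R) (T : R).
Implicit Types (G : R -> set (set Omega)) (H : set (set Omega)).
Implicit Types (f g h X Y M rho xi zeta : R -> Omega -> R) (theta : Omega -> R).

Definition sub_measurable H {d'} {U : measurableType d'} (X : Omega -> U) : Prop :=
  forall B, measurable B -> H (X @^-1` B).

(* Conditional expectations *)

Definition is_nonneg_condexp H (X Y : Omega -> \bar R) : Prop :=
  [/\ (forall w, 0 <= Y w)%E, sub_measurable H Y &
      forall A, H A -> (\int[P]_(w in A) Y w = \int[P]_(w in A) X w)%E].

Definition nonneg_condexp H (X : Omega -> \bar R) : Omega -> \bar R :=
  xget (cst 0%E) [set Y | is_nonneg_condexp H X Y].

(* A version of E[X | H], defined as E[X^+ | H] - E[X^- | H].  Integrability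
   of X is not required: the weights Pi in [cond_payoff] below are unbounded,
   so the variables there satisfy E[|X| | H] < +oo a.s. but need not be
   integrable. *)
Definition condexp H (X : Omega -> \bar R) : Omega -> \bar R :=
  (nonneg_condexp H X^\+ \- nonneg_condexp H X^\-)%E.

(* Essential infimum and supremum of a family of random variables *)

Definition is_essinf (C : set (Omega -> \bar R)) (Y : Omega -> \bar R) : Prop :=
  [/\ measurable_fun setT Y,
      forall X : Omega -> \bar R, C X -> {ae P, forall w, (Y w <= X w)%E} &
      forall Z : Omega -> \bar R, measurable_fun setT Z ->
        (forall X : Omega -> \bar R, C X -> {ae P, forall w, (Z w <= X w)%E}) ->
        {ae P, forall w, (Z w <= Y w)%E}].

Definition is_esssup (C : set (Omega -> \bar R)) (Y : Omega -> \bar R) : Prop :=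
  [/\ measurable_fun setT Y,
      forall X : Omega -> \bar R, C X -> {ae P, forall w, (X w <= Y w)%E} &
      forall Z : Omega -> \bar R, measurable_fun setT Z ->
        (forall X : Omega -> \bar R, C X -> {ae P, forall w, (X w <= Z w)%E}) ->
        {ae P, forall w, (Y w <= Z w)%E}].

Definition essinf C : Omega -> \bar R := xget (cst 0%E) [set Y | is_essinf C Y].
Definition esssup C : Omega -> \bar R := xget (cst 0%E) [set Y | is_esssup C Y].

(* Filtrations and stopping times *)

Definition usual_filtration G : Prop :=
  [/\ forall t, 0 <= t <= T ->
        sigma_algebra setT (G t) /\ G t `<=` measurable,
      forall s t, 0 <= s -> s <= t -> t <= T -> G s `<=` G t,
      forall t, 0 <= t < T -> \bigcap_(s in `]t, T]) G s `<=` G t &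
      forall N, P.-negligible N -> G 0 N].

Definition adapted G X : Prop :=
  forall t, 0 <= t <= T -> sub_measurable (G t) (X t).

Definition cadlag X : Prop := forall w, cadlag_path T (X ^~ w).

Definition stopping_time G theta : Prop :=
  (forall w, 0 <= theta w <= T) /\
  (forall t, 0 <= t <= T -> G t [set w | theta w <= t]).

(* The sigma-algebra G_theta of events prior to theta. *)
Definition stopped_algebra G theta : set (set Omega) :=
  [set A | forall t, 0 <= t <= T -> G t (A `&` [set w | theta w <= t])].

Definition time_space : set (R * Omega) := `[0, T] `*` setT.

Definition class_Lb X : Prop :=
  [/\ cadlag X,
      measurable_fun (time_space : set (measurableTypeR R * Omega)%type)
        (fun p => X p.1 p.2) &
      (\int[P]_w ereal_sup [set `|X t w|%:E | t in `[0%R, T]] < +oo)%E].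

Definition optional_algebra G : set (set (R * Omega)) :=
  <<s time_space,
    [set A | exists Y (B : set R), [/\ adapted G Y, cadlag Y, measurable B &
       A = time_space `&` [set p | B (Y p.1 p.2)]]] >>.

Definition optional G X : Prop :=
  forall B : set R, measurable B ->
    optional_algebra G (time_space `&` [set p | B (X p.1 p.2)]).

Definition indistinguishable X Y : Prop :=
  {ae P, forall w, forall t, 0 <= t <= T -> X t w = Y t w}.

(* Randomised stopping times *)

(* The class A^o_theta(G); for theta = 0 the condition on the left limit
   is void by the convention rho_{0-} = 0. *)
Definition control G theta rho : Prop :=
  [/\ adapted G rho, cadlag rho,
      forall w, 0 <= rho 0 w /\
        {in `[0, T] &, {homo rho ^~ w : s t / s <= t}},
      {ae P, forall w, left_lim (rho ^~ w) (theta w) = 0} &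
      {ae P, forall w, rho T w = 1}].

(* The infimum is over the empty set only on a null event (rho_T = 1 and
   Z < 1 almost surely), where its value is irrelevant. *)
Definition generated_time rho (Z : Omega -> R) : Omega -> R :=
  fun w => inf [set t | 0 <= t <= T /\ Z w < rho t w].

(* A pair of devices for the two players: uniform variables such that Z1, Z2
   and the sigma-algebra FT are mutually independent. *)
Definition devices (FT : set (set Omega)) (Z1 Z2 : {RV P >-> R}) : Prop :=
  [/\ forall B, measurable B -> distribution P Z1 B = uniform_prob (@ltr01 R) B,
      forall B, measurable B -> distribution P Z2 B = uniform_prob (@ltr01 R) B &
      forall A B1 B2, FT A -> measurable B1 -> measurable B2 ->
        (P (A `&` Z1 @^-1` B1 `&` Z2 @^-1` B2) =
         P A * P (Z1 @^-1` B1) * P (Z2 @^-1` B2))%E].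

(* eta belongs to T^R_0(G) and is generated with the device Z. *)
Definition randomised_time G (Z : Omega -> R) (eta : Omega -> R) : Prop :=
  exists2 rho, control G (cst 0) rho & eta = generated_time rho Z.

Definition payoff f g h (tau sigma : Omega -> R) : Omega -> R := fun w =>
  if tau w < sigma w then f (tau w) w
  else if sigma w < tau w then g (sigma w) w
  else h (tau w) w.

(* The pair (xi, zeta) generates a saddle point: player 1 minimises over
   tau in T^R_0(F1), player 2 maximises over sigma in T^R_0(F2). *)
Definition optimal (F F1 F2 : R -> set (set Omega)) f g h xi zeta : Prop :=
  exists Z1 Z2 : {RV P >-> R},
    let tau_ := generated_time xi Z1 in
    let sigma_ := generated_time zeta Z2 in
    [/\ devices (F T) Z1 Z2,
        forall (Z : {RV P >-> R}) sigma,
          devices (F T) Z1 Z -> randomised_time F2 Z sigma ->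
          ('E_P[payoff f g h tau_ sigma] <= 'E_P[payoff f g h tau_ sigma_])%E &
        forall (Z : {RV P >-> R}) tau,
          devices (F T) Z Z2 -> randomised_time F1 Z tau ->
          ('E_P[payoff f g h tau_ sigma_] <= 'E_P[payoff f g h tau sigma_])%E].

(* Equilibrium values *)

Definition truncated rho theta : R -> Omega -> R := fun t w =>
  if theta w <= t then
    div_or1 (rho t w - left_lim (rho ^~ w) (theta w))
          (1 - left_lim (rho ^~ w) (theta w))
  else 0.

(* 1 - rho_{theta-} *)
Definition survival rho theta : Omega -> R :=
  fun w => 1 - left_lim (rho ^~ w) (theta w).

(* Pi^{*,1}_theta for rho = zeta^*, G = F1 and Pi^{*,2}_gamma for
   rho = xi^*, G = F2. *)
Definition weight rho G theta : Omega -> R := fun w =>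
  div_or1 (survival rho theta w)
    (fine (condexp (stopped_algebra G theta) (EFin \o survival rho theta) w)).

(* The conditional expected payoff J^Pi(xi, zeta | H) from theta on. *)
Definition cond_payoff f g h (Pi : Omega -> R) theta xi zeta H :
    Omega -> \bar R :=
  condexp H (fun w => (Pi w *
   (\int[stieltjes T (xi ^~ w)]_(t in `[theta w, T[) (f t w * (1 - zeta t w))
    + \int[stieltjes T (zeta ^~ w)]_(t in `[theta w, T[) (g t w * (1 - xi t w))
    + real_sum `[theta w, T]
        (fun t => h t w * jump (zeta ^~ w) t * jump (xi ^~ w) t)))%:E).

Definition value1 F1 f g h zeta theta : Omega -> \bar R :=
  essinf [set cond_payoff f g h (weight zeta F1 theta) theta
                xi (truncated zeta theta) (stopped_algebra F1 theta)
         | xi in control F1 theta].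

Definition value2 F2 f g h xi gamma : Omega -> \bar R :=
  esssup [set cond_payoff f g h (weight xi F2 gamma) gamma
                (truncated xi gamma) zeta (stopped_algebra F2 gamma)
         | zeta in control F2 gamma].

Definition system_M0 F1 f g h zeta theta : Omega -> \bar R := fun w =>
  (condexp (stopped_algebra F1 theta)
     (fun w' => (\int[stieltjes T (zeta ^~ w')]_(t in `[0, theta w'[) g t w')%R%:E) w
   + condexp (stopped_algebra F1 theta) (EFin \o survival zeta theta) w
     * value1 F1 f g h zeta theta w)%E.

Definition system_N0 F2 f g h xi gamma : Omega -> \bar R := fun w =>
  (condexp (stopped_algebra F2 gamma)
     (fun w' => (\int[stieltjes T (xi ^~ w')]_(t in `[0, gamma w'[) f t w')%R%:E) w
   + condexp (stopped_algebra F2 gamma) (EFin \o survival xi gamma) w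
     * value2 F2 f g h xi gamma w)%E.

(* Systems indexed by stopping times *)

Implicit Type S : (Omega -> R) -> Omega -> \bar R.

Definition is_system G S : Prop :=
  (forall theta, stopping_time G theta ->
     sub_measurable (stopped_algebra G theta) (S theta)) /\
  (forall theta1 theta2, stopping_time G theta1 -> stopping_time G theta2 ->
     {ae P, forall w, theta1 w = theta2 w -> S theta1 w = S theta2 w}).

Definition integrable_system G S : Prop :=
  forall theta, stopping_time G theta -> P.-integrable setT (S theta).

Definition submartingale_system G S : Prop :=
  [/\ is_system G S, integrable_system G S &
      forall theta1 theta2, stopping_time G theta1 -> stopping_time G theta2 ->
        {ae P, forall w, theta1 w <= theta2 w} ->
        {ae P, forall w,
          (S theta1 w <= condexp (stopped_algebra G theta1) (S theta2) w)%E}].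

Definition supermartingale_system G S : Prop :=
  [/\ is_system G S, integrable_system G S &
      forall theta1 theta2, stopping_time G theta1 -> stopping_time G theta2 ->
        {ae P, forall w, theta1 w <= theta2 w} ->
        {ae P, forall w,
          (condexp (stopped_algebra G theta1) (S theta2) w <= S theta1 w)%E}].

Definition right_continuous_in_expectation G S : Prop :=
  forall (theta_ : nat -> Omega -> R) theta,
    (forall n, stopping_time G (theta_ n)) -> stopping_time G theta ->
    {ae P, forall w, (forall n, theta_ n.+1 w <= theta_ n w) /\
                     theta_ n w @[n --> \oo] --> theta w} ->
    (\int[P]_w S (theta_ n) w)%E @[n --> \oo] --> (\int[P]_w S theta w)%E.

(* Uniform integrability of the family {S(theta)}. *)
Definition class_D G S : Prop :=
  ereal_sup [set (\int[P]_(w in [set w | K%:E < `|S theta w|]) `|S theta w|)%E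
            | theta in stopping_time G] @[K --> +oo%R] --> 0%E.

Definition aggregates G M S : Prop :=
  optional G M /\
  forall theta, stopping_time G theta ->
    {ae P, forall w, S theta w = (M (theta w) w)%:E}.

Definition submartingale G M : Prop :=
  [/\ adapted G M,
      forall t, 0 <= t <= T -> P.-integrable setT (EFin \o M t) &
      forall s t, 0 <= s -> s <= t -> t <= T ->
        {ae P, forall w, ((M s w)%:E <= condexp (G s) (EFin \o M t) w)%E}].

Definition supermartingale G M : Prop :=
  [/\ adapted G M,
      forall t, 0 <= t <= T -> P.-integrable setT (EFin \o M t) &
      forall s t, 0 <= s -> s <= t -> t <= T ->
        {ae P, forall w, (condexp (G s) (EFin \o M t) w <= (M s w)%:E)%E}].

(* [mart] is [submartingale] or [supermartingale]. *)
Definition uniquely_aggregated (mart : (R -> set (set Omega)) ->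
    (R -> Omega -> R) -> Prop) G S : Prop :=
  exists M, [/\ cadlag M, mart G M, aggregates G M S &
    forall M', cadlag M' -> aggregates G M' S -> indistinguishable M M'].

End Stochastics.

(* Main.v *)
Require Import Defs.
From HB Require Import structures.
From mathcomp Require Import all_boot all_order all_algebra.
From mathcomp Require Import all_classical all_reals all_analysis measurable_realfun.
From mathcomp Require Import ring lra.

Import Order.TTheory GRing.Theory Num.Theory.
Import numFieldNormedType.Exports.

Local Open Scope classical_set_scope.
Local Open Scope ring_scope.

Set Implicit Arguments.
Unset Strict Implicit.
Unset Printing Implicit Defensive.

(* Realising a control xi by its quantile function, the expected payoff of a pair
   of randomised stopping times, conditionally on the information carried by the
   paths, is Y_xi = \int\int P(q_xi(u), q_zeta(v)) du dv over the unit square.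
   Splitting it at theta gives, for xi in A_theta(F1),
     E[Y_xi | F1_theta] = E[\int_[0, theta) g dzeta | F1_theta]
        + E[1 - zeta_{theta-} | F1_theta] J(xi, zeta^theta | F1_theta),
   so M0(theta) is the essential infimum over A_theta(F1) of E[Y_xi | F1_theta].
   As A_theta shrinks when theta grows, M0 is a submartingale system; pasting
   controls gives consistency on {theta1 = theta2}, the common integrable bound of
   all Y_xi gives class (D), and delaying a control from theta to theta_n costs
   asymptotically nothing because g <= h, which gives right-continuity in
   expectation.  The downcrossing inequality along dyadic times and Vitali's theorem
   then produce the cadlag aggregation.  Finally, -N0 is the system M0 of the game
   with exchanged players and payoffs -g, -f, -h. *)

(** Two features shape the argument. The weight Pi has the denominator
    E[1 - zeta_{theta-} | F1_theta], which is not bounded away from zero, so J need not be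
    integrable. Multiplied by that denominator it is: the product is the conditional expectation of
    1 - zeta_{theta-} times the pathwise payoff, and where the denominator vanishes so does, almost
    surely, the survival probability. Hence only the products are integrated, and inequalities
    between systems are tested by integrals over events of the stopped algebra. Quantiles turn the
    three terms of the payoff, two Stieltjes integrals and a sum over common jumps, into one
    integral of the game payoff against two independent uniform variables. Moving a control to a
    later time theta_n then replaces q_xi by max(q_xi, theta_n). In the limit this matters only
    where q_xi = theta: against a later opponent right-continuity of f applies, against a
    simultaneous one h is replaced by g. Only the positive part of the change has to vanish, since
    player 1 minimises. *)

Section RealIntegrals.
Context {R : realType} {d : measure_display} {Omega : measurableType d}.
Variable P : probability Omega R.
Implicit Types (X Y : Omega -> R) (A B : set Omega).

Local Notation intg X := (P.-integrable setT (EFin \o X)).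

Lemma integrable_sub X A : measurable A -> intg X ->
  P.-integrable A (EFin \o X).
Proof. by move=> mA iX; apply: (integrableS measurableT mA _ iX). Qed.

Lemma integrable_measurable X : intg X -> measurable_fun setT X.
Proof. by move=> iX; apply/measurable_EFinP; exact: measurable_int iX. Qed.

Lemma ae_eq_integrable X Y : {ae P, forall w, X w = Y w} ->
  measurable_fun setT Y -> intg X -> intg Y.
Proof.
move=> XY mY iX; apply/integrableP; split; first exact/measurable_EFinP.
rewrite (_ : (\int[P]_x `|(EFin \o Y) x|)%E = (\int[P]_x `|(EFin \o X) x|)%E).
  by case/integrableP: iX.
apply: ae_eq_integral => //.
- by apply: measurableT_comp => //; exact/measurable_EFinP.
- by apply: measurableT_comp => //; exact: measurable_int iX.
- by apply: filterS XY => w /= ->.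
Qed.

Lemma ae_le_integrable X Y : {ae P, forall w, `|X w| <= Y w} ->
  measurable_fun setT X -> intg Y -> intg X.
Proof.
move=> XY mX iY; apply/integrableP; split; first exact/measurable_EFinP.
case/integrableP: (iY) => mY; apply: le_lt_trans.
apply: ae_ge0_le_integral => //.
- by apply: measurableT_comp => //; exact/measurable_EFinP.
- exact: measurableT_comp.
- apply: filterS XY => w /= XYw _; rewrite lee_fin.
  by apply: le_trans XYw _; exact: ler_norm.
Qed.

Lemma ae_eq_Rintegral A X Y : measurable A -> measurable_fun setT X ->
  measurable_fun setT Y -> {ae P, forall w, A w -> X w = Y w} ->
  \int[P]_(w in A) X w = \int[P]_(w in A) Y w.
Proof.
move=> mA mX mY XY; congr fine; apply: ae_eq_integral => //.
- by apply/measurable_EFinP; exact: measurable_funTS.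
- by apply/measurable_EFinP; exact: measurable_funTS.
- by apply: filterS XY => w /= h Aw; rewrite h.
Qed.

Lemma ae_le_Rintegral A X Y : measurable A -> intg X -> intg Y ->
  {ae P, forall w, A w -> X w <= Y w} ->
  \int[P]_(w in A) X w <= \int[P]_(w in A) Y w.
Proof.
move=> mA iX iY XY.
(* The maximum equals Y a.e. on A and dominates X everywhere, which turns the a.e. hypothesis into a
   pointwise one. *)
have iM : intg (fun w => Num.max (X w) (Y w)).
  apply: (@ae_le_integrable _ (fun w => `|X w| + `|Y w|)).
  - by apply: aeW => w; rewrite /Num.max; case: ifP => _; rewrite ?lerDl ?lerDr.
  - apply: measurable_maxr; exact: integrable_measurable.
  - by apply: (@integrableD _ _ _ P setT measurableT (fun w => `|X w|%:E) (fun w => `|Y w|%:E)) => //; exact: integrable_norm.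
rewrite (@ae_eq_Rintegral A Y (fun w => Num.max (X w) (Y w))) //.
- apply: le_Rintegral => //; [exact: integrable_sub..|].
  by move=> w _; rewrite le_max lexx.
- exact: integrable_measurable.
- exact: integrable_measurable.
- by apply: filterS XY => w h Aw; rewrite max_r // h.
Qed.

Lemma Rintegral_split A B X : measurable A -> measurable B -> intg X ->
  \int[P]_(w in A) X w =
  \int[P]_(w in A `&` B) X w + \int[P]_(w in A `\` B) X w.
Proof.
move=> mA mB iX; rewrite -[X in Rintegral _ X _ = _](setUIDK A B).
apply: Rintegral_setU.
- exact: measurableI.
- exact: measurableD.
- apply: integrable_sub => //; apply: measurableU.
    exact: measurableI.
  exact: measurableD.
- by apply/disj_setPS => w [[_ Bw] [_]].
Qed.

Lemma Rintegral_EFin A X : measurable A -> intg X ->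
  (\int[P]_(w in A) X w)%:E = (\int[P]_(w in A) (X w)%:E)%E.
Proof.
move=> mA iX; rewrite fineK //; apply: integrable_fin_num => //.
exact: integrable_sub.
Qed.

(** The source of the a.e. inequalities below: it is applied to a difference X - Y on the event
    where that difference is positive. *)
Lemma Rintegral_pos_null A X : measurable A -> intg X ->
  (forall w, A w -> 0 < X w) -> \int[P]_(w in A) X w <= 0 -> P.-negligible A.
Proof.
move=> mA iX Xpos Xle.
have mX : measurable_fun A (EFin \o X).
  by apply/measurable_EFinP; apply: measurable_funTS; exact: integrable_measurable.
have : (\int[P]_(w in A) `|(EFin \o X) w| = 0)%E.
  rewrite (eq_integral (fun w => (X w)%:E)); last first.
    by move=> w /set_mem Aw /=; rewrite ger0_norm // ltW // Xpos.
  rewrite -Rintegral_EFin //; congr EFin; apply/eqP; rewrite eq_le Xle /=.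
  by apply: Rintegral_ge0 => w Aw; rewrite ltW // Xpos.
move/(ae_eq_integral_abs _ mA mX) => [N [mN N0 sub]].
exists N; split => // w Aw; apply: sub => /= /(_ Aw) [] X0.
by have := Xpos _ Aw; rewrite X0 ltxx.
Qed.

Lemma probability_Rintegral_cst (r : R) : \int[P]_w (cst r w) = r.
Proof.
transitivity (r * fine (P setT)); first exact: Rintegral_cst.
by have -> : P setT = 1%E by [exact: probability_setT]; rewrite mulr1.
Qed.

End RealIntegrals.

(** * Conditional expectations and essential infima *)

Section SubSigma.
Context {R : realType} {d : measure_display} {Omega : measurableType d}.
Variable P : probability Omega R.
Implicit Types (H : set (set Omega)) (A B : set Omega).

Local Notation intg X := (P.-integrable setT (EFin \o X)).

Definition sub_sigma H := sigma_algebra setT H /\ H `<=` measurable.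

(** Lets closure properties of measurable functions be used for H: as H is a sigma-algebra, the
    measurable sets of the type it generates are exactly its members. *)
Lemma sub_measurableP H d' (U : measurableType d') (X : Omega -> U) :
  sigma_algebra setT H ->
  sub_measurable H X <->
  measurable_fun (setT : set (g_sigma_algebraType H)) (X : g_sigma_algebraType H -> U).
Proof.
move=> sH; split => [hX _ B mB|hX B mB].
  by rewrite setTI; apply: sub_sigma_algebra; exact: hX.
have := hX measurableT B mB; rewrite setTI.
by rewrite (measurable_g_measurableTypeE sH).
Qed.

Lemma sub_measurable_fun H d' (U : measurableType d') (X : Omega -> U) :
  sub_sigma H -> sub_measurable H X -> measurable_fun setT X.
Proof. by move=> [_ sH] hX _ B mB; rewrite setTI; apply/sH/hX. Qed.

Lemma sub_sigmaC H A : sub_sigma H -> H A -> H (~` A).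
Proof. by move=> [[_ hC _] _] /hC; rewrite setTD. Qed.

Lemma sub_sigmaT H : sub_sigma H -> H setT.
Proof. by move=> hH; rewrite -setC0; apply: sub_sigmaC => //; case: hH => -[]. Qed.

Lemma sub_sigma_bigcup H (F : (set Omega)^nat) : sub_sigma H ->
  (forall n, H (F n)) -> H (\bigcup_n F n).
Proof. by move=> [[_ _ hU] _]; exact: hU. Qed.

Lemma sub_sigmaU H A B : sub_sigma H -> H A -> H B -> H (A `|` B).
Proof.
move=> hH hA hB; rewrite -bigcup2E; apply: sub_sigma_bigcup => // -[|[|n]] //=.
by case: hH => -[].
Qed.

Lemma sub_sigmaI H A B : sub_sigma H -> H A -> H B -> H (A `&` B).
Proof.
move=> hH hA hB; rewrite -[X in H X]setCK setCI; apply: sub_sigmaC => //.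
by apply: sub_sigmaU => //; exact: sub_sigmaC.
Qed.

Lemma sub_sigmaD H A B : sub_sigma H -> H A -> H B -> H (A `\` B).
Proof. by move=> hH hA hB; rewrite setDE; apply: sub_sigmaI => //; exact: sub_sigmaC. Qed.

Lemma sub_measurable_fine H (X : Omega -> \bar R) : sub_sigma H ->
  sub_measurable H X -> sub_measurable H (fine \o X).
Proof.
move=> [sH _] /(sub_measurableP _ sH) mX; apply/sub_measurableP => //.
by apply: measurableT_comp => //; exact: fine_measurable.
Qed.

Lemma sub_measurable_EFin H (X : Omega -> R) : sub_sigma H ->
  sub_measurable H X -> sub_measurable H (EFin \o X).
Proof.
move=> [sH _] /(sub_measurableP _ sH) mX; apply/sub_measurableP => //.
exact/measurable_EFinP.
Qed.

Lemma sub_measurable_lt H (X Y : Omega -> \bar R) : sub_sigma H ->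
  sub_measurable H X -> sub_measurable H Y -> H [set w | (X w < Y w)%E].
Proof.
move=> [sH _] /(sub_measurableP _ sH) mX /(sub_measurableP _ sH) mY.
have := measurable_lte measurableT mX mY; rewrite setTI.
by rewrite (measurable_g_measurableTypeE sH).
Qed.

Lemma sub_measurable_ltr H (X Y : Omega -> R) : sub_sigma H ->
  sub_measurable H X -> sub_measurable H Y -> H [set w | X w < Y w].
Proof.
move=> hH /(sub_measurable_EFin hH) mX /(sub_measurable_EFin hH) mY.
exact: sub_measurable_lt hH mX mY.
Qed.

Lemma sub_measurable_cst H d' (U : measurableType d') (u : U) : sub_sigma H ->
  sub_measurable H (cst u : Omega -> U).
Proof. by move=> [sH _]; apply/sub_measurableP. Qed.

(** The event {Y < X} is itself in H, and X - Y is positive on it with a nonpositive integral. *)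
Lemma sub_le_ae H (X Y : Omega -> R) : sub_sigma H ->
  sub_measurable H X -> sub_measurable H Y -> intg X -> intg Y ->
  (forall A, H A -> \int[P]_(w in A) X w <= \int[P]_(w in A) Y w) ->
  {ae P, forall w, X w <= Y w}.
Proof.
move=> hH mX mY iX iY le.
have HA : H [set w | Y w < X w] by exact: sub_measurable_ltr.
have mA : measurable [set w | Y w < X w] by case: hH => _; exact.
suff : P.-negligible [set w | Y w < X w].
  by apply: negligibleS => w /= /negP; rewrite -ltNge.
apply: (@Rintegral_pos_null _ _ _ _ _ (fun w => X w - Y w)) => //.
- by apply: (@integrableB _ _ _ P setT measurableT (EFin \o X) (EFin \o Y)).
- by move=> w /=; rewrite subr_gt0.
- rewrite RintegralB ?subr_le0 ?le //; exact: integrable_sub.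
Qed.

Lemma sub_eq_ae H (X Y : Omega -> R) : sub_sigma H ->
  sub_measurable H X -> sub_measurable H Y -> intg X -> intg Y ->
  (forall A, H A -> \int[P]_(w in A) X w = \int[P]_(w in A) Y w) ->
  {ae P, forall w, X w = Y w}.
Proof.
move=> hH mX mY iX iY eq.
have h1 : {ae P, forall w, X w <= Y w} by apply: sub_le_ae hH _ _ _ _ _ => // A HA; rewrite eq.
have h2 : {ae P, forall w, Y w <= X w} by apply: sub_le_ae hH _ _ _ _ _ => // A HA; rewrite eq.
by apply: filterS2 h1 h2 => w a b; apply/eqP; rewrite eq_le a.
Qed.

End SubSigma.

Section CondExp.
Context {R : realType} {d : measure_display} {Omega : measurableType d}.
Variable P : probability Omega R.
Implicit Types (A B : set Omega).
Import HBNNSimple.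
Variable H : set (set Omega).
Hypothesis hH : sub_sigma H.

Local Notation intg X := (P.-integrable setT (EFin \o X)).
Local Notation OmegaH := (g_sigma_algebraType H).

Lemma measurable_OmegaH A : H A <-> measurable (A : set OmegaH).
Proof. by rewrite measurable_g_measurableTypeE; case: hH. Qed.

Let idH : Omega -> OmegaH := id.

Let measurable_idH : idH \in mfun.
Proof.
apply/mem_set => _ B mB; rewrite setTI; case: hH => _; apply.
exact/measurable_OmegaH.
Qed.

(** The restriction of P to H, obtained as the image of P under the identity so that it is a measure
    on the type carrying H. *)
Let PH := distribution P (mfun_Sub measurable_idH).

Let PH_ae (Q : Omega -> Prop) : {ae PH, forall w, Q w} -> {ae P, forall w, Q w}.
Proof.
move=> [N [mN N0 sub]]; exists N; split => //.
by case: hH => _; apply; exact/measurable_OmegaH.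
Qed.

Let PH_integral A (X : Omega -> \bar R) : H A -> sub_measurable H X ->
  (forall w, 0 <= X w)%E ->
  (\int[PH]_(w in (A : set OmegaH)) X w = \int[P]_(w in A) X w)%E.
Proof.
move=> HA mX X0; rewrite ge0_integral_pushforward //.
- exact/measurable_OmegaH.
- by apply: measurable_funTS; apply/sub_measurableP => //; case: hH.
Qed.

(** The Radon-Nikodym derivative, with respect to P restricted to H, of the finite measure A |->
    E[X 1_A] on H. *)
Lemma ge0_condexp_ex (X : Omega -> R) : intg X -> (forall w, 0 <= X w) ->
  exists Y : Omega -> R, [/\ sub_measurable H Y, intg Y, forall w, 0 <= Y w &
    forall A, H A -> (\int[P]_(w in A) (Y w)%:E = \int[P]_(w in A) (X w)%:E)%E].
Proof.
move=> iX X0.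
have mH (A : set OmegaH) : measurable A -> measurable (A : set Omega).
  by move=> mA; case: hH => _; apply; exact/measurable_OmegaH.
pose nu : set OmegaH -> \bar R := induced_charge iX.
have nu0 : (nu set0 = 0)%E by exact: (@charge0 _ _ _ (induced_charge iX)).
have nu_ge0 A : (0 <= nu A)%E.
  by apply: integral_ge0 => w _; rewrite lee_fin.
have nusig : semi_sigma_additive nu.
  move=> F mF tF mUF.
  apply: (@charge_semi_sigma_additive _ _ _ (induced_charge iX)) => //; last exact: mH.
  by move=> i; apply: mH; exact: mF.
pose nuM : {measure set OmegaH -> \bar R} :=
  HB.pack nu (isMeasure.Build _ OmegaH R nu nu0 nu_ge0 nusig).
have nufin : fin_num_fun nuM.
  by move=> A mA; exact: (@fin_num_measure _ _ _ (induced_charge iX) _ (mH _ mA)).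
pose nuF : {finite_measure set OmegaH -> \bar R} :=
  HB.pack (Measure.sort nuM) (isMeasure.Build _ OmegaH R nu nu0 nu_ge0 nusig) (Measure_isFinite.Build _ OmegaH R nuM nufin).
have dom : nuF `<< PH.
  apply/null_content_dominatesP => A mA PA0.
  have -> : nuF A = (\int[P]_(w in A) (EFin \o X) w)%E by [].
  apply: null_set_integral => //; first exact: mH.
  apply: measurable_funTS; exact: measurable_int iX.
have [f [f0 ffin iRN intf]] := radon_nikodym_sigma_finite dom.
pose Y := fine \o f.
have fY w : (Y w)%:E = f w by rewrite /Y /= fineK.
have mf : sub_measurable H f.
  by apply/sub_measurableP; [case: hH|exact: measurable_int iRN].
have mY : sub_measurable H Y by exact: sub_measurable_fine.
have intY A : H A -> (\int[P]_(w in A) (Y w)%:E = \int[P]_(w in A) (X w)%:E)%E.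
  move=> HA; under eq_integral do rewrite fY.
  transitivity (\int[PH]_(w in (A : set OmegaH)) f w)%E; first by rewrite PH_integral.
  by apply: esym; apply: intf; exact/measurable_OmegaH.
have Y0 w : 0 <= Y w by rewrite fine_ge0.
exists Y; split => //; apply/integrableP; split.
  by apply/measurable_EFinP/(@sub_measurable_fun _ _ H).
under eq_integral => w _ do rewrite /= ger0_norm //.
rewrite intY; last exact: sub_sigmaT.
by apply: integrable_lty.
Qed.

(** Integrability is not assumed, so X and Y are compared on the events [D n], where X is bounded.
    These events exhaust Omega because X is finite. *)
Lemma sub_ge0_eq_ae (X : Omega -> R) (Y : Omega -> \bar R) :
  sub_measurable H X -> sub_measurable H Y ->
  (forall w, 0 <= X w) -> (forall w, 0 <= Y w)%E ->
  (forall A, H A -> \int[P]_(w in A) Y w = \int[P]_(w in A) (X w)%:E)%E ->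
  {ae P, forall w, Y w = (X w)%:E}.
Proof.
move=> mX mY X0 Y0 XY.
have mX' : measurable_fun (setT : set OmegaH) (X : OmegaH -> R).
  by apply/sub_measurableP => //; case: hH.
have mY' : measurable_fun (setT : set OmegaH) (Y : OmegaH -> \bar R).
  by apply/sub_measurableP => //; case: hH.
pose D n : set OmegaH := [set w | X w <= n%:R].
have mD n : measurable (D n).
  apply/measurable_OmegaH.
  have -> : D n = ~` [set w | cst n%:R w < X w].
    by apply/seteqP; split => w /=; rewrite /D /= leNgt => /negP.
  apply: sub_sigmaC => //; apply: sub_measurable_ltr => //.
  exact: sub_measurable_cst.
have key n : {ae PH, forall w, D n w -> (X w)%:E = Y w}.
  apply: integral_ae_eq => //.
  - apply: (@measurable_bounded_integrable _ _ _ PH X) => //.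
    + by rewrite -ge0_fin_numE // fin_num_measure.
    + exact: measurable_funTS.
    + exists n%:R; split => // x xn w Dw; rewrite /= ger0_norm //.
      exact: le_trans (ltW xn).
  - exact: measurable_funTS.
  - move=> E _ mE; have HE : H E by apply/measurable_OmegaH.
    rewrite PH_integral //; last exact: sub_measurable_EFin.
    by rewrite PH_integral // XY.
apply: PH_ae.
have : {ae PH, forall w, forall n, D n w -> (X w)%:E = Y w}.
  by apply: ae_foralln.
apply: filterS => w h; rewrite -(h (Num.truncn (X w)).+1) //.
by rewrite /D /= ltW // truncnS_gt.
Qed.

Let nnsfun_integralM (h : {nnsfun OmegaH >-> R}) A (X : Omega -> \bar R) :
  H A -> measurable_fun setT X -> (forall w, 0 <= X w)%E ->
  (\int[P]_(w in A) ((h w)%:E * X w) =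
   \sum_(r \in range h) (r%:E * \int[P]_(w in A `&` h @^-1` [set r]) X w))%E.
Proof.
move=> HA mX X0.
have mA : measurable A by case: hH => _; exact.
have mh r : measurable (h @^-1` [set r] : set Omega).
  by case: hH => _; apply; apply/measurable_OmegaH; exact: measurable_sfunP.
transitivity (\int[P]_(w in A) (\sum_(r \in range h)
    ((r * \1_(h @^-1` [set r] : set Omega) w)%:E * X w)))%E.
  apply: eq_integral => w _.
  rewrite -ge0_mule_fsuml => [|y]; last exact: nnfun_muleindic_ge0.
  by rewrite fsumEFin // -(fimfunE h w).
rewrite ge0_integral_fsum //; last 2 first.
- move=> r; apply: emeasurable_funM; apply: measurable_funTS => //.
  by apply/measurable_EFinP; apply: measurable_funM.
- by move=> r w Aw; rewrite mule_ge0 // nnfun_muleindic_ge0.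
apply: eq_fsbigr => r; rewrite inE => -[t _ rt].
have r0 : 0 <= r by rewrite -rt.
under eq_integral do rewrite EFinM -muleA.
rewrite ge0_integralZl //; last first.
- by move=> w _; rewrite mule_ge0 // lee_fin.
- apply: emeasurable_funM; apply: measurable_funTS => //.
  exact/measurable_EFinP.
congr (_ * _)%E; rewrite integral_mkcondr; apply: eq_integral => w _.
by rewrite muleC epatch_indic.
Qed.

(** The factor c is an increasing limit of simple functions whose level sets lie in H. The
    hypothesis applies on each level set, and monotone convergence concludes. *)
Lemma sub_integralM (c : Omega -> R) (X Y : Omega -> R) : sub_measurable H c ->
  measurable_fun setT X -> measurable_fun setT Y ->
  (forall w, 0 <= c w) -> (forall w, 0 <= X w) -> (forall w, 0 <= Y w) ->
  (forall A, H A -> \int[P]_(w in A) (X w)%:E = \int[P]_(w in A) (Y w)%:E)%E ->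
  forall A, H A ->
   (\int[P]_(w in A) (c w * X w)%:E = \int[P]_(w in A) (c w * Y w)%:E)%E.
Proof.
move=> mc mX mY c0 X0 Y0 XY A HA.
have mA : measurable A by case: hH => _; exact.
have mc' : measurable_fun (setT : set OmegaH) (EFin \o c : OmegaH -> \bar R).
  by apply/measurable_EFinP; apply/sub_measurableP => //; case: hH.
pose h := nnsfun_approx measurableT mc'.
have mh n : measurable_fun setT (h n : Omega -> R).
  apply: (@sub_measurable_fun _ _ H) => //.
  by apply/sub_measurableP; [case: hH|exact: measurable_funP].
have lim_h (Z : Omega -> R) : measurable_fun setT Z -> (forall w, 0 <= Z w) ->
    (\int[P]_(w in A) (c w * Z w)%:E =
     limn (fun n => \int[P]_(w in A) ((h n w)%:E * (Z w)%:E)))%E.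
  move=> mZ Z0.
  have cZ w : (c w * Z w)%:E = limn (fun n => (h n w)%:E * (Z w)%:E)%E.
    apply/esym/cvg_lim => //; rewrite EFinM.
    apply: cvgeZr => //.
    by apply: cvg_nnsfun_approx => // t _ /=; rewrite lee_fin.
  under eq_integral do rewrite cZ.
  apply: monotone_convergence => //.
  - move=> n; apply: measurable_funTS; apply: emeasurable_funM; exact/measurable_EFinP.
  - by move=> n w _; rewrite mule_ge0 // lee_fin.
  - move=> w _ a b ab; rewrite lee_wpmul2r ?lee_fin //.
    exact/lefP/(nd_nnsfun_approx measurableT mc' ab).
rewrite lim_h // lim_h //; congr (limn _); apply/funext => n.
rewrite nnsfun_integralM //; last exact/measurable_EFinP.
rewrite nnsfun_integralM //; last exact/measurable_EFinP.
apply: eq_fsbigr => r _; rewrite XY //.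
apply: sub_sigmaI => //; apply/measurable_OmegaH; exact: measurable_sfunP.
Qed.

Lemma nonneg_condexp_measurable (X : Omega -> \bar R) :
  sub_measurable H (nonneg_condexp P H X).
Proof.
rewrite /nonneg_condexp; case: xgetP => [Y _ []//|_]; exact: sub_measurable_cst.
Qed.

Lemma nonneg_condexp_ge0 (X : Omega -> \bar R) w : (0 <= nonneg_condexp P H X w)%E.
Proof. by rewrite /nonneg_condexp; case: xgetP => [Y _ []//|]. Qed.

Lemma condexp_measurable (X : Omega -> \bar R) : sub_measurable H (condexp P H X).
Proof.
have [sH _] := hH.
apply/sub_measurableP => //; apply: emeasurable_funB; apply/sub_measurableP => //;
  exact: nonneg_condexp_measurable.
Qed.

(** Existence of E[X | H] without integrability of X: with Y0 a version of E[X0 | H], the product c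
    Y0 is a witness, and uniqueness carries it over to the version selected by [xget]. *)
Lemma nonneg_condexp_mul (c X0 : Omega -> R) (X : Omega -> \bar R) :
  sub_measurable H c -> (forall w, 0 <= c w) -> (forall w, 0 <= X0 w) ->
  intg X0 -> measurable_fun setT X -> (forall w, 0 <= X w)%E ->
  {ae P, forall w, X w = (c w * X0 w)%:E} ->
  exists Y0 : Omega -> R, [/\ sub_measurable H Y0, intg Y0,
    forall A, H A -> \int[P]_(w in A) Y0 w = \int[P]_(w in A) X0 w &
    {ae P, forall w, nonneg_condexp P H X w = (c w * Y0 w)%:E}].
Proof.
move=> mc c0 X00 iX0 mX X_ge0 XE; have [sH HM] := hH.
have [Y0 [mY0 iY0 Y00 intY0]] := ge0_condexp_ex iX0 X00.
exists Y0; split => //; first by move=> A HA; rewrite /Rintegral intY0.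
have mcY : sub_measurable H (fun w => c w * Y0 w).
  by apply/sub_measurableP => //; apply: measurable_funM; apply/sub_measurableP.
have mc' := sub_measurable_fun hH mc.
have intX A : H A -> (\int[P]_(w in A) (c w * Y0 w)%:E = \int[P]_(w in A) X w)%E.
  move=> HA; have mA := HM _ HA.
  rewrite (sub_integralM mc (sub_measurable_fun hH mY0) (integrable_measurable iX0)) //.
  apply: ge0_ae_eq_integral => //.
  - apply: measurable_funTS; apply/measurable_EFinP; apply: measurable_funM => //.
    exact: integrable_measurable iX0.
  - exact: measurable_funTS.
  - by move=> w _; rewrite lee_fin mulr_ge0.
  - by apply: filterS XE => w ->.
apply: sub_ge0_eq_ae => //.
- exact: nonneg_condexp_measurable.
- by move=> w; rewrite mulr_ge0.
- exact: nonneg_condexp_ge0.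
- move=> A HA.
  have : is_nonneg_condexp P H X (nonneg_condexp P H X).
    apply: (xgetPex _ (P := [set Y | is_nonneg_condexp P H X Y])).
    exists (fun w => (c w * Y0 w)%:E); split => //.
    + by move=> w; rewrite lee_fin mulr_ge0.
    + exact: sub_measurable_EFin.
  by case=> _ _ ->; rewrite // intX.
Qed.

(** Since c is nonnegative, the positive and negative parts of c X0 are c times those of X0. Both
    conditional expectations are a.e. finite, so their difference is meaningful even if X is not
    integrable. *)
Lemma condexp_mul (c X0 : Omega -> R) (X : Omega -> \bar R) :
  sub_measurable H c -> (forall w, 0 <= c w) -> intg X0 -> measurable_fun setT X ->
  {ae P, forall w, X w = (c w * X0 w)%:E} ->
  exists Y0 : Omega -> R, [/\ sub_measurable H Y0, intg Y0,
    forall A, H A -> \int[P]_(w in A) Y0 w = \int[P]_(w in A) X0 w &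
    {ae P, forall w, condexp P H X w = (c w * Y0 w)%:E}].
Proof.
move=> mc c0 iX0 mX XE; have [sH HM] := hH.
have ip : intg (fun w => Num.max (X0 w) 0).
  exact: (integrable_funrpos measurableT iX0).
have in_ : intg (fun w => Num.max (- X0 w) 0).
  exact: (integrable_funrneg measurableT iX0).
have [Yp [mYp iYp intYp eYp]] : exists Yp : Omega -> R, [/\ sub_measurable H Yp, intg Yp,
    forall A, H A -> \int[P]_(w in A) Yp w = \int[P]_(w in A) Num.max (X0 w) 0 &
    {ae P, forall w, nonneg_condexp P H (X^\+)%E w = (c w * Yp w)%:E}].
  apply: nonneg_condexp_mul => //.
  - by move=> w; rewrite le_max lexx orbT.
  - exact: measurable_funepos.
  - apply: filterS XE => w XEw; rewrite funeposE /= XEw -EFin_max; congr EFin.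
    by rewrite maxr_pMr // mulr0.
have [Yn [mYn iYn intYn eYn]] : exists Yn : Omega -> R, [/\ sub_measurable H Yn, intg Yn,
    forall A, H A -> \int[P]_(w in A) Yn w = \int[P]_(w in A) Num.max (- X0 w) 0 &
    {ae P, forall w, nonneg_condexp P H (X^\-)%E w = (c w * Yn w)%:E}].
  apply: nonneg_condexp_mul => //.
  - by move=> w; rewrite le_max lexx orbT.
  - exact: measurable_funeneg.
  - apply: filterS XE => w XEw; rewrite funenegE /= XEw -EFin_max; congr EFin.
    by rewrite maxr_pMr // mulr0 mulrN.
exists (fun w => Yp w - Yn w); split.
- by apply/sub_measurableP => //; apply: measurable_funB; apply/sub_measurableP.
- exact: (@integrableB _ _ _ P setT measurableT (EFin \o Yp) (EFin \o Yn)).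
- move=> A HA; have mA := HM _ HA.
  rewrite RintegralB //; [|exact: integrable_sub..].
  rewrite intYp // intYn // -RintegralB //; [|exact: integrable_sub..].
  apply: eq_Rintegral => w _.
  by have [h|h] := leP 0 (X0 w);
    [rewrite max_r ?oppr_le0 // subr0|rewrite max_l ?oppr_ge0 ?ltW // sub0r opprK].
- apply: filterS2 eYp eYn => w; rewrite /condexp => -> ->.
  by rewrite -EFinB mulrBr.
Qed.

Lemma condexp_integrable (X0 : Omega -> R) (X : Omega -> \bar R) : intg X0 ->
  measurable_fun setT X -> {ae P, forall w, X w = (X0 w)%:E} ->
  exists Y : Omega -> R, [/\ sub_measurable H Y, intg Y,
    forall A, H A -> \int[P]_(w in A) Y w = \int[P]_(w in A) X0 w &
    {ae P, forall w, condexp P H X w = (Y w)%:E}].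
Proof.
move=> iX mX XE.
have [|||Y [mY iY intY eY]] := @condexp_mul (cst 1) X0 X _ _ iX mX.
- exact: sub_measurable_cst.
- by [].
- by apply: filterS XE => w ->; rewrite mul1r.
- by exists Y; split => //; apply: filterS eY => w ->; rewrite mul1r.
Qed.

End CondExp.

Section EssInf.
Context {R : realType} {d : measure_display} {Omega : measurableType d}.
Variable P : probability Omega R.
Implicit Types (C : set (Omega -> \bar R)) (u : (Omega -> \bar R)^nat).

Lemma measurable_contract (X : Omega -> \bar R) : measurable_fun setT X ->
  measurable_fun setT (fun w => contract (X w)).
Proof.
move=> mX; apply: (measurability _ (RGenOInfty.measurableE R)) => // _ [_ [a ->] <-].
rewrite setTI.
have [a1|a1] := ltP a (-1).
  rewrite (_ : _ @^-1` _ = setT) //; apply/seteqP; split => // w _ /=.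
  rewrite in_itv /= andbT; apply: lt_le_trans a1 _.
  by have := contract_le1 (X w); rewrite ler_norml => /andP[].
have [a2|a2] := leP 1 a.
  rewrite (_ : _ @^-1` _ = set0) //; apply/seteqP; split => // w /=.
  rewrite in_itv /= andbT => h; have := contract_le1 (X w).
  by rewrite ler_norml => /andP[_ h2]; have := le_lt_trans a2 h; rewrite ltNge h2.
have -> : (fun w => contract (X w)) @^-1` `]a, +oo[ = [set w | (expand a < X w)%E].
  apply/seteqP; split => w /=; rewrite in_itv /= andbT.
    by rewrite -[a in (a < _)%R]expandK ?inE ?ler_norml ?a1 ?ltW // !ltNge le_contract.
  by rewrite -[a in (_ -> (a < _)%R)]expandK ?inE ?ler_norml ?a1 ?ltW // !ltNge le_contract.
have := emeasurable_fun_o_infty measurableT mX (expand a).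
by rewrite setTI.
Qed.

Definition seq_inf u : Omega -> \bar R := fun w => einfs (u ^~ w) 0.

Lemma seq_inf_le u n w : (seq_inf u w <= u n w)%E.
Proof. by apply: ereal_inf_lbound; exists n. Qed.

Lemma le_seq_inf u w x : (forall n, (x <= u n w)%E) -> (x <= seq_inf u w)%E.
Proof. by move=> h; apply: le_ereal_inf_tmp => _ [n _ <-]; exact: h. Qed.

Lemma measurable_seq_inf u : (forall n, measurable_fun setT (u n)) ->
  measurable_fun setT (seq_inf u).
Proof. by move=> mu; exact: (measurable_fun_einfs mu). Qed.

(** Minimises E[contract (inf u)] over all sequences u in C. The map [contract] is strictly
    increasing and bounded, so these expectations exist even for infinite-valued variables and still
    detect a strict decrease of the infimum. *)
Lemma essinf_seq_ex C : C !=set0 -> (forall X, C X -> measurable_fun setT X) ->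
  exists u, (forall n, C (u n)) /\ is_essinf P C (seq_inf u).
Proof.
move=> [X0 CX0] mC.
pose U := [set u : (Omega -> \bar R)^nat | forall n, C (u n)].
pose phi u := \int[P]_w contract (seq_inf u w).
have mI u : U u -> measurable_fun setT (fun w => contract (seq_inf u w)).
  by move=> Uu; apply: measurable_contract; apply: measurable_seq_inf => n; exact: mC.
have iI u : U u -> P.-integrable setT (EFin \o (fun w => contract (seq_inf u w))).
  move=> Uu; apply: measurable_bounded_integrable => //.
  - by rewrite -ge0_fin_numE // fin_num_measure.
  - exact: mI.
  - exists 1; split => // x x1 w _ /=; apply: le_trans (ltW x1); exact: contract_le1.
have mono u v : U u -> U v -> (forall w, (seq_inf u w <= seq_inf v w)%E) -> phi u <= phi v.
  move=> Uu Uv uv; apply: le_Rintegral => //; [exact: iI|exact: iI|].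
  by move=> w _; rewrite le_contract.
pose S := phi @` U.
have S0 : S !=set0 by exists (phi (fun=> X0)); exists (fun=> X0).
have Slb : has_inf S.
  split => //; exists (-1) => _ [u Uu <-].
  have -> : -1 = \int[P]_w (cst (-1) w) :> R.
    by rewrite probability_Rintegral_cst.
  apply: le_Rintegral => //; [exact: finite_measure_integrable_cst|exact: iI|].
  move=> w _; have := contract_le1 (seq_inf u w).
  by rewrite ler_norml => /andP[].
have /choice[uk Huk] : forall k : nat, exists u, U u /\ phi u < inf S + k.+1%:R^-1.
  move=> k; have k0 : 0 < k.+1%:R^-1 :> R by rewrite invr_gt0.
  by have [_ [u Uu <-] h] := inf_adherent k0 Slb; exists u.
(* All minimising sequences are merged into one, whose infimum lies below each of theirs and
   therefore attains the minimum. *)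
pose v n := if unpickle n is Some (k, m) then uk k m else X0.
have Uv : U v.
  move=> n; rewrite /v; case: (unpickle n) => [[k m]|//].
  by have [+ _] := Huk k; exact.
have phiv k : phi v <= phi (uk k).
  have [Uk _] := Huk k; apply: mono => // w; apply: le_seq_inf => m.
  by have := seq_inf_le v (pickle (k, m)) w; rewrite {2}/v pickleK.
have phivE : phi v <= inf S.
  apply/ler_addgt0Pr => e e0.
  have [k /ltW ke] : exists k : nat, k.+1%:R^-1 < e.
    exists (Num.truncn e^-1); rewrite invf_plt ?posrE //.
    exact: truncnS_gt.
  apply: le_trans (phiv k) _; have [_ /ltW h] := Huk k.
  by apply: le_trans h _; rewrite lerD2l.
exists v; split => //; split.
- by apply: measurable_seq_inf => n; exact/mC/Uv.
- move=> X CX.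
  (* Adjoining X to v cannot lower the minimum, so the infimum changes only on a null set. *)
  pose v' n := if n is m.+1 then v m else X.
  have Uv' : U v' by case.
  have le' w : (seq_inf v' w <= seq_inf v w)%E.
    apply: le_seq_inf => n; exact: (seq_inf_le v' n.+1).
  pose D w := contract (seq_inf v w) - contract (seq_inf v' w).
  have iD : P.-integrable setT (EFin \o D).
    exact: (@integrableB _ _ _ P setT measurableT _ _ (iI _ Uv) (iI _ Uv')).
  have D0 w : 0 <= D w by rewrite subr_ge0 le_contract.
  have mA : measurable [set w | (seq_inf v' w < seq_inf v w)%E].
    have := @measurable_lte _ _ _ setT measurableT _ _
      (measurable_seq_inf (fun n => mC _ (Uv' n))) (measurable_seq_inf (fun n => mC _ (Uv n))).
    by rewrite setTI.
  have : P.-negligible [set w | (seq_inf v' w < seq_inf v w)%E].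
    apply: (@Rintegral_pos_null _ _ _ _ _ D) => //.
    + by move=> w /=; rewrite subr_gt0 !ltNge le_contract.
    + have : \int[P]_w D w <= 0.
        rewrite RintegralB //; [|exact: iI|exact: iI].
        rewrite subr_le0; apply: le_trans phivE _.
        by apply: ge_inf; [case: Slb|exists v'].
      apply: le_trans; rewrite (Rintegral_split measurableT mA iD) setTI lerDl.
      exact: Rintegral_ge0.
  apply: negligibleS => w /= /negP; rewrite -ltNge.
  by apply: le_lt_trans; exact: (seq_inf_le v' 0).
- move=> Z mZ hZ.
  have : {ae P, forall w, forall n, (Z w <= v n w)%E}.
    by apply: ae_foralln => n; exact: hZ.
  by apply: filterS => w; exact: le_seq_inf.
Qed.

Lemma is_essinf_unique C Y Y' : is_essinf P C Y -> is_essinf P C Y' ->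
  {ae P, forall w, Y w = Y' w}.
Proof.
move=> [mY lY gY] [mY' lY' gY'].
have := gY' _ mY lY; have := gY _ mY' lY'.
by apply: filterS2 => w a b; apply/eqP; rewrite eq_le a b.
Qed.

Lemma essinfP C : C !=set0 -> (forall X, C X -> measurable_fun setT X) ->
  is_essinf P C (essinf P C).
Proof.
move=> C0 mC; have [u [_ hu]] := essinf_seq_ex C0 mC.
by apply: (xgetPex _ (P := [set Y | is_essinf P C Y])); exists (seq_inf u).
Qed.

Lemma is_esssupN C Y :
  is_esssup P C Y <-> is_essinf P [set (-%E \o X)%E | X in C] (-%E \o Y)%E.
Proof.
split => [[mY uY lY]|[mY lY gY]]; split.
- exact: measurableT_comp.
- by move=> _ [X CX <-]; apply: filterS (uY _ CX) => w /=; rewrite leeN2.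
- move=> Z mZ hZ.
  have : {ae P, forall w, (Y w <= - Z w)%E}.
    apply: lY; first exact: measurableT_comp.
    move=> X CX; apply: filterS (hZ _ (ex_intro2 _ _ X CX erefl)) => w /=.
    by rewrite leeNr.
  by apply: filterS => w /=; rewrite leeNr.
- have -> : Y = (-%E \o (-%E \o Y))%E by apply/funext => w /=; rewrite oppeK.
  exact: measurableT_comp.
- move=> X CX; apply: filterS (lY _ (ex_intro2 _ _ X CX erefl)) => w /=.
  by rewrite leeN2.
- move=> Z mZ hZ.
  have : {ae P, forall w, (- Z w <= - Y w)%E}.
    apply: (gY (-%E \o Z)%E); first exact: measurableT_comp.
    by move=> _ [X CX <-]; apply: filterS (hZ _ CX) => w /=; rewrite leeN2.
  by apply: filterS => w /=; rewrite leeN2.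
Qed.

Lemma esssupP C : C !=set0 -> (forall X, C X -> measurable_fun setT X) ->
  is_esssup P C (esssup P C).
Proof.
move=> [X0 CX0] mC; apply: (xgetPex _ (P := [set Y | is_esssup P C Y])).
have := @essinfP [set (-%E \o X)%E | X in C].
case; first by exists (-%E \o X0)%E; exists X0.
  by move=> _ [X CX <-]; apply: measurableT_comp => //; exact: mC.
move=> mY lY gY; exists (-%E \o essinf P [set (-%E \o X)%E | X in C])%E.
apply/is_esssupN; rewrite (_ : (-%E \o _)%E = essinf P [set (-%E \o X)%E | X in C]) //.
by apply/funext => w /=; rewrite oppeK.
Qed.

End EssInf.

(** * Stopping times *)

Section StoppingTimes.
Context {R : realType} {d : measure_display} {Omega : measurableType d}.
Variables (P : probability Omega R) (T : R) (G : R -> set (set Omega)).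
Hypotheses (T0 : 0 < T) (hG : usual_filtration P T G).
Implicit Types (theta : Omega -> R) (A : set Omega).

Local Notation stopping := (stopping_time T G).
Local Notation alg := (stopped_algebra T G).

Lemma filtration_sub_sigma t : 0 <= t <= T -> sub_sigma (G t).
Proof. by case: hG => h _ _ _ /h. Qed.

Lemma filtration_mono s t : 0 <= s -> s <= t -> t <= T -> G s `<=` G t.
Proof. by case: hG => _ h _ _; exact: h. Qed.

Lemma filtration_null t A : 0 <= t <= T -> P.-negligible A -> G t A.
Proof.
case: hG => _ h _ hN /andP[t0 tT] /hN; exact: h.
Qed.

Lemma stopped_measurable theta A : stopping theta -> alg theta A -> measurable A.
Proof.
move=> [th _] hA; have TT : 0 <= T <= T by rewrite ltW /=.
have [_] := filtration_sub_sigma TT; apply.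
have -> : A = A `&` [set w | theta w <= T].
  apply/seteqP; split => [w Aw|w []//]; split => //=.
  by have /andP[] := th w.
exact: hA.
Qed.

Lemma stopped_sub_sigma theta : stopping theta -> sub_sigma (alg theta).
Proof.
move=> sth; split; last by move=> A; exact: stopped_measurable sth.
split.
- move=> t tT; rewrite set0I; by case: (filtration_sub_sigma tT) => -[].
- move=> A hA t tT; have sG := filtration_sub_sigma tT.
  rewrite (_ : _ `&` _ = [set w | theta w <= t] `\` (A `&` [set w | theta w <= t])); last first.
    by apply/seteqP; split => w /=; [move=> [[_ nA] ht]; split => // -[]|
      move=> [ht nA]; split => //; split => // Aw; apply: nA].
  by apply: sub_sigmaD => //; [case: sth => _; exact|exact: hA].
- move=> F hF t tT; rewrite setI_bigcupl.
  by apply: sub_sigma_bigcup (filtration_sub_sigma tT) _ => n; exact: hF.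
Qed.

Lemma stopped_null theta A : P.-negligible A -> alg theta A.
Proof.
by move=> nA t tT; apply: filtration_null => //; apply: negligibleS nA => w [].
Qed.

Lemma stopping_cst t : 0 <= t <= T -> stopping (cst t).
Proof.
move=> tT; split => [w //|s sT]; have sG := filtration_sub_sigma sT.
have [ts|ts] := boolP (t <= s).
- rewrite (_ : [set _ | _] = setT); first exact: sub_sigmaT.
  by apply/seteqP; split.
- rewrite (_ : [set _ | _] = set0); first by case: sG => -[].
  by apply/seteqP; split => w //=; exact/negP.
Qed.

Lemma stopped_cst t : 0 <= t <= T -> alg (cst t) = G t.
Proof.
move=> tT; apply/seteqP; split => [A hA|A hA s sT].
- have -> : A = A `&` [set w | cst t w <= t].
    by apply/seteqP; split => [w Aw|w []//]; split => //=.
  exact: hA.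
- have [ts|ts] := boolP (t <= s).
  + rewrite (_ : _ `&` _ = A); last by apply/seteqP; split => [w []//|w Aw]; split.
    by move: hA; apply: filtration_mono => //; [case/andP: tT|case/andP: sT].
  + rewrite (_ : _ `&` _ = set0); first by case: (filtration_sub_sigma sT) => -[].
    by apply/seteqP; split => w //= -[_]; exact/negP.
Qed.

(** An a.e. inequality is enough, because the part of the event where theta2 <= t < theta1 is null
    and every G t contains the null sets. *)
Lemma stopped_le theta1 theta2 : stopping theta1 -> stopping theta2 ->
  {ae P, forall w, theta1 w <= theta2 w} -> alg theta1 `<=` alg theta2.
Proof.
move=> s1 s2 le12 A hA t tT; have sG := filtration_sub_sigma tT.
rewrite (_ : _ `&` _ =
  ((A `&` [set w | theta1 w <= t]) `&` [set w | theta2 w <= t]) `|`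
  (A `&` [set w | theta2 w <= t] `&` [set w | t < theta1 w])); last first.
  apply/seteqP; split => w /=; last by case => -[[]].
  by move=> [Aw ht]; have [h|h] := leP (theta1 w) t; [left|right].
apply: sub_sigmaU => //.
- by apply: sub_sigmaI => //; [exact: hA|case: s2 => _; exact].
- apply: filtration_null => //; apply: negligibleS le12 => w /= [[_ h2 h1]].
  by apply/negP; rewrite -ltNge; exact: le_lt_trans h1.
Qed.

(** Enumerates the rationals clamped to [0, t]; the clamping keeps the events {theta <= q} inside G
    t. *)
Let clampq (t : R) (n : nat) : R :=
  if unpickle n is Some q then Num.min t (Num.max 0 (ratr q)) else 0.

Let clampqP t n : 0 <= t -> 0 <= clampq t n <= t.
Proof.
move=> t0; rewrite /clampq; case: (unpickle n) => [q|]; last by rewrite lexx.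
by rewrite le_min t0 le_max lexx /= ge_min lexx.
Qed.

(** If theta2 is still to come at t there is nothing to show; otherwise a rational below t separates
    theta1 from theta2. *)
Lemma stopped_lt theta1 theta2 t : stopping theta1 -> stopping theta2 -> 0 <= t <= T ->
  G t ([set w | theta1 w < theta2 w] `&` [set w | theta1 w <= t]).
Proof.
move=> [r1 s1] [r2 s2] tT; have sG := filtration_sub_sigma tT.
have /andP[t0 tleT] := tT.
rewrite (_ : _ `&` _ =
  ([set w | theta1 w <= t] `\` [set w | theta2 w <= t]) `|`
  (\bigcup_n ([set w | theta1 w <= clampq t n] `\` [set w | theta2 w <= clampq t n]))).
  apply: sub_sigmaU => //; first by apply: sub_sigmaD => //; [exact: s1|exact: s2].
  apply: sub_sigma_bigcup => // n; have /andP[c0 ct] := clampqP n t0.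
  apply: (filtration_mono c0 ct tleT).
  have cT : 0 <= clampq t n <= T by rewrite c0 (le_trans ct).
  by apply: sub_sigmaD; [exact: filtration_sub_sigma|exact: s1|exact: s2].
apply/seteqP; split => w /=.
- move=> [h1 h2]; have [h|h] := leP (theta2 w) t; last first.
    by left; split => //; apply/negP; rewrite -ltNge.
  right; have [q] := rat_in_itvoo h1; rewrite in_itv /= => /andP[q1 q2].
  exists (pickle q) => //=; rewrite /clampq pickleK.
  have q0 : 0 <= ratr q :> R by apply: le_trans (ltW q1); have /andP[] := r1 w.
  rewrite max_r // min_r; last by apply: le_trans (ltW q2) h.
  by split; [exact: ltW|apply/negP; rewrite -ltNge].
- case=> [[h1 /negP]|[n _ /= [h1 /negP]]]; rewrite -ltNge => h2.
    by split => //; exact: le_lt_trans h2.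
  split; first exact: le_lt_trans h2.
  by apply: le_trans h1 _; have /andP[] := clampqP n t0.
Qed.

Lemma stopped_eq theta1 theta2 : stopping theta1 -> stopping theta2 ->
  alg theta1 [set w | theta1 w = theta2 w].
Proof.
move=> s1 s2 t tT; have sG := filtration_sub_sigma tT.
rewrite (_ : _ `&` _ = ([set w | theta1 w <= t] `\`
   ([set w | theta1 w < theta2 w] `&` [set w | theta1 w <= t])) `\`
   ([set w | theta2 w < theta1 w] `&` [set w | theta2 w <= t])); last first.
  apply/seteqP; split => w /=.
    by move=> [-> h]; rewrite ltxx; split; [split => //; case|case].
  move=> [[h1 h2] h3]; split => //.
  have [h|h|//] := ltgtP (theta1 w) (theta2 w); first by case: h2.
  by case: h3; split => //; exact: le_trans (ltW h) h1.
by apply: sub_sigmaD => //; [apply: sub_sigmaD => //; [case: s1 => _; exact|]|];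
  exact: stopped_lt.
Qed.

Lemma stopped_trace theta1 theta2 A : A `<=` [set w | theta1 w = theta2 w] ->
  alg theta1 A -> alg theta2 A.
Proof.
move=> A12 hA t tT.
rewrite (_ : A `&` _ = A `&` [set w | theta1 w <= t]); first exact: hA.
by apply/seteqP; split => w /= [Aw ht]; split => //; move: ht; rewrite (A12 _ Aw).
Qed.

Lemma stopping_lt theta s : stopping theta -> 0 <= s <= T -> G s [set w | theta w < s].
Proof.
move=> sth sT; have := stopped_lt sth (stopping_cst sT) sT.
by rewrite (_ : _ `&` _ = [set w | theta w < s]) //; apply/seteqP;
  split => w /=; [case|move=> h; split => //; exact: ltW].
Qed.

Definition mesh n : R := T / 2 ^+ n.

(** The successor of the integer part makes the grid point strictly larger than t when t < T, so
    that limits along [dyadic_up] are limits from the right. *)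
Definition dyadic_up n (t : R) : R :=
  Num.min T ((Num.truncn (t / mesh n)).+1%:R * mesh n).

Lemma mesh_gt0 n : 0 < mesh n.
Proof. by rewrite divr_gt0 // exprn_gt0. Qed.

Lemma mesh_cvg0 : mesh n @[n --> \oo] --> (0 : R).
Proof.
have -> : (fun n => mesh n) = (fun n => T * (2^-1) ^+ n).
  by apply/funext => n; rewrite /mesh exprVn.
rewrite -(mulr0 T); apply: cvgMr; apply: cvg_expr.
by rewrite gtr0_norm ?invr_gt0 // invf_lt1 // ltr1n.
Qed.

Lemma meshS n : mesh n = 2 * mesh n.+1.
Proof. by rewrite /mesh exprS; field; rewrite expf_neq0. Qed.

Lemma dyadic_up_range n t : 0 <= t <= T -> 0 <= dyadic_up n t <= T.
Proof.
move=> /andP[t0 tT]; rewrite /dyadic_up ge_min lexx /= andbT le_min ltW //=.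
by rewrite mulr_ge0 // ltW // mesh_gt0.
Qed.

Lemma dyadic_up_ge n t : 0 <= t <= T -> t <= dyadic_up n t.
Proof.
move=> /andP[t0 tT]; rewrite /dyadic_up le_min tT /= -ler_pdivrMr ?mesh_gt0 //.
by rewrite ltW // truncnS_gt.
Qed.

Lemma dyadic_up_gt n t : 0 <= t < T -> t < dyadic_up n t.
Proof.
move=> /andP[t0 tT]; rewrite /dyadic_up lt_min tT /= -ltr_pdivrMr ?mesh_gt0 //.
exact: truncnS_gt.
Qed.

Lemma dyadic_up_le n t : 0 <= t -> dyadic_up n t <= t + mesh n.
Proof.
move=> t0; rewrite /dyadic_up ge_min; apply/orP; right.
rewrite -natr1 mulrDl mul1r lerD2r -ler_pdivlMr ?mesh_gt0 //.
by rewrite truncn_le // divr_ge0 // ltW // mesh_gt0.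
Qed.

Lemma dyadic_up_decr n t : 0 <= t -> dyadic_up n.+1 t <= dyadic_up n t.
Proof.
move=> t0; rewrite /dyadic_up le_min ge_min lexx /= ge_min; apply/orP; right.
rewrite [mesh n]meshS [leRHS]mulrA ler_pM2r ?mesh_gt0 // -natrM ler_nat.
set x := t / (2 * mesh n.+1).
have x0 : 0 <= x by rewrite divr_ge0 // mulr_ge0 // ltW // mesh_gt0.
have -> : t / mesh n.+1 = x * 2.
  by rewrite /x; field; rewrite gt_eqF // mesh_gt0.
rewrite truncn_lt_nat; last by rewrite mulr_ge0.
by rewrite natrM ltr_pM2r // truncnS_gt.
Qed.

Lemma dyadic_up_cvg t : 0 <= t <= T -> dyadic_up n t @[n --> \oo] --> t.
Proof.
move=> tT; have /andP[t0 _] := tT.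
apply: (@squeeze_cvgr _ _ _ _ (cst t) (fun n => t + mesh n)).
- by apply: nearW => n; rewrite dyadic_up_ge //= dyadic_up_le.
- exact: cvg_cst.
- by rewrite -[X in _ --> X]addr0; apply: cvgD; [exact: cvg_cst|exact: mesh_cvg0].
Qed.

Lemma stopping_dyadic_up theta n : stopping theta -> stopping (dyadic_up n \o theta).
Proof.
move=> sth; have [r s] := sth; split => [w|t tT]; first exact: dyadic_up_range.
have /andP[t0 tleT] := tT; have sG := filtration_sub_sigma tT.
have [Tt|tT'] := leP T t.
  rewrite (_ : [set _ | _] = setT); first exact: sub_sigmaT.
  apply/seteqP; split => w //= _; apply: le_trans Tt.
  by have /andP[] := dyadic_up_range n (r w).
pose k := Num.truncn (t / mesh n).
have tm0 : 0 <= t / mesh n by rewrite divr_ge0 // ltW // mesh_gt0.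
have kt : k%:R * mesh n <= t by rewrite -ler_pdivlMr ?mesh_gt0 // truncn_le.
have k0 : 0 <= k%:R * mesh n by rewrite mulr_ge0 // ltW // mesh_gt0.
(* The last grid point not after t is k times the mesh. As [dyadic_up] is the first grid point
   strictly after theta, it is at most t exactly when theta lies before that point. *)
rewrite (_ : [set _ | _] = [set w | theta w < k%:R * mesh n]).
  apply: (filtration_mono k0 kt tleT); apply: stopping_lt => //.
  by rewrite k0 (le_trans kt).
apply/seteqP; split => w /=; rewrite /dyadic_up ge_min [T <= t]leNgt tT' /=;
  have /andP[w0 wT] := r w;
  have wm0 : 0 <= theta w / mesh n by rewrite divr_ge0 // ltW // mesh_gt0.
- rewrite -ler_pdivlMr ?mesh_gt0 // => h.
  rewrite -ltr_pdivrMr ?mesh_gt0 //; apply: lt_le_trans (truncnS_gt _) _.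
  by rewrite ler_nat /k truncn_ge_nat.
- rewrite -ltr_pdivrMr ?mesh_gt0 // => h.
  apply: le_trans kt; rewrite ler_pM2r ?mesh_gt0 // ler_nat.
  by rewrite truncn_lt_nat.
Qed.

End StoppingTimes.

(** * Value systems *)

Section ValueSystem.
Context {R : realType} {d : measure_display} {Omega : measurableType d}.
Variables (P : probability Omega R) (T : R) (G : R -> set (set Omega)).
Hypotheses (T0 : 0 < T) (hG : usual_filtration P T G).
Implicit Types (theta : Omega -> R) (A B : set Omega).

Local Notation stopping := (stopping_time T G).
Local Notation alg := (stopped_algebra T G).
Local Notation intg X := (P.-integrable setT (EFin \o X)).

Definition decreasing_to (theta_ : nat -> Omega -> R) theta : Prop :=
  {ae P, forall w, (forall n, theta_ n.+1 w <= theta_ n w) /\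
                   theta_ n w @[n --> \oo] --> theta w}.

Lemma decreasing_to_le (theta_ : nat -> Omega -> R) theta n : decreasing_to theta_ theta ->
  {ae P, forall w, theta w <= theta_ n w}.
Proof.
apply: filterS => w [dec cv].
have nd : nonincreasing_seq (theta_ ^~ w) by apply/nonincreasing_seqP.
have <- : lim (theta_ n w @[n --> \oo]) = theta w by exact/cvg_lim.
by apply: nonincreasing_cvgn_ge => //; apply/cvg_ex; exists (theta w).
Qed.

(* [is_value s Y Adm K]: the random variables [s theta] are the conditional
   essential infima of the costs [Y i] over the actions [i] in [Adm theta],
   expressed through integrals over the events of the stopped algebra. *)
Record is_value (I : Type) (s : (Omega -> R) -> Omega -> R)
    (Y : I -> Omega -> R) (Adm : (Omega -> R) -> set I) (K : Omega -> R) : Prop := {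
  value_measurable : forall theta, stopping theta ->
    sub_measurable (alg theta) (s theta);
  value_integrable : forall theta, stopping theta -> intg (s theta);
  value_le : forall theta i A, stopping theta -> Adm theta i -> alg theta A ->
    \int[P]_(w in A) s theta w <= \int[P]_(w in A) Y i w;
  value_approx : forall theta e, stopping theta -> 0 < e ->
    exists2 i, Adm theta i & \int[P]_w Y i w <= \int[P]_w s theta w + e;
  cost_measurable : forall theta i, stopping theta -> Adm theta i ->
    measurable_fun setT (Y i);
  cost_bound : forall theta i, stopping theta -> Adm theta i ->
    {ae P, forall w, `|Y i w| <= K w};
  bound_integrable : intg K;
  action_le : forall theta1 theta2, stopping theta1 -> stopping theta2 ->
    {ae P, forall w, theta1 w <= theta2 w} -> Adm theta2 `<=` Adm theta1;
  action_paste : forall theta1 theta2 A i, stopping theta1 -> stopping theta2 ->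
    A `<=` [set w | theta1 w = theta2 w] -> alg theta1 A -> Adm theta2 i ->
    exists2 j, Adm theta1 j & {ae P, forall w, A w -> Y j w = Y i w};
  action_delay : forall (theta_ : nat -> Omega -> R) theta i, (forall n, stopping (theta_ n)) ->
    stopping theta -> decreasing_to theta_ theta -> Adm theta i ->
    exists2 j : nat -> I, (forall n, Adm (theta_ n) (j n)) &
      forall e, 0 < e ->
        \forall n \near \oo, \int[P]_w Y (j n) w <= \int[P]_w Y i w + e }.

Variables (I : Type) (s : (Omega -> R) -> Omega -> R) (Y : I -> Omega -> R)
  (Adm : (Omega -> R) -> set I) (K : Omega -> R).
Hypothesis val : is_value s Y Adm K.

Let iK : intg K := bound_integrable val.

Lemma cost_integrable theta i : stopping theta -> Adm theta i -> intg (Y i).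
Proof.
move=> st hi; apply: ae_le_integrable iK; first exact: (cost_bound val st hi).
exact: (cost_measurable val st hi).
Qed.

(** [value_approx] speaks of the whole space only. Subtracting the inequality [value_le] on the
    complement of A localises it. *)
Lemma value_approx_on theta A e : stopping theta -> alg theta A -> 0 < e ->
  exists2 i, Adm theta i & \int[P]_(w in A) Y i w <= \int[P]_(w in A) s theta w + e.
Proof.
move=> st hA e0; have [i hi le] := value_approx val st e0; exists i => //.
have mA := stopped_measurable T0 hG st hA.
have iY := cost_integrable st hi; have is_ := value_integrable val st.
have := value_le val st hi (sub_sigmaC (stopped_sub_sigma T0 hG st) hA).
move: le; rewrite (Rintegral_split measurableT mA iY) (Rintegral_split measurableT mA is_).
rewrite !setTI !setTD; lra.
Qed.

Lemma value_submartingale theta1 theta2 A : stopping theta1 -> stopping theta2 ->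
  {ae P, forall w, theta1 w <= theta2 w} -> alg theta1 A ->
  \int[P]_(w in A) s theta1 w <= \int[P]_(w in A) s theta2 w.
Proof.
move=> s1 s2 le12 hA; apply/ler_addgt0Pr => e e0.
have [i hi le] := value_approx_on s2 (stopped_le hG s1 s2 le12 hA) e0.
apply: le_trans le; apply: (value_le val s1) => //.
exact: (action_le val s1 s2 le12).
Qed.

(** An almost optimal action for theta2 is pasted into one admissible for theta1 with the same cost
    on {theta1 = theta2}. Restrictions to this event are compared, because there the two stopped
    algebras have the same trace. *)
Let value_local_le theta1 theta2 : stopping theta1 -> stopping theta2 ->
  {ae P, forall w, theta1 w = theta2 w -> s theta1 w <= s theta2 w}.
Proof.
move=> s1 s2; pose A := [set w | theta1 w = theta2 w].
have A1 : alg theta1 A by exact: (@stopped_eq _ _ _ P T G hG _ _ s1 s2).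
have mA : measurable A by exact: (@stopped_measurable _ _ _ P T G T0 hG theta1 A s1 A1).
have sig1 := stopped_sub_sigma T0 hG s1.
have restr_meas theta : stopping theta -> A `<=` [set w | theta w = theta1 w] ->
    sub_measurable (alg theta1) (s theta \_ A).
  move=> st At B mB.
  rewrite (_ : _ @^-1` _ = (A `&` (s theta @^-1` B)) `|` (~` A `&` [set _ | B 0])); last first.
    apply/seteqP; split => w /=; rewrite patchE.
      by case: ifPn => [/set_mem Aw Bw|/negP nA B0]; [left|right];
        split => // Aw; apply: nA; exact: mem_set.
    by case=> -[Aw Bw]; [rewrite mem_set|rewrite memNset].
  have At1 : alg theta A by exact: (@stopped_trace _ _ _ T G theta1 theta A (fun w Aw => esym (At w Aw)) A1).
  have AB : alg theta (A `&` s theta @^-1` B).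
    exact: (sub_sigmaI (stopped_sub_sigma T0 hG st) At1 (value_measurable val st mB)).
  have AB1 : alg theta1 (A `&` s theta @^-1` B).
    by apply: (@stopped_trace _ _ _ T G theta theta1 _ _ AB) => w [/At].
  apply: (sub_sigmaU sig1 AB1).
  apply: (sub_sigmaI sig1 (sub_sigmaC sig1 A1)).
  have [B0|B0] := pselect (B 0).
    have -> : [set _ : Omega | B 0] = setT by apply/seteqP; split.
    exact: (sub_sigmaT sig1).
  have -> : [set _ : Omega | B 0] = set0 by apply/seteqP; split.
  by case: sig1 => -[].
have restr_int theta : stopping theta -> intg (s theta \_ A).
  move=> st; have := value_integrable val st.
  move=> /(integrable_sub mA) /(integrable_mkcond _ mA).1.
  by rewrite restrict_EFin.
have : {ae P, forall w, (s theta1 \_ A) w <= (s theta2 \_ A) w}.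
  apply: (sub_le_ae sig1).
  - exact: restr_meas.
  - by apply: restr_meas => // w.
  - exact: restr_int.
  - exact: restr_int.
  - move=> B hB; rewrite -!Rintegral_mkcondr.
    have BA1 : alg theta1 (B `&` A) by exact: (sub_sigmaI sig1).
    have BA2 : alg theta2 (B `&` A) by apply: (stopped_trace _ BA1) => w [].
    have mBA := stopped_measurable T0 hG s1 BA1.
    apply/ler_addgt0Pr => e e0.
    have [i hi le] := value_approx_on s2 BA2 e0.
    have BAsub : B `&` A `<=` [set w | theta1 w = theta2 w] by move=> w [].
    have [j hj ji] := action_paste val s1 s2 BAsub BA1 hi.
    apply: le_trans le; apply: le_trans (value_le val s1 hj BA1) _.
    rewrite (ae_eq_Rintegral mBA _ _ ji) //.
      exact: (cost_measurable val s1 hj).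
    exact: (cost_measurable val s2 hi).
by apply: filterS => w; rewrite !patchE; case: ifPn => // /negP h _ e;
  case: h; exact: mem_set.
Qed.

Lemma value_local theta1 theta2 : stopping theta1 -> stopping theta2 ->
  {ae P, forall w, theta1 w = theta2 w -> s theta1 w = s theta2 w}.
Proof.
move=> s1 s2; apply: filterS2 (value_local_le s1 s2) (value_local_le s2 s1).
by move=> w h1 h2 e; apply/eqP; rewrite eq_le h1 // h2.
Qed.

Lemma value_ge theta A : stopping theta -> alg theta A ->
  - (\int[P]_(w in A) K w) <= \int[P]_(w in A) s theta w.
Proof.
move=> st hA; have mA := stopped_measurable T0 hG st hA.
apply/ler_addgt0Pr => e e0; have [i hi le] := value_approx_on st hA e0.
apply: le_trans le; have iY := cost_integrable st hi.
rewrite -mulN1r -RintegralZl //; last exact: integrable_sub.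
apply: ae_le_Rintegral => //.
  by have := integrableZl measurableT (-1) iK.
apply: filterS (cost_bound val st hi) => w + _.
by rewrite ler_norml mulN1r => /andP[].
Qed.

(** Split by the sign of s theta, which is an event of the stopped algebra: where it is positive,
    the cost of any admissible action dominates it; elsewhere [value_ge] applies. *)
Lemma value_abs_le theta A : stopping theta -> alg theta A ->
  \int[P]_(w in A) `|s theta w| <= \int[P]_(w in A) K w.
Proof.
move=> st hA; have mA := stopped_measurable T0 hG st hA.
have sig := stopped_sub_sigma T0 hG st.
have is_ := value_integrable val st.
pose B := [set w | cst 0 w < s theta w].
have hB : alg theta B.
  by apply: sub_measurable_ltr => //; [exact: sub_measurable_cst|exact: (value_measurable val)].
have mB := stopped_measurable T0 hG st hB.
have AB : alg theta (A `&` B) by exact: (sub_sigmaI sig).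
have AnB : alg theta (A `\` B) by exact: (sub_sigmaD sig).
have mAB := stopped_measurable T0 hG st AB.
have mAnB := stopped_measurable T0 hG st AnB.
rewrite (Rintegral_split mA mB (integrable_norm is_)) (Rintegral_split mA mB iK).
apply: lerD.
- rewrite (@eq_Rintegral _ _ _ P (A `&` B) (s theta)); last first.
    by move=> w /set_mem [_ Bw] /=; rewrite gtr0_norm.
  have [i hi _] := value_approx val st ltr01. apply: le_trans (value_le val st hi AB) _.
  apply: ae_le_Rintegral => //; first exact: cost_integrable st hi.
  apply: filterS (cost_bound val st hi) => w + _.
  by apply: le_trans; exact: ler_norm.
- rewrite (@eq_Rintegral _ _ _ P (A `\` B) (fun w => -1 * s theta w)); last first.
    by move=> w /set_mem [_ /negP] /=; rewrite -leNgt mulN1r => h; rewrite ler0_norm.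
  rewrite RintegralZl //; last exact: integrable_sub.
  by rewrite mulN1r lerNl; exact: value_ge.
Qed.

(** The tail event lies in the stopped algebra, so [value_abs_le] replaces s by K on it, and
    absolute continuity of the integral of K asks only for a small probability. *)
Lemma value_tail e : 0 < e -> exists L0 : R, forall L theta, L0 <= L -> stopping theta ->
  \int[P]_(w in [set w | L < `|s theta w|]) `|s theta w| <= e.
Proof.
move=> e0; have [de [de0 hde]] := integral_normr_continuous iK e0.
have K0 : 0 <= \int[P]_w `|K w| by exact: Rintegral_ge0.
(* By Markov's inequality the tail has probability at most E|K| / L; the added 1 makes this strictly
   smaller than de. *)
exists ((\int[P]_w `|K w| + 1) / de) => L theta L0L st.
have L0 : 0 < L by apply: lt_le_trans L0L; rewrite divr_gt0 // ltr_wpDl.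
pose A := [set w | cst L w < `|s theta w|].
have sig := stopped_sub_sigma T0 hG st; have [sA _] := sig.
have hA : alg theta A.
  apply: sub_measurable_ltr => //; first exact: sub_measurable_cst.
  apply/sub_measurableP => //; apply: measurableT_comp => //.
  by apply/sub_measurableP => //; exact: (value_measurable val).
have mA := stopped_measurable T0 hG st hA.
have is_ := value_integrable val st.
have le1 := value_abs_le st hA.
have le2 : \int[P]_(w in A) K w <= \int[P]_(w in A) `|K w|.
  apply: le_Rintegral => //; [exact: integrable_sub|apply: integrable_sub => //; exact: integrable_norm|].
  by move=> w _; exact: ler_norm.
have PA : (P A < de%:E)%E.
  have PAfin : P A \is a fin_num by exact: fin_num_measure.
  rewrite -(fineK PAfin) lte_fin.
  have : L * fine (P A) <= \int[P]_w `|K w|.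
    rewrite -Rintegral_cst //; apply: (@le_trans _ _ (\int[P]_(w in A) `|s theta w|)).
      apply: le_Rintegral => //; [exact: finite_measure_integrable_cst|
        apply: integrable_sub => //; exact: integrable_norm|].
      by move=> w /= /ltW.
    apply: le_trans le1 _; apply: le_trans le2 _.
    rewrite [leRHS](Rintegral_split measurableT mA (integrable_norm iK)) setTI lerDl.
    by apply: Rintegral_ge0 => w _ /=.
  rewrite -ler_pdivlMl // => /le_lt_trans; apply.
  rewrite mulrC ltr_pdivrMr //; move: L0L; rewrite ler_pdivrMr //; lra.
apply: le_trans le1 _; apply: le_trans le2 _; apply: ltW.
have := hde _ mA PA; rewrite -lte_fin; apply: le_lt_trans.
rewrite fineK //=; apply: integrable_fin_num => //.
by apply: integrable_sub => //; exact: integrable_norm.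
Qed.

Lemma value_right_continuous (theta_ : nat -> Omega -> R) theta A : (forall n, stopping (theta_ n)) ->
  stopping theta -> decreasing_to theta_ theta -> alg theta A ->
  \int[P]_(w in A) s (theta_ n) w @[n --> \oo] --> \int[P]_(w in A) s theta w.
Proof.
move=> st_ st dec hA.
have mA := stopped_measurable T0 hG st hA.
have hC := sub_sigmaC (stopped_sub_sigma T0 hG st) hA.
apply/cvgrPdist_le => e e0; have e2 : 0 < e / 2 by rewrite divr_gt0.
near=> n.
have le_n := decreasing_to_le n dec.
have le1 := value_submartingale st (st_ n) le_n hA.
have le2 := value_submartingale st (st_ n) le_n hC.
(* The submartingale inequality holds on A and on its complement, so neither integral decreases. An
   excess of at most e over the whole space therefore bounds the excess over A. *)
suff : \int[P]_w s (theta_ n) w <= \int[P]_w s theta w + e.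
  rewrite (Rintegral_split measurableT mA (value_integrable val (st_ n))).
  rewrite (Rintegral_split measurableT mA (value_integrable val st)).
  rewrite !setTI !setTD ler_norml; lra.
near: n.
have [i hi lei] := value_approx val st e2.
have [j hj lej] := action_delay val st_ st dec hi.
apply: filterS (lej _ e2) => n len.
have := value_le val (st_ n) (hj n) (sub_sigmaT (stopped_sub_sigma T0 hG (st_ n))).
lra.
Unshelve. all: by end_near. Qed.

End ValueSystem.

(** * Aggregation *)

Section Downcrossings.
Context {R : realType}.
Variables (a b : R).
Implicit Types (z : nat -> R).

(** A hysteresis switch: on above b, off below a, unchanged in between. It is the position held by
    the trading strategy behind the downcrossing inequality. *)
Fixpoint high z i : bool :=
  if i is j.+1 then if b < z i then true else if z i < a then false else high z j
  else b < z 0.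

Fixpoint downcross z i : nat :=
  if i is j.+1 then (downcross z j + (high z j && ~~ high z i))%N else 0%N.

(** The discrete stochastic integral of the position [high]; the position is fixed before the
    increment it multiplies. *)
Definition gain z i : R := \sum_(j < i) (high z j)%:R * (z j.+1 - z j).

Hypothesis ab : a < b.

(* Buying above [b] and selling below [a] loses at least [b - a] per
   downcrossing. *)
Lemma gain_le z i :
  gain z i <= - ((b - a) * (downcross z i)%:R) + (high z i)%:R * (z i - b).
Proof.
elim: i => [|i IH].
  rewrite /gain big_ord0 /= mulr0 oppr0 add0r.
  by case: ltP => h; rewrite ?mul0r // mul1r subr_ge0 ltW.
rewrite /gain big_ord_recr /= -/(gain z i).
case hi: (high z i) IH => IH; rewrite /= ?mul1r ?mul0r in IH *.
- case: (ltP b (z i.+1)) => h1 /=; rewrite ?addn0 ?mul1r; first lra.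
  case: (ltP (z i.+1) a) => h2 /=; rewrite ?addn0 ?mul1r ?mul0r; last lra.
  by rewrite natrD; lra.
- case: (ltP b (z i.+1)) => h1 /=; rewrite ?addn0 ?mul1r; first lra.
  case: (ltP (z i.+1) a) => h2 /=; rewrite ?addn0 ?mul0r; lra.
Qed.

Lemma high_above z i : b < z i -> high z i.
Proof. by case: i => [|i] //= ->. Qed.

Lemma high_below z i : z i < a -> ~~ high z i.
Proof.
move=> h; have hb : (b < z i) = false by apply/negbTE; rewrite -leNgt ltW // (lt_trans h).
by case: i h hb => [|i] /= h ->; rewrite ?h.
Qed.

Lemma downcross_mono z i j : (i <= j)%N -> (downcross z i <= downcross z j)%N.
Proof.
elim: j => [|j IH]; first by rewrite leqn0 => /eqP ->.
rewrite leq_eqVlt => /predU1P[-> //|]; rewrite ltnS => /IH /leq_trans; apply.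
by rewrite /= leq_addr.
Qed.

Lemma downcross_lt z i j : (i < j)%N -> b < z i -> z j < a ->
  (downcross z i < downcross z j)%N.
Proof.
move=> ij /high_above hi /high_below hj.
(* Only the state of the switch matters: it is on at i, so being off at any later index means that
   it has been turned off in between. *)
suff : forall k, (i <= k)%N -> ~~ high z k -> (downcross z i < downcross z k)%N.
  by apply => //; exact: ltnW.
elim=> [|k IH]; first by rewrite leqn0 => /eqP i0; rewrite i0 in hi; rewrite hi.
rewrite leq_eqVlt => /predU1P[ik|]; first by rewrite -ik hi.
rewrite ltnS => ik hk; have [h|h] := boolP (high z k); last first.
  by apply: leq_trans (IH ik h) _; rewrite /= leq_addr.
have -> : downcross z k.+1 = (downcross z k + (high z k && ~~ high z k.+1))%N by [].
by rewrite h hk addn1 ltnS; exact: downcross_mono.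
Qed.

End Downcrossings.

(** The limit is the lower limit sup S. If x exceeded sup S + e frequently, it would be frequently
    below p and above q for some rationals p < q between sup S and sup S + e. *)
Lemma cvg_no_oscillation {R : realType} (F : set_system R) (x : R -> R) (C : R) :
  ProperFilter F -> (\forall s \near F, `|x s| <= C) ->
  (forall p q : rat, ratr p < ratr q :> R ->
     (forall A, F A -> exists2 s, A s & x s < ratr p) ->
     (forall A, F A -> exists2 s, A s & ratr q < x s) -> False) ->
  cvg (x @ F).
Proof.
move=> FF bd osc.
pose S := [set c | \forall s \near F, c <= x s].
have S0 : S !=set0.
  by exists (- C); apply: filterS bd => s; rewrite ler_norml => /andP[].
have SC : ubound S C.
  move=> c Sc; have [s [h1 h2]] := filter_ex (filterI bd Sc).
  by apply: le_trans h2 _; apply: le_trans (ler_norm _) h1.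
have hS : has_sup S by split => //; exists C.
apply/cvg_ex; exists (sup S); apply/cvgrPdist_le => e e0.
have low : \forall s \near F, sup S - e <= x s.
  have [c Sc cs] := sup_adherent e0 hS.
  by apply: filterS Sc => s; apply: le_trans; exact: ltW.
suff up : \forall s \near F, x s <= sup S + e.
  by apply: filterS2 low up => s h1 h2; rewrite ler_norml; apply/andP; split; lra.
apply: contrapT => nup.
have [q] := @rat_in_itvoo _ (sup S) (sup S + e) ltac:(lra).
rewrite in_itv /= => /andP[q1 q2].
have [p] := @rat_in_itvoo _ (sup S) (ratr q) q1.
rewrite in_itv /= => /andP[p1 p2].
apply: (osc p q p2) => A FA; apply: contrapT => h.
- suff : S (ratr p) by move/(ub_le_sup hS.2); rewrite leNgt p1.
  apply: filterS FA => s As; rewrite leNgt; apply/negP => xs.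
  by apply: h; exists s.
- apply: nup; apply: filterS FA => s As; rewrite leNgt; apply/negP => xs.
  by apply: h; exists s => //; apply: lt_trans q2 xs.
Qed.

(** * Limits of a path along dyadic times *)

Section PathRegularisation.
Context {R : realType}.
Variable T : R.
Hypothesis T0 : 0 < T.
Implicit Types (x : R -> R) (t s u v : R).

Definition dyadic : set R := [set t | exists n i, (i <= 2 ^ n)%N /\ t = i%:R * mesh T n].

Lemma mesh_full n : (2 ^ n)%:R * mesh T n = T.
Proof. by rewrite /mesh natrX mulrCA divff ?mulr1 // expf_neq0. Qed.

Lemma dyadic_range t : dyadic t -> 0 <= t <= T.
Proof.
move=> [n [i [i2 ->]]]; have m0 := mesh_gt0 T0 n.
rewrite mulr_ge0 ?(ltW m0) //= -[leRHS](mesh_full n) ler_pM2r //.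
by rewrite ler_nat.
Qed.

Lemma dyadic_T : dyadic T.
Proof. by exists 0, 1; split => //; rewrite -{1}(mesh_full 0) expn0. Qed.

Lemma dyadic_dyadic_up n t : 0 <= t <= T -> dyadic (dyadic_up T n t).
Proof.
move=> /andP[t0 tT]; have m0 := mesh_gt0 T0 n.
rewrite /dyadic_up; have [h|h] := leP T; first exact: dyadic_T.
exists n, (Num.truncn (t / mesh T n)).+1; split => //.
rewrite -(ler_nat R) -(ler_pM2r m0) mesh_full; exact: ltW.
Qed.

Lemma dyadic_dense u v : 0 <= u -> u < v -> u < T -> exists2 s, dyadic s & u < s < v.
Proof.
move=> u0 uv uT; have uT' : 0 <= u <= T by rewrite u0 ltW.
have [n _ hn] : \forall n \near \oo, dyadic_up T n u < v.
  move/cvgrPdist_lt: (dyadic_up_cvg T0 uT') => /(_ (v - u)); rewrite subr_gt0 => /(_ uv).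
  by apply: filterS => n; rewrite ltr_norml => /andP[]; lra.
exists (dyadic_up T n u); first exact: dyadic_dyadic_up.
by rewrite hn //= ?andbT; apply: dyadic_up_gt => //; rewrite u0.
Qed.

Definition grid_index n t : nat := Num.truncn (t / mesh T n).

(** Grids are nested, so a dyadic time belongs to all sufficiently fine grids. Finitely many dyadic
    times are thus eventually seen together. *)
Lemma dyadic_grid s : dyadic s -> exists m, forall n, (m <= n)%N ->
  s = (grid_index n s)%:R * mesh T n /\ (grid_index n s <= 2 ^ n)%N.
Proof.
move=> [m [i [i2 sE]]]; exists m => n mn.
have mm := mesh_gt0 T0 m; have m0 := mesh_gt0 T0 n.
have mE : mesh T m = (2 ^ (n - m))%:R * mesh T n.
  rewrite /mesh -[in X in _ = _ * X](subnK mn) exprD natrX; field; rewrite !expf_neq0 //.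
have -> : grid_index n s = (i * 2 ^ (n - m))%N.
  rewrite /grid_index sE mE mulrA -natrM mulfK ?gt_eqF //.
  exact: natrK.
split; first by rewrite sE mE mulrA -natrM.
by rewrite -[in leqRHS](subnKC mn) expnD leq_mul2r i2 orbT.
Qed.

Definition grid_count (p q : R) x n s : nat :=
  downcross p q (fun i => x (i%:R * mesh T n)) (grid_index n s).

Lemma grid_index_le n s t : s <= t -> (grid_index n s <= grid_index n t)%N.
Proof. by move=> st; apply: le_truncn; rewrite ler_pM2r // invr_gt0 mesh_gt0. Qed.

Lemma grid_count_mono p q x n s t : s <= t -> (grid_count p q x n s <= grid_count p q x n t)%N.
Proof. by move=> st; apply: downcross_mono; exact: grid_index_le. Qed.

Lemma grid_count_lt p q x s t : p < q -> dyadic s -> dyadic t -> s < t ->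
  q < x s -> x t < p ->
  exists m, forall n, (m <= n)%N -> (grid_count p q x n s < grid_count p q x n t)%N.
Proof.
move=> pq ds dt st xs xt.
have [m1 h1] := dyadic_grid ds; have [m2 h2] := dyadic_grid dt.
exists (maxn m1 m2) => n; rewrite geq_max => /andP[/h1[e1 _] /h2[e2 _]].
apply: downcross_lt => //; last 2 first.
- by rewrite -e1.
- by rewrite -e2.
by rewrite -(ltr_nat R) -(ltr_pM2r (mesh_gt0 T0 n)) -e1 -e2.
Qed.

Definition right_dyadic t : set_system R := within dyadic t^'+.
Definition left_dyadic t : set_system R := within dyadic t^'-.

Lemma right_dyadic_filter t : Filter (right_dyadic t).
Proof. exact: within_filter. Qed.

Lemma left_dyadic_filter t : Filter (left_dyadic t).
Proof. exact: within_filter. Qed.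

Local Existing Instance right_dyadic_filter.
Local Existing Instance left_dyadic_filter.

Lemma right_dyadic_ex t A : 0 <= t < T -> right_dyadic t A ->
  forall u, t < u -> exists s, [/\ A s, dyadic s & t < s < u].
Proof.
move=> /andP[t0 tT] /= [e /= e0 he] u tu.
have [s ds /andP[ts su]] := @dyadic_dense t (Num.min u (t + e)) t0 ltac:(by rewrite lt_min tu ltrDl) tT.
move: su; rewrite lt_min => /andP[su se].
exists s; split => //; last by rewrite ts.
apply: he => //=; rewrite ltr_norml; apply/andP; split; lra.
Qed.

Lemma left_dyadic_ex t A : 0 < t <= T -> left_dyadic t A ->
  forall u, u < t -> exists s, [/\ A s, dyadic s & u < s < t].
Proof.
move=> /andP[t0 tT] /= [e /= e0 he] u tu.
have m0 : 0 <= Num.max 0 (Num.max u (t - e)) by rewrite le_max lexx.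
have mt : Num.max 0 (Num.max u (t - e)) < t by rewrite !gt_max t0 tu gtrDl oppr_lt0.
have [s ds /andP[]] := dyadic_dense m0 mt (lt_le_trans mt tT).
rewrite !gt_max => /and3P[s0 su se st].
exists s; split => //; last by rewrite su.
apply: he => //=; rewrite ltr_norml; apply/andP; split; lra.
Qed.

Lemma right_dyadic_proper t : 0 <= t < T -> ProperFilter (right_dyadic t).
Proof.
move=> tT; apply: Build_ProperFilter_ex => A hA.
have [s [As _ _]] := @right_dyadic_ex t A tT hA (t + 1) ltac:(lra).
by exists s.
Qed.

Lemma left_dyadic_proper t : 0 < t <= T -> ProperFilter (left_dyadic t).
Proof.
move=> tT; apply: Build_ProperFilter_ex => A hA.
have [s [As _ _]] := @left_dyadic_ex t A tT hA (t - 1) ltac:(lra).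
by exists s.
Qed.

(** The second clause says that the lower limit over n of the number of downcrossings on grid n is
    finite. A lower limit is what Fatou's lemma controls, and it suffices because a downcrossing
    between dyadic times is seen by every fine enough grid. *)
Definition regular_path x : Prop :=
  (exists C, forall s, dyadic s -> `|x s| <= C) /\
  (forall p q : rat, ratr p < ratr q :> R ->
    ~ (forall k, exists m, forall n, (m <= n)%N -> (k <= grid_count (ratr p) (ratr q) x n T)%N)).

Lemma regular_path_right x t : regular_path x -> 0 <= t < T -> cvg (x s @[s --> right_dyadic t]).
Proof.
move=> [[C hC] osc] tT; have pf := right_dyadic_proper tT.
apply: (@cvg_no_oscillation _ _ _ C).
  by near=> s; apply: hC; near: s; exact: withinT.
move=> p q pq hp hq; apply: (osc p q pq) => k.
have FT A u : right_dyadic t A -> t < u -> right_dyadic t (A `&` [set s | dyadic s /\ t < s < u]).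
  move=> hA tu; apply: filterI => //.
  near=> s; split; [near: s; exact: withinT|].
  apply/andP; split; near: s; apply: cvg_within; [exact: nbhs_right_gt|exact: nbhs_right_lt].
(* Downcrossings accumulate towards t from the right: below u choose a low time s2, before it a high
   time s1, and find the remaining j crossings before s1. *)
have key : forall k u, dyadic u -> t < u -> exists m, forall n, (m <= n)%N ->
    (k <= grid_count (ratr p) (ratr q) x n u)%N.
  elim=> [|j IH] u du tu; first by exists 0.
  have [s2 [_ [d2 /andP[t2 s2u]]] x2] := hp _ (FT _ u filterT tu).
  have [s1 [_ [d1 /andP[t1 s12]]] x1] := hq _ (FT _ s2 filterT t2).
  have [m1 h1] := IH s1 d1 t1.
  have [m2 h2] := grid_count_lt pq d1 d2 s12 x1 x2.
  exists (maxn m1 m2) => n; rewrite geq_max => /andP[n1 n2].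
  apply: leq_ltn_trans (h1 _ n1) _; apply: leq_trans (h2 _ n2) _.
  by apply: grid_count_mono; exact: ltW.
by apply: key; [exact: dyadic_T|case/andP: tT].
Unshelve. all: by end_near. Qed.

Lemma regular_path_left x t : regular_path x -> 0 < t <= T -> cvg (x s @[s --> left_dyadic t]).
Proof.
move=> [[C hC] osc] tT; have pf := left_dyadic_proper tT.
apply: (@cvg_no_oscillation _ _ _ C).
  by near=> s; apply: hC; near: s; exact: withinT.
move=> p q pq hp hq; apply: (osc p q pq) => k.
have FT A u : left_dyadic t A -> u < t -> left_dyadic t (A `&` [set s | dyadic s /\ u < s < t]).
  move=> hA tu; apply: filterI => //.
  near=> s; split; [near: s; exact: withinT|].
  apply/andP; split; near: s; apply: cvg_within; [exact: nbhs_left_gt|exact: nbhs_left_lt].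
(* Here the times increase to t. Each new downcrossing is appended after the time u of the previous
   ones, so u is part of the induction hypothesis. *)
have key : forall k, exists2 u, dyadic u /\ u < t & exists m, forall n, (m <= n)%N ->
    (k <= grid_count (ratr p) (ratr q) x n u)%N.
  elim=> [|j [u [du ut] [m1 h1]]].
    have [s [_ [ds /andP[_ st]]] _] := hp _ (FT _ (t - 1) filterT ltac:(lra)).
    by exists s => //; exists 0.
  have [s1 [_ [d1 /andP[us1 s1t]]] x1] := hq _ (FT _ u filterT ut).
  have [s2 [_ [d2 /andP[s12 s2t]]] x2] := hp _ (FT _ s1 filterT s1t).
  have [m2 h2] := grid_count_lt pq d1 d2 s12 x1 x2.
  exists s2 => //; exists (maxn m1 m2) => n; rewrite geq_max => /andP[n1 n2].
  apply: leq_ltn_trans (h1 _ n1) _; apply: leq_ltn_trans _ (h2 _ n2).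
  by apply: grid_count_mono; exact: ltW.
have [u [du ut] [m h]] := key k; exists m => n mn; apply: leq_trans (h _ mn) _.
apply: grid_count_mono; case/andP: tT => _; exact: le_trans (ltW ut).
Unshelve. all: by end_near. Qed.

(** One formula covers both cases: before T the approximating times decrease strictly to t and give
    the right limit, while at T they are constant and give x T. *)
Definition regularise x t : R := lim (x (dyadic_up T n t) @[n --> \oo]).

Lemma dyadic_up_T n : dyadic_up T n T = T.
Proof.
have TT : 0 <= T <= T by rewrite ltW /=.
apply/eqP; rewrite eq_le; case/andP: (dyadic_up_range T0 n TT) => _ ->.
exact: dyadic_up_ge.
Qed.

Lemma dyadic_up_right t : 0 <= t < T -> dyadic_up T n t @[n --> \oo] --> right_dyadic t.
Proof.
move=> tT; have tT' : 0 <= t <= T by case/andP: tT => -> /ltW.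
move=> A /= [e /= e0 he]; move/cvgrPdist_lt: (dyadic_up_cvg T0 tT') => /(_ _ e0).
apply: filterS => n hn; apply: he => //; last exact: dyadic_dyadic_up.
exact: dyadic_up_gt.
Qed.

Lemma regularise_cvg x t : regular_path x -> 0 <= t <= T ->
  x (dyadic_up T n t) @[n --> \oo] --> regularise x t.
Proof.
move=> rx /andP[t0]; rewrite le_eqVlt => /predU1P[->|tT].
  by rewrite /regularise; under eq_fun do rewrite dyadic_up_T; rewrite lim_cst //; exact: cvg_cst.
have tT' : 0 <= t < T by rewrite t0.
have cx := cvg_comp _ _ (dyadic_up_right tT') (regular_path_right rx tT').
by rewrite /regularise; apply/cvg_ex; eexists; exact: cx.
Qed.

Lemma regularise_right x t : regular_path x -> 0 <= t < T ->
  x s @[s --> right_dyadic t] --> regularise x t.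
Proof.
move=> rx tT; have pf := right_dyadic_proper tT.
have c := regular_path_right rx tT.
have cx := cvg_comp _ _ (dyadic_up_right tT) c.
by rewrite /regularise (cvg_lim _ cx).
Qed.

(** Carries an estimate at dyadic times just after u over to the right limit at u. Both halves of
    the cadlag property follow, with l the right or the left dyadic limit at the time considered. *)
Let regularise_near x u l (e : R) : regular_path x -> 0 <= u < T ->
  (forall v, u < v -> exists w, [/\ u < w, w <= v & forall s, dyadic s -> u < s < w -> `|l - x s| <= e]) ->
  `|l - regularise x u| <= e.
Proof.
move=> rx uT h; have pf := right_dyadic_proper uT.
have [w [uw _ hw]] := h (u + 1) ltac:(lra).
have cl : (`|l - x s|) @[s --> right_dyadic u] --> `|l - regularise x u|.
  apply: cvg_norm; apply: cvgB; first exact: cvg_cst.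
  exact: regularise_right.
rewrite -(cvg_lim _ cl) //; apply: limr_le; first by apply/cvg_ex; eexists; exact: cl.
near=> s; apply: hw; first by near: s; exact: withinT.
apply/andP; split; near: s; apply: cvg_within; [exact: nbhs_right_gt|exact: nbhs_right_lt].
Unshelve. all: by end_near. Qed.

Lemma regularise_cadlag x : regular_path x -> cadlag_path T (regularise x).
Proof.
move=> rx; split=> t tT.
- apply/cvgrPdist_le => e e0; have /andP[t0 tT'] := tT.
  have pf := right_dyadic_proper tT.
  have /cvgrPdist_le /(_ _ e0) [del /= del0 hdel] := regularise_right rx tT.
  near=> u.
  have tu : t < u by near: u; exact: nbhs_right_gt.
  have uT : u < T by near: u; apply: nbhs_right_lt.
  have ud : u < t + del by near: u; apply: nbhs_right_lt; rewrite ltrDl.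
  apply: regularise_near => //.
    by rewrite uT andbT; apply: le_trans (ltW tu).
  move=> v uv; exists (Num.min v (t + del)); split.
  + by rewrite lt_min uv.
  + by rewrite ge_min lexx.
  + move=> s ds /andP[us]; rewrite lt_min => /andP[_ sd]; apply: hdel => //=.
      by rewrite ltr_norml; apply/andP; split; lra.
    lra.
- have pf := left_dyadic_proper tT.
  have cl := regular_path_left rx tT; set l := lim _ in cl.
  apply/cvg_ex; exists l; apply/cvgrPdist_le => e e0.
  have /cvgrPdist_le /(_ _ e0) [del /= del0 hdel] := cl.
  have /andP[t0 tT'] := tT.
  near=> u.
  have tu : u < t by near: u; exact: nbhs_left_lt.
  have ud : t - del < u by near: u; apply: nbhs_left_gt; rewrite gtrDl oppr_lt0.
  apply: regularise_near => //.
    by rewrite (lt_le_trans tu tT') ltW.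
  move=> v uv; exists (Num.min v t); split.
  + by rewrite lt_min uv.
  + by rewrite ge_min lexx.
  + move=> s ds /andP[us]; rewrite lt_min => /andP[_ sd]; apply: hdel => //=.
    by rewrite ltr_norml; apply/andP; split; lra.
Unshelve. all: by end_near. Qed.

End PathRegularisation.

(** * Convergence of integrals of uniformly integrable sequences *)

Section VitaliConvergence.
Context {R : realType} {d : measure_display} {Omega : measurableType d}.
Variable P : probability Omega R.

Local Notation intg X := (P.-integrable setT (EFin \o X)).

Let clamp (L x : R) : R := Num.max (- L) (Num.min L x).

Let clamp_norm L x : 0 <= L -> `|clamp L x| <= L.
Proof.
move=> L0; rewrite /clamp ler_norml le_max lexx /= ge_max ge_min lexx /= andbT.
by rewrite -subr_ge0 opprK addr_ge0.
Qed.

Let clamp_id L x : `|x| <= L -> clamp L x = x.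
Proof. by rewrite ler_norml /clamp => /andP[h1 h2]; rewrite min_r // max_r. Qed.

Let clamp_dist L x : 0 <= L -> `|x - clamp L x| <= `|x|.
Proof.
move=> L0; rewrite /clamp; have [h1|h1] := leP x L; last first.
  rewrite max_r; last by rewrite ge0_cp // ; lra.
  by rewrite !ger0_norm; lra.
have [h2|h2] := leP (- L) x; first by rewrite subrr normr0.
by rewrite !ler0_norm; lra.
Qed.

Let clamp_cts L : continuous (clamp L).
Proof.
move=> x; apply: (@continuous_max _ _ (cst (- L)) (fun x => Num.min L x)); first exact: cvg_cst.
by apply: (@continuous_min _ _ (cst L) id); [exact: cvg_cst|exact: cvg_id].
Qed.

Lemma fatou_ae (g_ : nat -> Omega -> R) (g : Omega -> R) (C : R) :
  (forall n, measurable_fun setT (g_ n)) -> measurable_fun setT g ->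
  (forall n w, 0 <= g_ n w) -> (forall w, 0 <= g w) ->
  {ae P, forall w, g_ n w @[n --> \oo] --> g w} ->
  (forall n, \int[P]_w (g_ n w)%:E <= C%:E)%E -> (\int[P]_w (g w)%:E <= C%:E)%E.
Proof.
move=> mg_ mg g_0 g0 [N [mN N0 hN]] gC.
have mNc : measurable (~` N) by exact: measurableC.
have int_restr (f : Omega -> R) : measurable_fun setT f -> (forall w, 0 <= f w) ->
    (\int[P]_w (f w)%:E = \int[P]_(w in ~` N) (f w)%:E)%E.
  move=> mf f0; rewrite (ge0_negligible_integral mN) ?setTD //.
    exact/measurable_EFinP.
  by move=> w _; rewrite lee_fin.
rewrite int_restr //.
rewrite (eq_integral (fun w => limn_einf (fun n => (g_ n w)%:E))); last first.
  move=> w /set_mem Nw; apply/esym.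
  have cg : (g_ n w)%:E @[n --> \oo] --> (g w)%:E.
    apply: cvg_EFin; first exact: nearW.
    by apply: contrapT => h; apply: Nw; apply: hN.
  by rewrite is_cvg_limn_einfE; [exact/cvg_lim|apply/cvg_ex; eexists; exact: cg].
apply: le_trans (fatou P mNc _ _) _ => //.
- by move=> n; apply: measurable_funTS; exact/measurable_EFinP.
- by move=> n w _; rewrite lee_fin.
- rewrite limn_einf_lim; apply: lime_le; first exact: is_cvg_einfs.
  apply: nearW => n; apply: le_trans (gC n); rewrite (int_restr (g_ n)) //.
  by apply: ereal_inf_lbound; exists n => /=.
Qed.

Let measurable_clamp L (f : Omega -> R) : measurable_fun setT f ->
  measurable_fun setT (fun w => clamp L (f w)).
Proof.
move=> mf; apply: measurable_maxr; first exact: measurable_cst.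
by apply: measurable_minr; [exact: measurable_cst|].
Qed.

(** Truncation at the level L of the tail bound: the error for f_n is controlled by the tail, the
    one for f by Fatou's lemma, and the truncated functions converge by dominated convergence. *)
Lemma uniformly_integrable_cvg (f_ : nat -> Omega -> R) (f : Omega -> R) (C : R) :
  (forall n, intg (f_ n)) -> measurable_fun setT f ->
  {ae P, forall w, f_ n w @[n --> \oo] --> f w} ->
  (forall n, \int[P]_w `|f_ n w| <= C) ->
  (forall e, 0 < e -> exists2 L, 0 <= L &
     forall n, \int[P]_(w in [set w | L < `|f_ n w|]) `|f_ n w| <= e) ->
  intg f /\ forall A, measurable A ->
    \int[P]_(w in A) f_ n w @[n --> \oo] --> \int[P]_(w in A) f w.
Proof.
move=> if_ mf cvf fC tail.
have mf_ n : measurable_fun setT (f_ n) by exact: integrable_measurable (if_ n).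
have if_n n : intg (fun w => `|f_ n w|) by exact: integrable_norm.
have mnf : measurable_fun setT (fun w => `|f w|) by exact: measurableT_comp.
have intf : intg f.
  apply/integrableP; split; first exact/measurable_EFinP.
  apply: (@le_lt_trans _ _ C%:E); last exact: ltry.
  apply: (@fatou_ae (fun n w => `|f_ n w|) (fun w => `|f w|)) => //.
  - by move=> n; exact: measurableT_comp.
  - by apply: filterS cvf => w; exact: cvg_norm.
  - by move=> n; rewrite -Rintegral_EFin // lee_fin.
split => // A mA; apply/cvgrPdist_le => e e0.
(* Three errors of e / 4 are added at the end. *)
have e4 : 0 < e / 4 by rewrite divr_gt0.
have [L L0 hL] := tail _ e4.
pose c n w := clamp L (f_ n w).
pose g n w : R := `|f_ n w - c n w|.
have mc n : measurable_fun setT (c n) by exact: measurable_clamp.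
have mcf : measurable_fun setT (fun w => clamp L (f w)) by exact: measurable_clamp.
have mg n : measurable_fun setT (g n).
  by apply: measurableT_comp => //; exact: measurable_funB.
have ig n : intg (g n).
  apply: (ae_le_integrable _ (mg n) (if_n n)); apply: aeW => w.
  by rewrite /g normr_id; exact: clamp_dist.
have ic n : intg (c n).
  apply: (@ae_le_integrable _ _ _ _ _ (cst L)) => //; last exact: finite_measure_integrable_cst.
  by apply: aeW => w; exact: clamp_norm.
have icf : intg (fun w => clamp L (f w)).
  apply: (@ae_le_integrable _ _ _ _ _ (cst L)) => //; last exact: finite_measure_integrable_cst.
  by apply: aeW => w; exact: clamp_norm.
have igf : intg (fun w => `|f w - clamp L (f w)|).
  apply: (ae_le_integrable _ _ (integrable_norm intf)).
    by apply: aeW => w; rewrite normr_id; exact: clamp_dist.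
  by apply: measurableT_comp => //; exact: measurable_funB.
have gle n : \int[P]_w g n w <= e / 4.
  apply: le_trans (hL n).
  have mB : measurable [set w | L < `|f_ n w|].
    have := @measurable_fun_ltr.
    have mL : measurable_fun setT (cst L : Omega -> R) by [].
    have mn : measurable_fun setT (fun w => `|f_ n w|) by exact: integrable_measurable (if_n n).
    have := measurable_lte measurableT ((measurable_EFinP _ _).2 mL) ((measurable_EFinP _ _).2 mn).
    by rewrite setTI.
  rewrite (Rintegral_split measurableT mB (ig n)) setTI.
  have -> : \int[P]_(w in setT `\` [set w | L < `|f_ n w|]) g n w = 0.
    rewrite (@eq_Rintegral _ _ _ P _ (cst 0)); last first.
      move=> w /set_mem [_ /negP]; rewrite -leNgt => h.
      by rewrite /g /c clamp_id // subrr normr0.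
    by rewrite Rintegral_cst ?mul0r //; exact: measurableD.
  rewrite addr0; apply: le_Rintegral => //; [exact: integrable_sub..|].
  by move=> w _; exact: clamp_dist.
have gfle : \int[P]_w `|f w - clamp L (f w)| <= e / 4.
  rewrite -lee_fin Rintegral_EFin //.
  apply: (@fatou_ae g) => //.
  - exact: integrable_measurable igf.
  - by move=> n w; exact: normr_ge0.
  - apply: filterS cvf => w h; apply: cvg_norm; apply: cvgB => //.
    exact: (continuous_cvg _ (@clamp_cts L (f w)) h).
  - by move=> n; rewrite -Rintegral_EFin // lee_fin.
have [_ _ cvc] : [/\ P.-integrable A (EFin \o (fun w => clamp L (f w))),
    (\int[P]_(w in A) `|(c n w)%:E - (clamp L (f w))%:E| @[n --> \oo] --> 0)%E &
    (\int[P]_(w in A) (c n w)%:E @[n --> \oo] --> \int[P]_(w in A) (clamp L (f w))%:E)%E].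
  apply: (@dominated_convergence _ _ _ P A mA (fun n => EFin \o c n) _ (cst L%:E)).
  - by move=> n; apply: measurable_funTS; exact/measurable_EFinP.
  - by apply: measurable_funTS; exact/measurable_EFinP.
  - apply: filterS cvf => w h _; apply: cvg_EFin; first exact: nearW.
    exact: (continuous_cvg _ (@clamp_cts L (f w)) h).
  - exact: finite_measure_integrable_cst.
  - by apply: aeW => w n _; rewrite lee_fin; exact: clamp_norm.
have {}cvc : \int[P]_(w in A) c n w @[n --> \oo] --> \int[P]_(w in A) clamp L (f w).
  apply: fine_cvg; rewrite fineK //.
  by apply: integrable_fin_num => //; exact: integrable_sub.
move/cvgrPdist_le: cvc => /(_ _ e4); apply: filterS => n hn.
have le_part (u v : Omega -> R) : intg u -> intg v -> intg (fun w => `|u w - v w|) ->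
    \int[P]_w `|u w - v w| <= e / 4 ->
    `|\int[P]_(w in A) u w - \int[P]_(w in A) v w| <= e / 4.
  move=> iu iv iuv h; rewrite -RintegralB //; [|exact: integrable_sub..].
  apply: le_trans (le_normr_Rintegral mA _) _.
    apply: integrable_sub => //.
    exact: (@integrableB _ _ _ P setT measurableT _ _ iu iv).
  apply: le_trans h; rewrite [leRHS](Rintegral_split measurableT mA iuv) setTI lerDl.
  by apply: Rintegral_ge0.
have h1 := le_part _ _ (if_ n) (ic n) (ig n) (gle n).
have h2 := le_part _ _ intf icf igf gfle.
move: h1 h2 hn; rewrite !ler_norml => /andP[? ?] /andP[? ?] /andP[? ?].
by apply/andP; split; lra.
Qed.

End VitaliConvergence.

(** * Sub-sigma-algebras containing the null sets *)

Section NullSets.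
Context {R : realType} {d : measure_display} {Omega : measurableType d}.
Variables (P : probability Omega R) (H : set (set Omega)).
Hypotheses (hH : sub_sigma H) (nullH : forall N, P.-negligible N -> H N).

Lemma sub_measurable_ae d' (U : measurableType d') (X Y : Omega -> U) :
  {ae P, forall w, X w = Y w} -> sub_measurable H X -> sub_measurable H Y.
Proof.
move=> XY mX B mB; set N := [set w | X w <> Y w].
have HN : H N by apply: nullH; exact: XY.
have -> : Y @^-1` B = (X @^-1` B `\` N) `|` (Y @^-1` B `&` N).
  apply/seteqP; split => w /=.
    by move=> YB; have [h|h] := pselect (X w = Y w); [left; rewrite h; split => // /(_ h)|right].
  by case=> [[+ /contrapT h]|[]//]; rewrite h.
apply: (sub_sigmaU hH).
  by apply: (sub_sigmaD hH) => //; exact: mX.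
apply: nullH; apply: negligibleS XY => w [_]; exact.
Qed.

Lemma sub_measurable_cvg (f_ : nat -> Omega -> R) (f : Omega -> R) :
  (forall n, sub_measurable H (f_ n)) ->
  {ae P, forall w, f_ n w @[n --> \oo] --> f w} -> sub_measurable H f.
Proof.
move=> mf cf; have [sH _] := hH.
set N := ~` [set w | f_ n w @[n --> \oo] --> f w].
have HN : H N by exact: nullH cf.
have HNc : H (~` N) by exact: sub_sigmaC.
apply: (@sub_measurable_ae _ _ (f \_ (~` N))).
  by apply: filterS cf => w h; have Nw : (~` N) w by [move=> /(_ h)]; rewrite patchE (mem_set Nw).
apply/sub_measurableP => //.
apply: (@measurable_fun_cvg _ (g_sigma_algebraType H) R setT (fun n => f_ n \_ (~` N)) (f \_ (~` N))) => //.
- move=> n; apply/measurable_restrict => //.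
    exact/(measurable_OmegaH hH).
  by apply: measurable_funTS; apply/sub_measurableP.
- move=> w _; rewrite patchE; case: ifPn => [/set_mem /contrapT|] h.
    have Nw : (~` N) w by move=> /(_ h).
    by under eq_fun do rewrite patchE (mem_set Nw).
  by under eq_fun do rewrite patchE (negbTE h); exact: cvg_cst.
Qed.

End NullSets.

(** * Regularity of almost every path of a value system *)

Section RegularPaths.
Context {R : realType} {d : measure_display} {Omega : measurableType d}.
Variables (P : probability Omega R) (T : R) (G : R -> set (set Omega)).
Hypotheses (T0 : 0 < T) (hG : usual_filtration P T G).
Variables (I : Type) (s : (Omega -> R) -> Omega -> R) (Y : I -> Omega -> R)
  (Adm : (Omega -> R) -> set I) (K : Omega -> R).
Hypothesis val : is_value P T G s Y Adm K.
Implicit Types (theta : Omega -> R) (A B : set Omega).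

Local Notation stopping := (stopping_time T G).
Local Notation alg := (stopped_algebra T G).
Local Notation intg X := (P.-integrable setT (EFin \o X)).

Let x t w := s (cst t) w.
Let grid n i : R := i%:R * mesh T n.

Let grid_range n i : (i <= 2 ^ n)%N -> 0 <= grid n i <= T.
Proof. by move=> h; apply: dyadic_range => //; exists n, i. Qed.

Let x_integrable t : 0 <= t <= T -> intg (x t).
Proof. by move=> tT; apply: (value_integrable val); exact: stopping_cst hG _ tT. Qed.

Let x_measurable t : 0 <= t <= T -> sub_measurable (G t) (x t).
Proof.
move=> tT; have := value_measurable val (stopping_cst hG tT).
by rewrite (stopped_cst hG tT).
Qed.

Let grid_mono n i j : (i <= j)%N -> grid n i <= grid n j.
Proof. by move=> ij; rewrite ler_pM2r ?ler_nat // mesh_gt0. Qed.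

Let G_grid n i j : (i <= j)%N -> (j <= 2 ^ n)%N -> G (grid n i) `<=` G (grid n j).
Proof.
move=> ij jn; have /andP[g0 _] := grid_range (leq_trans ij jn).
have /andP[_ gT] := grid_range jn.
by apply: (filtration_mono hG g0 _ gT); exact: grid_mono.
Qed.

Section Crossing.
Variables (a b : R) (n : nat).
Hypothesis ab : a < b.

Let z w i := x (grid n i) w.

Let high_measurable i : (i <= 2 ^ n)%N -> G (grid n i) [set w | high a b (z w) i].
Proof.
elim: i => [|i IH] hi; have sG := filtration_sub_sigma hG (grid_range hi);
  have mz := x_measurable (grid_range hi).
  by apply: (@sub_measurable_ltr _ _ _ _ (cst b) (x (grid n 0)) sG) => //; exact: sub_measurable_cst.
have -> : [set w | high a b (z w) i.+1] =
    [set w | cst b w < x (grid n i.+1) w] `|`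
    ([set w | high a b (z w) i] `\` [set w | x (grid n i.+1) w < cst a w]).
  apply/seteqP; split => w /=; rewrite /z.
    case: ltP => h1 /=; first by left.
    by case: ltP => h2 //; right; split => //; apply/negP; rewrite -leNgt.
  case=> [->//|[h1 /negP]]; rewrite -leNgt => h2.
  by case: ltP => // _; rewrite ltNge h2.
apply: (sub_sigmaU sG).
  by apply: (@sub_measurable_ltr _ _ _ _ (cst b) (x (grid n i.+1)) sG) => //; exact: sub_measurable_cst.
apply: (sub_sigmaD sG).
  by apply: (G_grid (leqnSn i) hi); apply: IH; exact: ltnW.
by apply: (@sub_measurable_ltr _ _ _ _ (x (grid n i.+1)) (cst a) sG) => //; exact: sub_measurable_cst.
Qed.

Let high_measurableT i : (i <= 2 ^ n)%N -> measurable [set w | high a b (z w) i].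
Proof. by move=> hi; have [_] := filtration_sub_sigma hG (grid_range hi); apply; exact: high_measurable. Qed.

(** The position held from the grid point N on is known at that point, so the new term is a
    submartingale increment integrated over an event of the filtration at that point. *)
Let gain_ge0 N : (N <= 2 ^ n)%N ->
  intg (fun w => gain a b (z w) N) /\ 0 <= \int[P]_w gain a b (z w) N.
Proof.
elim: N => [|N IH] hN.
  have -> : (fun w => gain a b (z w) 0) = cst 0 by apply/funext => w; rewrite /gain big_ord0.
  split; first exact: integrable0.
  by rewrite probability_Rintegral_cst.
have [iN gN] := IH (ltnW hN).
pose D w := x (grid n N.+1) w - x (grid n N) w.
pose A := [set w | high a b (z w) N].
have iN1 := x_integrable (grid_range hN).
have iN0 := x_integrable (grid_range (ltnW hN)).
have iD : intg D by exact: (@integrableB _ _ _ P setT measurableT _ _ iN1 iN0).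
have mA : measurable A by exact: high_measurableT (ltnW hN).
have iDA : intg (D \_ A).
  by have := (integrable_mkcond _ mA).1 (integrable_sub mA iD); rewrite restrict_EFin.
have gE w : gain a b (z w) N.+1 = gain a b (z w) N + (D \_ A) w.
  rewrite /gain big_ord_recr /=; congr (_ + _); rewrite patchE /A.
  case: ifPn => [/set_mem /= ->|/negP]; first by rewrite mul1r.
  by rewrite inE => /negP/negbTE ->; rewrite mul0r.
split.
  rewrite (_ : (fun w => _) = (fun w => gain a b (z w) N + (D \_ A) w)); last exact/funext.
  exact: (@integrableD _ _ _ P setT measurableT _ _ iN iDA).
rewrite (_ : (fun w => _) = (fun w => gain a b (z w) N + (D \_ A) w)); last exact/funext.
rewrite RintegralD // addr_ge0 // -Rintegral_mkcond.
rewrite RintegralB //; [|exact: integrable_sub..].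
rewrite subr_ge0; apply: (value_submartingale T0 hG val).
- exact: stopping_cst hG _ (grid_range (ltnW hN)).
- exact: stopping_cst hG _ (grid_range hN).
- by apply: aeW => w /=; exact: grid_mono.
- rewrite (stopped_cst hG (grid_range (ltnW hN))).
  exact: high_measurable (ltnW hN).
Qed.

Lemma downcross_measurable N : (N <= 2 ^ n)%N ->
  measurable_fun setT (fun w => (downcross a b (fun i => x (i%:R * mesh T n) w) N)%:R : R).
Proof.
rewrite -/(grid n _); elim: N => [|N IH] hN; first exact: measurable_cst.
have -> : (fun w => (downcross a b (fun i => x (i%:R * mesh T n) w) N.+1)%:R : R) =
   (fun w => (downcross a b (fun i => x (i%:R * mesh T n) w) N)%:R +
     \1_([set w | high a b (z w) N] `\` [set w | high a b (z w) N.+1]) w).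
  apply/funext => w; rewrite [downcross _ _ _ N.+1]/= -/(high _ _ _ N.+1) natrD.
  congr (_ + _); rewrite indicE in_setD; congr (nat_of_bool (_ && ~~ _))%:R.
    by apply/idP/idP; rewrite inE.
  by apply/idP/idP; rewrite inE.
apply: measurable_funD; first exact: IH (ltnW hN).
by apply: measurable_indic; apply: measurableD; apply: high_measurableT => //; exact: ltnW.
Qed.

(** [gain_le] solved for the number of downcrossings and integrated, the expected gain being
    nonnegative. The bound depends neither on n nor on N, because the mean of K dominates that of
    every |x t|. *)
Lemma downcross_integral N : (N <= 2 ^ n)%N ->
  (\int[P]_w ((downcross a b (fun i => x (i%:R * mesh T n) w) N)%:R)%:E <=
   ((\int[P]_w `|K w| + `|b|) / (b - a))%:E)%E.
Proof.
move=> hN.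
have [ig g0] := gain_ge0 hN.
have iN := x_integrable (grid_range hN).
pose D w : R := (downcross a b (z w) N)%:R.
pose B w := (b - a)^-1 * (`|x (grid n N) w| + `|b| - gain a b (z w) N).
have ba0 : 0 < b - a by rewrite subr_gt0.
have DB w : D w <= B w.
  rewrite /B -ler_pdivrMl ?invr_gt0 // invrK.
  have := gain_le a b (z w) N; rewrite -/(D w).
  have : (high a b (z w) N)%:R * (z w N - b) <= `|x (grid n N) w| + `|b|.
    have hn : z w N - b <= `|x (grid n N) w| + `|b|.
      by apply: lerD; [exact: ler_norm|rewrite -normrN ler_norm].
    case: high; rewrite ?mul1r ?mul0r //; exact: addr_ge0.
  lra.
have iab : intg (fun w => `|x (grid n N) w| + `|b|).
  by apply: (@integrableD _ _ _ P setT measurableT (fun w => `|x (grid n N) w|%:E) (fun=> `|b|%:E));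
    [exact: integrable_norm|exact: finite_measure_integrable_cst].
have iB' : intg (fun w => `|x (grid n N) w| + `|b| - gain a b (z w) N).
  exact: (@integrableB _ _ _ P setT measurableT _ _ iab ig).
have iB : intg B by exact: (integrableZl measurableT (b - a)^-1 iB').
have mD : measurable_fun setT D by exact: downcross_measurable.
have iD : intg D.
  apply: ae_le_integrable iB => //; apply: aeW => w.
  by rewrite ger0_norm.
rewrite -/(D _) -Rintegral_EFin // lee_fin.
apply: le_trans (le_Rintegral measurableT iD iB (fun w _ => DB w)) _.
rewrite RintegralZl // mulrC ler_pM2r ?invr_gt0 //.
rewrite RintegralB // RintegralD //; [|exact: integrable_norm|exact: finite_measure_integrable_cst].
have -> : \int[P]_w `|b| = `|b| by exact: probability_Rintegral_cst.
have st := stopping_cst hG (grid_range hN).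
have h1 : \int[P]_w `|x (grid n N) w| <= \int[P]_w K w.
  exact: (@value_abs_le _ _ _ P T G T0 hG _ _ _ _ _ val _ setT st (sub_sigmaT (stopped_sub_sigma T0 hG st))).
have h2 : \int[P]_w K w <= \int[P]_w `|K w|.
  have iK := bound_integrable val.
  apply: le_Rintegral => //; first exact: integrable_norm.
  by move=> w _; exact: ler_norm.
move: h1 h2 g0; rewrite /z; lra.
Qed.

End Crossing.

Let grid_index_T n : grid_index T n T = (2 ^ n)%N.
Proof.
rewrite /grid_index -[X in X / _](mesh_full T n) mulfK ?gt_eqF ?mesh_gt0 //.
exact: natrK.
Qed.

(** By Fatou's lemma the lower limit over the grids has a finite mean; counts eventually exceeding
    every k would make it infinite. *)
Let downcross_finite (a b : R) : a < b ->
  {ae P, forall w, ~ forall k, exists m, forall n, (m <= n)%N ->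
     (k <= grid_count T a b (x ^~ w) n T)%N}.
Proof.
move=> ab.
pose D n w : \bar R := ((downcross a b (fun i => x (i%:R * mesh T n) w) (2 ^ n)%N)%:R)%:E.
pose C : \bar R := ((\int[P]_w `|K w| + `|b|) / (b - a))%:E.
have mD n : measurable_fun setT (D n).
  by apply/measurable_EFinP; exact: downcross_measurable.
have D0 n w : (0 <= D n w)%E by rewrite lee_fin.
pose g w := limn_einf (D ^~ w).
have mg : measurable_fun setT g.
  have -> : g = (-%E \o (fun w => limn_esup (fun n => - D n w)))%E.
    apply/funext => w; rewrite /g /=; transitivity (- - limn_einf (D ^~ w))%E.
      by rewrite oppeK.
    by rewrite -limn_esupN.
  apply: measurableT_comp => //; apply: measurable_fun_limn_esup => n.
  exact: measurableT_comp.
have g0 w : (0 <= g w)%E.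
  rewrite /g limn_einf_lim; apply: lime_ge; first exact: is_cvg_einfs.
  by apply: nearW => n; apply: le_ereal_inf_tmp => _ [m _ <-].
have gC : (\int[P]_w g w <= C)%E.
  apply: le_trans (fatou P measurableT mD (fun n w _ => D0 n w)) _.
  rewrite limn_einf_lim; apply: lime_le; first exact: is_cvg_einfs.
  apply: nearW => n; apply: le_trans (downcross_integral ab (leqnn (2 ^ n))).
  by apply: ereal_inf_lbound; exists n => /=.
have ig : P.-integrable setT g.
  apply/integrableP; split => //; under eq_integral => w _ do rewrite gee0_abs //.
  by apply: le_lt_trans gC _; rewrite ltry.
apply: filterS (integrable_ae measurableT ig) => w /(_ Logic.I) gfin h.
suff : (g w = +oo)%E by move=> gy; rewrite gy in gfin.
apply/eqyP => r r0; rewrite /g limn_einf_lim.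
have [k rk] : exists k : nat, r <= k%:R.
  by exists (Num.truncn r).+1; rewrite ltW // truncnS_gt.
have [m hm] := h k.
apply: lime_ge; first exact: is_cvg_einfs.
exists m => // n /= mn; apply: le_ereal_inf_tmp => _ [j /= nj <-].
rewrite /D lee_fin; apply: le_trans rk _; rewrite ler_nat.
have := hm j (leq_trans mn nj); rewrite /grid_count.
by rewrite grid_index_T.
Qed.

Section Maximal.
Variables (c : R) (n : nat).

Let B i := [set w | c < `|x (grid n i) w|].
Let U j := \big[setU/set0]_(i < j) B i.

Let B_measurable i : (i <= 2 ^ n)%N -> G (grid n i) (B i).
Proof.
move=> hi; have sG := filtration_sub_sigma hG (grid_range hi).
apply: (@sub_measurable_ltr _ _ _ _ (cst c) (fun w => `|x (grid n i) w|) sG).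
  exact: sub_measurable_cst.
have [sig _] := sG; apply/sub_measurableP => //; apply: measurableT_comp => //.
by apply/sub_measurableP => //; exact: x_measurable (grid_range hi).
Qed.

Let U_measurable j : (j <= 2 ^ n)%N -> G (grid n j) (U j).
Proof.
elim: j => [|j IH] hj; have sG := filtration_sub_sigma hG (grid_range hj).
  by rewrite /U big_ord0; case: sG => -[].
rewrite /U big_ord_recr /= -/(U j); apply: (sub_sigmaU sG).
  by apply: (G_grid (leqnSn j) hj); apply: IH; exact: ltnW.
by apply: (G_grid (leqnSn j) hj); apply: B_measurable; exact: ltnW.
Qed.

(* Decompose the event according to the first time at which [c] is exceeded. *)
Lemma maximal_inequality :
  measurable (\big[setU/set0]_(i < (2 ^ n).+1) [set w | c < `|s (cst (i%:R * mesh T n)) w|]) /\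
  c * fine (P (\big[setU/set0]_(i < (2 ^ n).+1)
    [set w | c < `|s (cst (i%:R * mesh T n)) w|])) <= \int[P]_w `|K w|.
Proof.
rewrite -/(U _).
have iK := bound_integrable val; have inK := integrable_norm iK.
have mT j : (j <= 2 ^ n)%N -> forall A, G (grid n j) A -> measurable A.
  by move=> hj; case: (filtration_sub_sigma hG (grid_range hj)).
have key j : (j <= (2 ^ n).+1)%N -> measurable (U j) /\
    c * fine (P (U j)) <= \int[P]_(w in U j) `|K w|.
  elim: j => [|j IH] hj.
    by rewrite /U big_ord0; split => //; rewrite measure0 mulr0 Rintegral_set0.
  have [mU le] := IH (ltnW hj); have hj' : (j <= 2 ^ n)%N by [].
  have GU := U_measurable hj'; have GB := B_measurable hj'.
  have sG := filtration_sub_sigma hG (grid_range hj').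
  have GD : G (grid n j) (B j `\` U j) by exact: (sub_sigmaD sG).
  have mD := mT j hj' _ GD.
  have UE : U j.+1 = U j `|` (B j `\` U j).
    rewrite /U big_ord_recr /= -/(U j); apply/seteqP; split => w.
      by have [h|h] := pselect (U j w); [left|case=> // hB; right].
    by case=> [|[]]; [left|right].
  have dis : [disjoint U j & B j `\` U j] by apply/disj_setPS => w [h [_]].
  have mE : measurable (U j `|` (B j `\` U j)) by exact: measurableU.
  rewrite UE; split => //.
  rewrite Rintegral_setU //; last exact: integrable_sub.
  rewrite measureU //; last by apply/eqP; rewrite -disj_set2E.
  rewrite fineD ?fin_num_measure // mulrDr; apply: lerD => //.
  have st := stopping_cst hG (grid_range hj').
  apply: (@le_trans _ _ (\int[P]_(w in B j `\` U j) `|x (grid n j) w|)).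
    rewrite -Rintegral_cst //; apply: le_Rintegral => //.
    - exact: finite_measure_integrable_cst.
    - by apply: integrable_sub => //; apply: integrable_norm; exact: x_integrable (grid_range hj').
    - by move=> w [/ltW].
  apply: (@le_trans _ _ (\int[P]_(w in B j `\` U j) K w)).
    apply: (@value_abs_le _ _ _ P T G T0 hG _ _ _ _ _ val _ (B j `\` U j) st).
    by rewrite (stopped_cst hG (grid_range hj')).
  apply: le_Rintegral => //; [exact: integrable_sub..|].
  by move=> w _; exact: ler_norm.
have [mU le] := key _ (leqnn _); split => //; apply: le_trans le _.
rewrite [leRHS](Rintegral_split measurableT mU inK) setTI lerDl.
by apply: Rintegral_ge0 => w _ /=.
Qed.

End Maximal.

(** The maximal inequality is uniform in the grid, so the probability of exceeding k + 1 at some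
    dyadic time is at most E|K| / (k + 1). *)
Let bounded_ae : {ae P, forall w, exists C : R, forall t, dyadic T t -> `|x t w| <= C}.
Proof.
pose V k n := \big[setU/set0]_(i < (2 ^ n).+1)
  [set w | k.+1%:R < `|s (cst (i%:R * mesh T n)) w|].
have VP k n w : V k n w <-> exists2 i, (i <= 2 ^ n)%N & k.+1%:R < `|x (grid n i) w|.
  rewrite /V -(bigcup_mkord _ (fun i => [set w | k.+1%:R < `|s (cst (i%:R * mesh T n)) w|])).
  by split=> [[i hi hw]|[i hi hw]]; exists i.
have mV k n : measurable (V k n) by have [] := maximal_inequality k.+1%:R n.
have ndV k : nondecreasing_seq (V k).
  apply/nondecreasing_seqP => n; apply/subsetPset => w /VP[i hi hw].
  (* Point i of one grid is point 2 i of the next. *)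
  apply/VP; exists (2 * i)%N; first by rewrite expnS leq_mul2l.
  by rewrite /grid mulnC natrM -mulrA -meshS.
have mW k : measurable (\bigcup_n V k n) by exact: bigcupT_measurable.
have PW k : fine (P (\bigcup_n V k n)) <= (\int[P]_w `|K w|) / k.+1%:R.
  have cv := nondecreasing_cvg_mu (mV k) (mW k) (ndV k) : P (V k n) @[n --> \oo] --> P (\bigcup_n V k n).
  rewrite -lee_fin fineK ?fin_num_measure // -(cvg_lim _ cv) //.
  apply: lime_le; first by apply/cvg_ex; eexists; exact: cv.
  apply: nearW => n; have [_ le] := maximal_inequality k.+1%:R n.
  rewrite -[leLHS]fineK ?fin_num_measure // lee_fin ler_pdivlMr // mulrC.
  exact: le.
pose N := \bigcap_k \bigcup_n V k n.
have mN : measurable N by exact: bigcapT_measurable.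
have PN : P N = 0%E.
  have h k : fine (P N) <= (\int[P]_w `|K w|) / k.+1%:R.
    apply: le_trans (PW k); apply: fine_le; rewrite ?fin_num_measure //.
    by apply: le_measure; rewrite ?inE //; move=> w; exact.
  rewrite -[LHS]fineK ?fin_num_measure //; congr EFin; apply/eqP.
  rewrite eq_le fine_ge0 // andbT; apply/ler_addgt0Pr => e e0; rewrite add0r.
  (* With this k, the number k + 1 exceeds E|K| / e, which makes the bound smaller than e. *)
  apply: le_trans (h (Num.truncn ((\int[P]_w `|K w|) / e))) _.
  rewrite ler_pdivrMr // -ler_pdivrMl // mulrC ltW //; exact: truncnS_gt.
exists N; split => // w /=; apply: contra_notP => Nw.
have [k] : exists k, ~ (\bigcup_n V k n) w.
  by apply: contrapT => h; apply: Nw => k _; apply: contrapT => h'; apply: h; exists k.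
move=> hk; exists k.+1%:R => t [n [i [hi ->]]]; rewrite leNgt; apply/negP => hlt.
by apply: hk; exists n => //; apply/VP; exists i.
Qed.

Lemma regular_path_ae : {ae P, forall w, regular_path T (fun t => s (cst t) w)}.
Proof.
have h : {ae P, forall w, forall pq : rat * rat, ratr pq.1 < ratr pq.2 :> R ->
    ~ forall k, exists m, forall n, (m <= n)%N ->
      (k <= grid_count T (ratr pq.1) (ratr pq.2) (x ^~ w) n T)%N}.
  have : {ae P, forall w, forall j : nat, let pq := odflt (0%Q, 0%Q) (unpickle j) in
    ratr pq.1 < ratr pq.2 :> R ->
    ~ forall k, exists m, forall n, (m <= n)%N ->
      (k <= grid_count T (ratr pq.1) (ratr pq.2) (x ^~ w) n T)%N}.
    apply: ae_foralln => j /=; set pq := odflt _ _.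
    have [lt|ge] := ltP (ratr pq.1 : R) (ratr pq.2).
      by apply: filterS (downcross_finite lt) => w.
    by apply: aeW => w.
  by apply: filterS => w hw pq; have := hw (pickle pq); rewrite pickleK.
apply: filterS2 bounded_ae h => w h1 h2; split => // p q pq.
exact: (h2 (p, q) pq).
Qed.

End RegularPaths.

(** * The aggregated process *)

Section Aggregation.
Context {R : realType} {d : measure_display} {Omega : measurableType d}.
Variables (P : probability Omega R) (T : R) (G : R -> set (set Omega)).
Hypotheses (T0 : 0 < T) (hG : usual_filtration P T G).
Variables (I : Type) (s : (Omega -> R) -> Omega -> R) (Y : I -> Omega -> R)
  (Adm : (Omega -> R) -> set I) (K : Omega -> R).
Hypothesis val : is_value P T G s Y Adm K.
Variable S : (Omega -> R) -> Omega -> \bar R.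
Hypothesis S_measurable : forall theta, stopping_time T G theta ->
  sub_measurable (stopped_algebra T G theta) (S theta).
Hypothesis S_ae : forall theta, stopping_time T G theta ->
  {ae P, forall w, S theta w = (s theta w)%:E}.
Implicit Types (theta : Omega -> R) (A B : set Omega).

Local Notation stopping := (stopping_time T G).
Local Notation alg := (stopped_algebra T G).
Local Notation intg X := (P.-integrable setT (EFin \o X)).

Let x t w := s (cst t) w.

(** The value 0 on irregular paths makes every path cadlag, as [cadlag] demands, and not merely
    almost every one. *)
Definition aggregate t w : R :=
  if `[< regular_path T (x ^~ w) >] then regularise T (x ^~ w) t else 0.

Lemma aggregate_cadlag : cadlag T aggregate.
Proof.
move=> w; have [h|h] := pselect (regular_path T (x ^~ w)).
  rewrite (_ : aggregate ^~ w = regularise T (x ^~ w)); first exact: regularise_cadlag.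
  by apply/funext => t; rewrite /aggregate asboolT.
rewrite (_ : aggregate ^~ w = cst 0); last first.
  by apply/funext => t; rewrite /aggregate asboolF.
by split => t _; [exact: cvg_cst|exact: is_cvg_cst].
Qed.

Let up theta n : Omega -> R := dyadic_up T n \o theta.

Let stopping_up theta n : stopping theta -> stopping (up theta n).
Proof. exact: stopping_dyadic_up T0 hG _ n. Qed.

Let up_decreasing theta : stopping theta -> decreasing_to P (up theta) theta.
Proof.
move=> [r _]; apply: aeW => w; split => [n|].
  by apply: dyadic_up_decr => //; have /andP[] := r w.
exact: dyadic_up_cvg.
Qed.

(** The time [up theta n] takes countably many values, so by [value_local] the variable s at that
    time is a.e. the path of s at constant times, evaluated at [up theta n w]. *)
Lemma aggregate_limit theta : stopping theta ->
  {ae P, forall w, s (up theta n) w @[n --> \oo] --> aggregate (theta w) w}.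
Proof.
move=> st; have [r _] := st.
have grid_range m i : (i <= 2 ^ m)%N -> 0 <= i%:R * mesh T m <= T.
  by move=> h; apply: dyadic_range => //; exists m, i.
have h : {ae P, forall w, forall n, s (up theta n) w = x (up theta n w) w}.
  apply: ae_foralln => n.
  have : {ae P, forall w, forall j : nat, let mi := odflt (0, 0)%N (unpickle j) in
      (mi.2 <= 2 ^ mi.1)%N -> up theta n w = mi.2%:R * mesh T mi.1 ->
      s (up theta n) w = x (mi.2%:R * mesh T mi.1) w}.
    apply: ae_foralln => j /=; set mi := odflt _ _.
    have [le|ge] := boolP (mi.2 <= 2 ^ mi.1)%N; last exact: aeW.
    have := value_local T0 hG val (stopping_up n st) (stopping_cst hG (grid_range _ _ le)).
    by apply: filterS => w hw _ e; rewrite hw.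
  apply: filterS => w hw.
  have [m [i [im e]]] := dyadic_dyadic_up T0 n (r w).
  have := hw (pickle (m, i)); rewrite pickleK /= => /(_ im e) ->.
  by rewrite -e.
apply: filterS2 h (regular_path_ae T0 hG val) => w hw reg.
under eq_fun do rewrite hw.
rewrite /aggregate; case: asboolP => // _; exact: regularise_cvg.
Qed.

(** The approximations from index m on are all measurable for the stopped algebra of [up theta m],
    hence so is their limit, for every m. Right-continuity of the filtration then brings this down
    to theta. *)
Lemma aggregate_measurable theta : stopping theta ->
  sub_measurable (alg theta) (fun w => aggregate (theta w) w).
Proof.
move=> st B mB; set A := _ @^-1` B; have [r sth] := st.
have hA m : alg (up theta m) A.
  have sm := stopping_up m st.
  have sig := stopped_sub_sigma T0 hG sm.
  apply: (@sub_measurable_cvg _ _ _ P _ sig _ (fun n => s (up theta (n + m))) (fun w => aggregate (theta w) w)) mB.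
  - by move=> N nN; exact: (@stopped_null _ _ _ P T G hG (up theta m) N nN).
  - move=> n B' mB'.
    have le : {ae P, forall w, up theta (n + m) w <= up theta m w}.
      apply: aeW => w; have /andP[w0 _] := r w; elim: n => [//|n IH].
      by apply: le_trans IH; rewrite addSn; exact: dyadic_up_decr.
    apply: (stopped_le hG (stopping_up (n + m) st) sm le).
    exact: (value_measurable val (stopping_up (n + m) st)).
  - apply: filterS (aggregate_limit st) => w hw.
    by rewrite (cvg_shiftn m (fun n => s (up theta n) w)).
(* For u > t a fine mesh gives up theta m <= u whenever theta <= t. At u = T any m will do, which
   covers t = T, where no later u exists. *)
have key t u : 0 <= t -> t <= u -> u <= T -> (u = T \/ t < u) -> G u (A `&` [set w | theta w <= t]).
  move=> t0 tu uT hu.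
  have uT' : 0 <= u <= T by rewrite uT (le_trans t0 tu).
  have sG := filtration_sub_sigma hG uT'.
  have [m hm] : exists m, forall w, theta w <= t -> up theta m w <= u.
    case: hu => [->|tu'].
      by exists 0 => w _; have /andP[] := dyadic_up_range T0 0 (r w).
    have e0 : 0 < u - t by rewrite subr_gt0.
    have /cvgrPdist_lt /(_ _ e0) [m _ /(_ m (leqnn m)) hm] := @mesh_cvg0 _ T.
    exists m => w wt; apply: le_trans (dyadic_up_le T0 _ _) _; first by have /andP[] := r w.
    move: hm; rewrite sub0r normrN ger0_norm ?(ltW (mesh_gt0 T0 m)) // => hm.
    lra.
  have -> : A `&` [set w | theta w <= t] =
      (A `&` [set w | up theta m w <= u]) `&` [set w | theta w <= t].
    apply/seteqP; split => w /=; last by case=> -[].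
    by move=> [Aw wt]; split => //; split => //; exact: hm.
  apply: (sub_sigmaI sG); first exact: hA.
  by apply: (filtration_mono hG t0 tu uT); apply: sth; rewrite t0 (le_trans tu).
move=> t /andP[t0]; rewrite le_eqVlt => /predU1P[tE|tT].
  by apply: key => //; [rewrite tE|left].
have [_ _ rc _] := hG.
apply: (rc t); first by rewrite t0.
by move=> u /=; rewrite in_itv /= => /andP[tu uT]; apply: key => //; [exact: ltW|right].
Qed.

(** Over an event of the stopped algebra, the integrals of s at the times [up theta n] have two
    limits: that of s theta by right-continuity, and that of the aggregate by uniform
    integrability. *)
Lemma aggregate_eq theta : stopping theta ->
  {ae P, forall w, s theta w = aggregate (theta w) w}.
Proof.
move=> st; have sig := stopped_sub_sigma T0 hG st.
have mM := aggregate_measurable st.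
have st_ n := stopping_up n st.
have [iM cM] : intg (fun w => aggregate (theta w) w) /\ forall A, measurable A ->
    \int[P]_(w in A) s (up theta n) w @[n --> \oo] --> \int[P]_(w in A) aggregate (theta w) w.
  apply: (@uniformly_integrable_cvg _ _ _ P (fun n => s (up theta n)) _ (\int[P]_w K w)).
  - by move=> n; exact: (value_integrable val).
  - exact: sub_measurable_fun sig mM.
  - exact: aggregate_limit.
  - move=> n; have sn := stopped_sub_sigma T0 hG (st_ n).
    exact: (@value_abs_le _ _ _ P T G T0 hG _ _ _ _ _ val _ setT (st_ n) (sub_sigmaT sn)).
  - move=> e e0; have [L0 hL] := value_tail T0 hG val e0.
    exists (Num.max 0 L0); first by rewrite le_max lexx.
    by move=> n; apply: hL => //; rewrite le_max lexx orbT.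
apply: (sub_eq_ae sig (value_measurable val st) mM (value_integrable val st) iM).
move=> A hA; have mA := stopped_measurable T0 hG st hA.
have c1 := @value_right_continuous _ _ _ P T G T0 hG _ _ _ _ _ val _ _ A st_ st (up_decreasing st) hA.
have c2 := cM A mA.
by rewrite -(cvg_lim _ c1) // -(cvg_lim _ c2).
Qed.

Let S_fun theta : stopping theta -> measurable_fun setT (S theta).
Proof. by move=> st; exact: sub_measurable_fun (stopped_sub_sigma T0 hG st) (S_measurable st). Qed.

Let S_integrable theta : stopping theta -> P.-integrable setT (S theta).
Proof.
move=> st; have iS := value_integrable val st.
apply/integrableP; split; first exact: S_fun.
rewrite (_ : (\int[P]_w `|S theta w|)%E = (\int[P]_w `|(s theta w)%:E|)%E).
  by case/integrableP: iS.
apply: ae_eq_integral => //.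
- by apply: measurableT_comp => //; exact: S_fun.
- by apply: measurableT_comp => //; exact: measurable_int iS.
- by apply: filterS (S_ae st) => w /= ->.
Qed.

Lemma value_submartingale_system : submartingale_system P T G S.
Proof.
split.
- split=> [theta|theta1 theta2 s1 s2]; first exact: S_measurable.
  apply: filterS3 (S_ae s1) (S_ae s2) (value_local T0 hG val s1 s2) => w -> -> h e.
  by rewrite h.
- by move=> theta; exact: S_integrable.
- move=> theta1 theta2 s1 s2 le12.
  have sig := stopped_sub_sigma T0 hG s1.
  have [Y2 [mY iY intY eY]] := condexp_integrable sig (value_integrable val s2) (S_fun s2) (S_ae s2).
  have le : {ae P, forall w, s theta1 w <= Y2 w}.
    apply: (sub_le_ae sig (value_measurable val s1) mY (value_integrable val s1) iY) => A hA.
    by rewrite intY //; exact: (value_submartingale T0 hG val s1 s2 le12 hA).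
  by apply: filterS3 (S_ae s1) eY le => w -> ->; rewrite lee_fin.
Qed.

Lemma value_right_continuous_in_expectation : right_continuous_in_expectation P T G S.
Proof.
move=> theta_ theta st_ st dec.
have intE eta : stopping eta -> (\int[P]_w S eta w)%E = (\int[P]_w s eta w)%:E.
  move=> se; rewrite Rintegral_EFin //; last exact: (value_integrable val).
  apply: ae_eq_integral => //.
  - exact: S_fun.
  - exact: measurable_int (value_integrable val se).
  - by apply: filterS (S_ae se) => w /= ->.
rewrite intE //; under eq_fun do rewrite intE //.
apply: cvg_EFin; first exact: nearW.
exact: (@value_right_continuous _ _ _ P T G T0 hG _ _ _ _ _ val _ _ setT st_ st dec
  (sub_sigmaT (stopped_sub_sigma T0 hG st))).
Qed.

Lemma value_class_D : class_D P T G S.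
Proof.
pose D (L : R) : \bar R := ereal_sup [set (\int[P]_(w in [set w | L%:E < `|S theta w|]) `|S theta w|)%E
            | theta in stopping].
have T0T : 0 <= (0 : R) <= T by apply/andP; split => //; exact: ltW.
have D0 L : (0 <= D L)%E.
  apply: (@le_trans _ _ (\int[P]_(w in [set w | L%:E < `|S (cst 0%R) w|]) `|S (cst 0%R) w|)%E).
    exact: integral_ge0.
  by apply: ereal_sup_ubound; exists (cst 0) => //; exact: stopping_cst hG _ T0T.
have Dle e : 0 < e -> exists L0, forall L, L0 <= L -> (D L <= e%:E)%E.
  move=> e0; have [L0 hL] := value_tail T0 hG val e0.
  exists L0 => L LL; apply: ub_ereal_sup => _ [theta st <-].
  have is_ := value_integrable val st.
  have mS : measurable_fun setT (fun w => `|S theta w|%E).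
    by apply: measurableT_comp => //; exact: S_fun.
  have ms : measurable_fun setT (fun w => `|(s theta w)%:E|%E).
    by apply: measurableT_comp => //; exact: measurable_int is_.
  have mA : measurable [set w | (L%:E < `|S theta w|)%E].
    by have := emeasurable_fun_o_infty measurableT mS L%:E; rewrite setTI.
  have mB : measurable [set w | (L%:E < `|(s theta w)%:E|)%E].
    by have := emeasurable_fun_o_infty measurableT ms L%:E; rewrite setTI.
  (* The domains for S and s differ by a null set, so both integrals are first extended to the whole
     space. *)
  rewrite integral_mkcond (_ : (\int[P]_w _)%E =
    (\int[P]_w ((fun w => `|(s theta w)%:E|%E) \_ [set w | (L%:E < `|(s theta w)%:E|)%E]) w)%E); last first.
    apply: ae_eq_integral => //.
    - by apply/measurable_restrict => //; exact: measurable_funTS.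
    - by apply/measurable_restrict => //; exact: measurable_funTS.
    - apply: filterS (S_ae st) => w ew _; rewrite !patchE ew.
      by congr (if _ then _ else _); apply/idP/idP; rewrite !inE /= ew.
  rewrite -integral_mkcond.
  rewrite (_ : [set w | (L%:E < `|(s theta w)%:E|)%E] = [set w | L < `|s theta w|]); last first.
    by apply/seteqP; split => w /=; rewrite lte_fin.
  rewrite -Rintegral_EFin ?lee_fin; [exact: hL| |exact: integrable_norm].
  by have := mB; rewrite (_ : [set w | (L%:E < `|(s theta w)%:E|)%E] = [set w | L < `|s theta w|]) //;
    apply/seteqP; split => w /=; rewrite lte_fin.
have Dfin e : 0 < e -> exists L0, forall L, L0 <= L -> D L \is a fin_num /\ (D L <= e%:E)%E.
  move=> e0; have [L0 hL] := Dle e e0; exists L0 => L /hL le; split => //.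
  by rewrite ge0_fin_numE //; exact: le_lt_trans le (ltry _).
suff : D L @[L --> +oo] --> 0%E by [].
apply/fine_cvgP; split.
  have [L0 hL] := Dfin 1 ltr01; exists L0; split; first exact: num_real.
  by move=> L /ltW /hL[].
apply/cvgrPdist_le => e e0; have [L0 hL] := Dfin e e0.
exists L0; split; first exact: num_real.
move=> L /ltW /hL[fin le]; rewrite sub0r normrN ger0_norm ?fine_ge0 //.
by rewrite -lee_fin fineK.
Qed.

Let aggregate_aggregates : aggregates P T G aggregate S.
Proof.
have MC t : 0 <= t <= T -> sub_measurable (G t) (aggregate t).
  move=> tT; have := aggregate_measurable (stopping_cst hG tT).
  by rewrite (stopped_cst hG tT).
split.
  move=> B mB; apply: sub_sigma_algebra; exists aggregate, B; split => //.
  exact: aggregate_cadlag.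
move=> theta st; apply: filterS2 (S_ae st) (aggregate_eq st) => w ->.
by move=> ->.
Qed.

Lemma value_uniquely_aggregated : uniquely_aggregated P T (submartingale P T) G S.
Proof.
have cM := aggregate_cadlag.
have MC t : 0 <= t <= T -> sub_measurable (G t) (aggregate t).
  move=> tT; have := aggregate_measurable (stopping_cst hG tT).
  by rewrite (stopped_cst hG tT).
have ME t (tT : 0 <= t <= T) := aggregate_eq (stopping_cst hG tT).
have MI t : 0 <= t <= T -> intg (aggregate t).
  move=> tT; apply: (ae_eq_integrable (ME t tT)).
    exact: sub_measurable_fun (filtration_sub_sigma hG tT) (MC t tT).
  exact: (value_integrable val (stopping_cst hG tT)).
exists aggregate; split => //.
- split => // u t u0 ut tT.
  have tT' : 0 <= t <= T by rewrite tT (le_trans u0).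
  have uT' : 0 <= u <= T by rewrite u0 (le_trans ut).
  have sG := filtration_sub_sigma hG uT'; have [_ GM] := sG.
  have mE : measurable_fun setT (EFin \o aggregate t).
    by apply/measurable_EFinP; exact: integrable_measurable (MI t tT').
  have [Y2 [mY iY intY eY]] := condexp_integrable sG (MI t tT') mE (aeW _ (fun w => erefl)).
  suff le : {ae P, forall w, aggregate u w <= Y2 w}.
    by apply: filterS2 eY le => w ->; rewrite lee_fin.
  apply: (sub_le_ae sG (MC u uT') mY (MI u uT') iY) => A hA.
  have mA := GM _ hA.
  have mt r (rT : 0 <= r <= T) := integrable_measurable (MI r rT).
  have ms r (rT : 0 <= r <= T) := integrable_measurable (value_integrable val (stopping_cst hG rT)).
  have ME' r (rT : 0 <= r <= T) : \int[P]_(w in A) aggregate r w = \int[P]_(w in A) s (cst r) w.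
    apply: ae_eq_Rintegral => //; [exact: mt|exact: ms|].
    by apply: filterS (ME r rT) => w ->.
  rewrite (intY A hA) (ME' u uT') (ME' t tT').
  apply: (value_submartingale T0 hG val (stopping_cst hG uT') (stopping_cst hG tT')).
    exact: aeW.
  by rewrite (stopped_cst hG uT').
- move=> M' cM' [_ aM'].
  have eq t : 0 <= t <= T -> {ae P, forall w, aggregate t w = M' t w}.
    move=> tT; have st := stopping_cst hG tT.
    have [_ aM] := aggregate_aggregates.
    by apply: filterS2 (aM _ st) (aM' _ st) => w -> [].
  (* Constant times are stopping times, which gives agreement at countably many times outside one
     null set; right-continuity propagates it to all of [0, T]. *)
  have eqd : {ae P, forall w, forall t, dyadic T t -> aggregate t w = M' t w}.
    have : {ae P, forall w, forall j : nat, let mi := odflt (0, 0)%N (unpickle j) in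
        (mi.2 <= 2 ^ mi.1)%N -> aggregate (mi.2%:R * mesh T mi.1) w = M' (mi.2%:R * mesh T mi.1) w}.
      apply: ae_foralln => j /=; set mi := odflt _ _.
      have [le|ge] := boolP (mi.2 <= 2 ^ mi.1)%N; last exact: aeW.
      have rT : 0 <= mi.2%:R * mesh T mi.1 <= T by apply: dyadic_range => //; exists mi.1, mi.2.
      by apply: filterS (eq _ rT) => w hw _.
    apply: filterS => w hw t [m [i [im ->]]].
    by have := hw (pickle (m, i)); rewrite pickleK; apply.
  apply: filterS eqd => w hw t /andP[t0]; rewrite le_eqVlt => /predU1P[->|tT].
    by apply: hw; exact: dyadic_T.
  have tT' : 0 <= t < T by rewrite t0.
  have lim_up (r : R -> R) : cadlag_path T r -> r (dyadic_up T n t) @[n --> \oo] --> r t.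
    move=> [rr _]; apply: cvg_comp (rr t tT').
    apply: cvg_trans (dyadic_up_right T0 tT') _.
    exact: cvg_within.
  have c1 := lim_up _ (cM w); have c2 := lim_up _ (cM' w).
  have E : (fun n => aggregate (dyadic_up T n t) w) = (fun n => M' (dyadic_up T n t) w).
    by apply/funext => n; apply: hw; apply: dyadic_dyadic_up => //; rewrite t0 ltW.
  by rewrite -(cvg_lim _ c1) // E; exact: cvg_lim c2.
Qed.

End Aggregation.

Section MeasurableComparison.
Context {R : realType} {d : measure_display} {W : measurableType d}.
Implicit Types f g : W -> R.

Lemma measurable_lt_set f g : measurable_fun setT f -> measurable_fun setT g ->
  measurable [set w | f w < g w].
Proof.
by move=> mf mg; have := measurable_fun_ltr mf mg measurableT (Y := [set true]) I; rewrite setTI.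
Qed.

Lemma measurable_le_set f g : measurable_fun setT f -> measurable_fun setT g ->
  measurable [set w | f w <= g w].
Proof.
by move=> mf mg; have := measurable_fun_ler mf mg measurableT (Y := [set true]) I; rewrite setTI.
Qed.

Lemma measurable_eq_set f g : measurable_fun setT f -> measurable_fun setT g ->
  measurable [set w | f w = g w].
Proof.
move=> mf mg.
rewrite [X in measurable X](_ : _ = [set w | f w <= g w] `&` [set w | g w <= f w]).
  by apply: measurableI; exact: measurable_le_set.
apply/seteqP; split=> w /=; first by move=> ->; rewrite lexx.
by case=> a b; apply/eqP; rewrite eq_le a b.
Qed.

End MeasurableComparison.

Definition uniform01 {R : realType} : probability (measurableTypeR R) R :=
  uniform_prob (@ltr01 R).

#[local] Instance uniform01_ae_filter (R : realType) :
  Filter (almost_everywhere (@uniform01 R)) := ae_filter_ringOfSetsType _.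

(** * Quantile representation of Stieltjes measures *)

Section Quantile.
Context {R : realType}.
Variable T : R.
Hypothesis T0 : 0 < T.
Implicit Types (r : R -> R) (t u c : R).
Local Notation U := (@uniform01 R).

Definition monotone_path r : Prop :=
  [/\ cadlag_path T r, 0 <= r 0 & {in `[0, T] &, {homo r : s t / s <= t}}].

(* The generalised inverse inf {t | u <= r t}; adjoining T to the set makes
   [quantile_le] an equivalence for every u, also above r T. *)
Definition quantile r u : R := inf [set t | 0 <= t <= T /\ (t = T \/ u <= r t)].

Let quantile_has_inf r u : has_inf [set t | 0 <= t <= T /\ (t = T \/ u <= r t)].
Proof.
split; first by exists T; split; [rewrite ltW//= lexx|left].
by exists 0 => t [/andP[]].
Qed.

Lemma quantile_range r u : 0 <= quantile r u <= T.
Proof.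
have [ne lb] := quantile_has_inf r u; apply/andP; split.
  by apply: lb_le_inf => // t [/andP[]].
by apply: ge_inf => //; split; [rewrite ltW//= lexx|left].
Qed.

Lemma quantile_le r u t : monotone_path r -> 0 <= t <= T ->
  (quantile r u <= t) = (t == T) || (u <= r t).
Proof.
move=> [[rc _] _ mono] t0T; have [ne lb] := quantile_has_inf r u.
apply/idP/idP; last first.
  by move=> h; apply: ge_inf => //; split=> //; case/orP: h => [/eqP|]; [left|right].
apply: contraTT; rewrite negb_or -!real_ltNge ?num_real// => /andP[tT rtu].
have {}tT : t < T by rewrite lt_neqAle tT; case/andP: t0T.
have t0 : 0 <= t by case/andP: t0T.
(* Right-continuity keeps r below u on some [t, t + e), so the infimum is at least min(t + e, T). *)
have := rc t; rewrite t0 tT => /(_ isT) /cvgr_lt /(_ _ rtu).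
rewrite near_withinE => /nbhs_ballP[e /= e0 he].
apply: (@lt_le_trans _ _ (Num.min (t + e) T)).
  by rewrite lt_min tT ltrDl e0.
apply: lb_le_inf => // s [/andP[s0 sT]]; rewrite ge_min => -[->|us]; first by rewrite lexx orbT.
rewrite leNgt; apply/orP; left; apply/negP => ste.
have [st|ts] := leP s t.
  by have := mono _ _ _ _ st; rewrite !in_itv/= s0 sT t0 ltW// => /(_ isT isT); lra.
have := he s; rewrite /= /ball/= ltr_distlC => /(_ _ ts); lra.
Qed.

Lemma quantile_lt r u t : monotone_path r -> 0 <= t <= T -> 
  (t < quantile r u) = (t < T) && (r t < u).
Proof.
move=> mr tT; rewrite real_ltNge ?num_real// quantile_le// negb_or -real_ltNge ?num_real//.
by rewrite [t < T]lt_neqAle; case/andP: tT => _ ->; rewrite andbT.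
Qed.

Lemma measurable_quantile d (W : measurableType d) (X : R -> W -> R) (V : W -> R) :
  (forall t, 0 <= t <= T -> measurable_fun setT (X t)) ->
  (forall w, monotone_path (X ^~ w)) -> measurable_fun setT V ->
  measurable_fun setT (fun w => quantile (X ^~ w) (V w)).
Proof.
move=> mX pX mV mT; apply: (measurability _ (RGenOInfty.measurableE R)) => //.
move=> _ [_ [t ->] <-]; rewrite setTI.
have [t0|t0] := ltP t 0.
  rewrite [X in measurable X](_ : _ = setT)//; apply/seteqP; split=> // w _ /=.
  by rewrite in_itv/= andbT; have /andP[] := quantile_range (X ^~ w) (V w); lra.
have [tT|tT] := ltP t T; last first.
  rewrite [X in measurable X](_ : _ = set0)//; apply/seteqP; split=> // w /=.
  by rewrite in_itv/= andbT; have /andP[] := quantile_range (X ^~ w) (V w); lra.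
rewrite [X in measurable X](_ : _ = [set w | X t w < V w]).
  apply: measurable_lt_set => //.
  by apply: mX; rewrite t0 ltW.
by apply/seteqP; split=> w /=; rewrite in_itv/= andbT quantile_lt ?t0 ?(ltW tT)//= tT.
Qed.

Lemma measurable_path_quantile r : monotone_path r -> measurable_fun setT (quantile r).
Proof. by move=> mr; apply: (@measurable_quantile _ _ (fun t _ => r t) id). Qed.

Lemma uniform_prob_le c : 0 <= c <= 1 -> U [set u | u <= c] = c%:E.
Proof.
move=> /andP[c0 c1]; rewrite [LHS]integral_uniform_pdf.
rewrite [X in integral _ X](_ : _ = `[0, c]%classic); last first.
  by apply/seteqP; split=> x /=; rewrite !in_itv/=; [case=> a /andP[-> _]|move=> /andP[-> xc]; split=> //; lra].
rewrite (@eq_integral _ _ _ _ _ (cst 1%E)); last first.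
  move=> x; rewrite inE/= in_itv/= => /andP[x0 xc]; rewrite /uniform_pdf x0 (le_trans xc c1)/=.
  by rewrite subr0 invr1.
by rewrite integral_cst//= mul1e lebesgue_measure_itv/= lte_fin; case: ltgtP c0 => // [_ _|<- _]; rewrite ?sube0.
Qed.

Lemma uniform_prob_gt c : 0 <= c <= 1 -> U [set u | c < u] = (1 - c)%:E.
Proof.
move=> c01; have mc : measurable [set u : measurableTypeR R | u <= c] by exact: measurable_le_set.
rewrite [X in U X](_ : _ = ~` [set u | u <= c]).
  by rewrite probability_setC// uniform_prob_le.
by apply/seteqP; split=> u /=; rewrite ltNge => /negP.
Qed.

Lemma uniform_prob_ae01 : {ae U, forall u, 0 < u <= 1}.
Proof.
have h0 : {ae U, forall u, 0 < u}.
  exists [set u | u <= 0]; split; first exact: measurable_le_set.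
    by rewrite uniform_prob_le// lexx ler01.
  by move=> u /= /negP; rewrite -leNgt.
have h1 : {ae U, forall u, u <= 1}.
  exists [set u | 1 < u]; split; first exact: measurable_lt_set.
    by rewrite uniform_prob_gt ?subrr// lexx ler01.
  by move=> u /= /negP; rewrite -ltNge.
by apply: filterS2 h0 h1 => u -> ->.
Qed.

Lemma extend_path_lt0 r t : t < 0 -> extend_path T r t = 0.
Proof. by rewrite /extend_path => ->. Qed.

Lemma extend_path_in r t : 0 <= t <= T -> extend_path T r t = r t.
Proof. by rewrite /extend_path ltNge => /andP[-> tT]/=; rewrite min_l. Qed.

Lemma extend_path_gt r t : T <= t -> extend_path T r t = r T.
Proof. by move=> tT; rewrite /extend_path ltNge (le_trans (ltW T0) tT)/= min_r. Qed.

Lemma extend_path_mono r : monotone_path r -> {homo extend_path T r : s t / s <= t}.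
Proof.
move=> [_ r0 mono] s t st.
have [s0|s0] := ltP s 0.
  rewrite (extend_path_lt0 _ s0); have [t0|t0] := ltP t 0; first by rewrite extend_path_lt0.
  rewrite /extend_path ltNge t0/=; apply: (le_trans r0); apply: mono.
  - by rewrite in_itv/= lexx ltW.
  - by rewrite in_itv/= le_min t0 (ltW T0) ge_min lexx orbT.
  - by rewrite le_min t0 ltW.
have t0 := le_trans s0 st; rewrite /extend_path !ltNge s0 t0/=; apply: mono.
- by rewrite in_itv/= le_min s0 (ltW T0) ge_min lexx orbT.
- by rewrite in_itv/= le_min t0 (ltW T0) ge_min lexx orbT.
- by rewrite le_min !ge_min st lexx !orbT.
Qed.

Lemma extend_path_right_continuous r : monotone_path r -> right_continuous (extend_path T r).
Proof.
move=> [[rc _] _ _] t.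
have [t0|t0] := ltP t 0.
  rewrite extend_path_lt0//; apply: cvg_near_cst.
  by near=> s; rewrite extend_path_lt0//; near: s; exact: nbhs_right_lt.
have [tT|tT] := ltP t T.
  rewrite extend_path_in ?t0 ?(ltW tT)//.
  apply: cvg_trans (rc t _); last by rewrite t0 tT.
  apply: near_eq_cvg; near=> s; rewrite extend_path_in//; apply/andP; split.
    by apply: (le_trans t0); near: s; exact: nbhs_right_ge.
  by near: s; exact: nbhs_right_le.
rewrite extend_path_gt//; apply: cvg_near_cst.
near=> s; rewrite extend_path_gt//; apply: (le_trans tT); near: s; exact: nbhs_right_ge.
Unshelve. all: by end_near. Qed.

Lemma uniform_quantile_le r t : monotone_path r -> r T = 1 ->
  U [set u | quantile r u <= t] = (extend_path T r t)%:E.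
Proof.
move=> mr rT.
have [t0|t0] := ltP t 0.
  rewrite extend_path_lt0// (_ : [set u | _] = set0) ?measure0//.
  by apply/seteqP; split=> u //=; have /andP[] := quantile_range r u; lra.
have [tT|tT] := ltP t T; last first.
  rewrite extend_path_gt// rT (_ : [set u | _] = setT) ?probability_setT//.
  by apply/seteqP; split=> u //=; have /andP[] := quantile_range r u; lra.
have tT' : 0 <= t <= T by rewrite t0 ltW.
rewrite extend_path_in// -uniform_prob_le.
  congr (U _); apply/seteqP; split=> u /=; rewrite quantile_le//.
    by rewrite (lt_eqF tT).
  by move=> ->; rewrite orbT.
have [_ r0 mono] := mr; apply/andP; split.
  by apply: (le_trans r0); apply: mono; rewrite ?in_itv/= ?t0 ?lexx ?ltW.
by rewrite -rT; apply: mono; rewrite ?in_itv/= ?t0 ?lexx ?ltW.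
Qed.

(** Both measures have distribution function [extend_path T r], so they agree on half-open
    intervals; the atom r 0 at time 0 is the jump of this function there. *)
Lemma stieltjes_quantile r (A : set (measurableTypeR R)) : monotone_path r -> r T = 1 ->
  measurable A -> stieltjes T r A = U (quantile r @^-1` A).
Proof.
move=> mr rT mA; rewrite /stieltjes.
case: pselect => [H|]; last first.
  by case; split; [exact: extend_path_mono|exact: extend_path_right_continuous].
have mq : @measurable_fun _ _ (measurableTypeR R) (measurableTypeR R) setT (quantile r) :=
  measurable_path_quantile mr.
pose qm : {mfun measurableTypeR R >-> measurableTypeR R} := HB.pack_for {mfun measurableTypeR R >-> measurableTypeR R} (quantile r) (isMeasurableFun.Build _ _ _ _ _ mq).
apply: (@lebesgue_stieltjes_measure_unique _ _ (pushforward U qm)) => // X.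
move=> /ocitvP[->|[[a b]/= ab ->]]; first by rewrite !measure0.
rewrite /lebesgue_stieltjes_measure /measure_extension measurable_mu_extE/=; last exact: is_ocitv.
rewrite wlength_itv_bnd ?ltW//.
rewrite /pushforward (_ : _ @^-1` _ = [set u | quantile r u <= b] `\` [set u | quantile r u <= a]).
  rewrite measureD//=; [|exact: measurable_le_set..|]; last first.
    by rewrite [ltLHS](uniform_quantile_le _ mr rT) ltry.
  rewrite setIidr; last by move=> u /= ua; lra.
  by rewrite !uniform_quantile_le.
apply/seteqP; split=> u /=; rewrite in_itv/=; first by move=> /andP[au ->]; split=> //; lra.
by case=> -> /negP; rewrite -ltNge => ->.
Qed.

End Quantile.

(** * Integrals of bounded functions over products *)

Section BoundedFubini.
Context {R : realType} {d1 d2 : measure_display}.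
Context {W1 : measurableType d1} {W2 : measurableType d2}.
Variables (m1 : probability W1 R) (m2 : probability W2 R).
Implicit Types (X : W1 * W2 -> R) (K : R).

Lemma bounded_integrable K (X : W1 -> R) : measurable_fun setT X ->
  (forall x, `|X x| <= K) -> m1.-integrable setT (EFin \o X).
Proof.
move=> mX XK; apply: (@ae_le_integrable _ _ _ m1 X (cst K)) => //.
  by apply: aeW => x /=; exact: XK.
exact: finite_measure_integrable_cst.
Qed.

Lemma bounded_Rintegral K (X : W1 -> R) : measurable_fun setT X ->
  (forall x, `|X x| <= K) -> `|\int[m1]_x X x| <= K.
Proof.
move=> mX XK; have iX := bounded_integrable mX XK.
apply: le_trans (le_normr_Rintegral measurableT iX) _.
rewrite -[leRHS](probability_Rintegral_cst m1).
apply: le_Rintegral => //; first exact: integrable_norm.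
exact: finite_measure_integrable_cst.
Qed.

Lemma measurable_Rintegral_section X : measurable_fun setT X ->
  measurable_fun setT (fun x => \int[m2]_y X (x, y)).
Proof.
move=> mX; have mE : measurable_fun setT (EFin \o X) by exact/measurable_EFinP.
rewrite (_ : (fun _ => _) = fun x => fine (fubini_F m2 (EFin \o X)^\+%E x - fubini_F m2 (EFin \o X)^\-%E x)%E).
  apply: measurableT_comp => //; apply: emeasurable_funB.
    by apply: measurable_fun_fubini_tonelli_F => //; exact: measurable_funepos.
  by apply: measurable_fun_fubini_tonelli_F => //; exact: measurable_funeneg.
apply/funext => x; rewrite /Rintegral integralE /fubini_F; congr (fine (_ - _)).
  by apply: eq_integral => y _; rewrite !funeposE.
by apply: eq_integral => y _; rewrite !funenegE.
Qed.

Lemma prod_bounded_integrable K X : measurable_fun setT X -> (forall p, `|X p| <= K) ->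
  (m1 \x m2)%E.-integrable setT (EFin \o X).
Proof.
move=> mX XK; apply: (@ae_le_integrable _ _ _ (m1 \x m2)%E X (cst K)) => //.
  by apply: aeW => x /=; exact: XK.
exact: finite_measure_integrable_cst.
Qed.

End BoundedFubini.

Section ProductIntegrals.
Context {R : realType} {d1 d2 : measure_display}.
Context {W1 : measurableType d1} {W2 : measurableType d2}.
Variables (m1 : probability W1 R) (m2 : probability W2 R).
Implicit Types (X : W1 * W2 -> R) (K : R).

Lemma Rintegral_prod1 K X : measurable_fun setT X -> (forall p, `|X p| <= K) ->
  \int[(m1 \x m2)%E]_p X p = \int[m1]_x \int[m2]_y X (x, y).
Proof.
move=> mX XK; have iX := prod_bounded_integrable m1 m2 mX XK.
rewrite {1}/Rintegral -(integral12_prod_meas1 iX); congr fine; apply: eq_integral => x _.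
rewrite /fubini_F (@Rintegral_EFin _ _ _ m2 setT (fun y => X (x, y)))//.
by apply: bounded_integrable (fun y => XK (x, y)); exact: measurable_fun_pair2.
Qed.

Lemma Rintegral_prod2 K X : measurable_fun setT X -> (forall p, `|X p| <= K) ->
  \int[(m1 \x m2)%E]_p X p = \int[m2]_y \int[m1]_x X (x, y).
Proof.
move=> mX XK; have iX := prod_bounded_integrable m1 m2 mX XK.
rewrite {1}/Rintegral -(integral21_prod_meas1 iX); congr fine; apply: eq_integral => y _.
rewrite /fubini_G (@Rintegral_EFin _ _ _ m1 setT (fun x => X (x, y)))//.
by apply: bounded_integrable (fun x => XK (x, y)); exact: measurable_fun_pair1.
Qed.

End ProductIntegrals.

(** * Left limits and the law of the quantile *)

Section PathIntegrals.
Context {R : realType}.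
Variable T : R.
Hypothesis T0 : 0 < T.
Implicit Types (r z phi : R -> R) (s t u c K : R).
Local Notation U := (@uniform01 R).
Local Notation RR := (measurableTypeR R).

Lemma left_lim_cvg z t : cadlag_path T z -> 0 < t <= T -> z s @[s --> t^'-] --> left_lim z t.
Proof.
move=> [_ lc] tT; rewrite /left_lim leNgt; have /andP[-> _]/= := tT; exact: lc.
Qed.

Lemma left_lim_ge z s t : monotone_path T z -> 0 <= s < t -> t <= T -> z s <= left_lim z t.
Proof.
move=> [cz z0 mono] /andP[s0 st] tT; have t0 := le_lt_trans s0 st.
have tT' : 0 < t <= T by rewrite t0.
have cv := left_lim_cvg cz tT'; rewrite -(cvg_lim _ cv)//; apply: limr_ge; first by apply/cvg_ex; eexists; exact: cv.
near=> x; have sx : s <= x by near: x; exact: nbhs_left_ge.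
have xt : x < t by near: x; exact: nbhs_left_lt.
apply: mono => //; rewrite in_itv/=; apply/andP; split; lra.
Unshelve. all: by end_near. Qed.

Lemma left_lim_approx z c t : monotone_path T z -> 0 < t <= T -> c < left_lim z t ->
  exists2 s, 0 <= s < t & c < z s.
Proof.
move=> [cz z0 mono] tT cL; have /cvgr_gt /(_ _ cL) near_c := left_lim_cvg cz tT.
have [x /= [] xc] := @filter_ex _ (t^'-) _ _ (filterI near_c (filterI (nbhs_left_lt t) (nbhs_left_gt (proj1 (andP tT))))).
by case=> xt x0; exists x => //; rewrite (ltW x0).
Qed.

Lemma left_lim_le z t : monotone_path T z -> 0 <= t <= T -> left_lim z t <= z t.
Proof.
move=> mz /andP[t0 tT]; have [cz z0 mono] := mz.
have [t00|t1] := leP t 0.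
  by rewrite /left_lim t00; have -> : t = 0 by lra.
rewrite leNgt; apply/negP => h.
have /(left_lim_approx mz)/(_ h) : 0 < t <= T by rewrite t1.
case=> s /andP[s0 st]; apply/negP; rewrite -leNgt; apply: mono; rewrite ?in_itv/=; lra.
Qed.

Lemma left_lim_ge0 z t : monotone_path T z -> t <= T -> 0 <= left_lim z t.
Proof.
move=> mz tT; have [_ z0 _] := mz.
have [t00|t1] := leP t 0; first by rewrite /left_lim t00.
by apply: (le_trans z0); apply: left_lim_ge => //; rewrite lexx.
Qed.

Lemma monotone_path_le1 z t : monotone_path T z -> z T = 1 -> 0 <= t <= T -> 0 <= z t <= 1.
Proof.
move=> [_ z0 mono] zT /andP[t0 tT]; apply/andP; split.
  by apply: (le_trans z0); apply: mono; rewrite ?in_itv/= ?lexx//=; lra.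
by rewrite -zT; apply: mono; rewrite ?in_itv/= ?lexx//=; lra.
Qed.

Lemma left_lim_le1 z t : monotone_path T z -> z T = 1 -> 0 <= t <= T -> 0 <= left_lim z t <= 1.
Proof.
move=> mz zT tT; have /andP[_ z1] := monotone_path_le1 mz zT tT.
rewrite left_lim_ge0//; last by case/andP: tT.
by rewrite (le_trans (left_lim_le mz tT)).
Qed.

Let mq z : monotone_path T z -> measurable_fun (setT : set RR) (quantile T z).
Proof. exact: (measurable_path_quantile T0). Qed.

Lemma measurable_quantile_set z (A : set RR) : monotone_path T z -> measurable A ->
  measurable (quantile T z @^-1` A : set RR).
Proof. by move=> mz mA; rewrite -[X in measurable X]setTI; exact: mq. Qed.

(** A quantile below t forces u <= z(t-). Conversely z(t-) is approached from below by values z s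
    with s < t, and u <= z s puts the quantile at or before s. *)
Lemma uniform_quantile_lt z t : monotone_path T z -> z T = 1 -> 0 <= t <= T ->
  U [set u | quantile T z u < t] = (left_lim z t)%:E.
Proof.
move=> mz zT tT; have L01 := left_lim_le1 mz zT tT.
have mlt : measurable ([set u | quantile T z u < t] : set RR).
  by apply: measurable_lt_set => //; exact: mq.
have [t0|t0] := leP t 0.
  rewrite (_ : [set u | _] = set0) ?measure0 /left_lim ?t0//.
  by apply/seteqP; split=> u //=; have /andP[] := quantile_range T0 z u; lra.
apply/eqP; rewrite eq_le; apply/andP; split.
  rewrite -(uniform_prob_le L01); apply: le_measure; rewrite ?inE//.
    exact: measurable_le_set.
  move=> u /=; move=> ut; have qr := quantile_range T0 z u.
  have : u <= z (quantile T z u).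
    have := quantile_le T0 u mz qr; rewrite lexx => /esym/orP[/eqP qT|//].
    by move: ut; rewrite qT; lra.
  move=> /le_trans; apply; apply: left_lim_ge => //; last by lra.
  by rewrite ut; case/andP: qr => ->.
apply/lee_subgt0Pr => e e0; have tT' : 0 < t <= T by lra.
have [|s /andP[s0 st] es] := @left_lim_approx z (left_lim z t - e) t mz tT'; first by lra.
have sT : 0 <= s <= T by lra.
rewrite -EFinB; apply: (@le_trans _ _ (z s)%:E); first by rewrite lee_fin ltW.
rewrite -uniform_prob_le; last exact: (monotone_path_le1 mz zT sT).
apply: le_measure; rewrite ?inE//; first exact: measurable_le_set.
move=> u /= us; apply: le_lt_trans st; by rewrite quantile_le// us orbT.
Qed.

Lemma uniform_quantile_eq z t : monotone_path T z -> z T = 1 -> 0 <= t <= T ->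
  U [set u | quantile T z u = t] = (jump z t)%:E.
Proof.
move=> mz zT tT.
rewrite (_ : [set u | _] = [set u | quantile T z u <= t] `\` [set u | quantile T z u < t]).
  rewrite measureD//=; [|by apply: measurable_le_set => //; exact: mq|by apply: measurable_lt_set => //; exact: mq|]; last first.
    by rewrite [ltLHS](uniform_quantile_le T0 _ mz zT) ltry.
  rewrite setIidr; last by move=> u /= /ltW.
  by rewrite [X in (X - _)%E](uniform_quantile_le T0 _ mz zT) [X in (_ - X)%E]uniform_quantile_lt// extend_path_in.
apply/seteqP; split=> u /=; first by move=> ->; rewrite lexx ltxx.
by case=> a /negP; rewrite -leNgt => b; apply/eqP; rewrite eq_le a.
Qed.

Lemma uniform_quantile_gt z t : monotone_path T z -> z T = 1 -> 0 <= t <= T ->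
  U [set u | t < quantile T z u] = (1 - z t)%:E.
Proof.
move=> mz zT tT.
rewrite (_ : [set u | _] = ~` [set u | quantile T z u <= t]).
  rewrite probability_setC; last by apply: measurable_le_set => //; exact: mq.
  by rewrite uniform_quantile_le// extend_path_in.
by apply/seteqP; split=> u /=; rewrite ltNge => /negP.
Qed.

(** How the requirement rho_{theta-} = 0 on controls is used: the randomised time does not occur
    before theta. *)
Lemma quantile_ge_ae z t : monotone_path T z -> z T = 1 -> 0 <= t <= T -> left_lim z t = 0 ->
  {ae U, forall u, t <= quantile T z u}.
Proof.
move=> mz zT tT L0; exists [set u | quantile T z u < t]; split.
- by apply: measurable_lt_set => //; exact: mq.
- by rewrite uniform_quantile_lt// L0.
- by move=> u /= /negP; rewrite -ltNge.
Qed.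

Lemma Rintegral_stieltjes K r (D : set R) phi : monotone_path T r -> r T = 1 ->
  measurable (D : set RR) -> measurable_fun (setT : set RR) phi ->
  (forall t, `|phi t| <= K) ->
  \int[stieltjes T r]_(t in D) phi t = \int[U]_(u in quantile T r @^-1` D) phi (quantile T r u).
Proof.
move=> mr rT mD mphi phiK; have mqr : @measurable_fun _ _ RR RR setT (quantile T r) := mq mr.
pose qm : {mfun RR >-> RR} :=
  HB.pack_for {mfun RR >-> RR} (quantile T r) (isMeasurableFun.Build _ _ _ _ _ mqr).
rewrite /Rintegral (eq_measure_integral (pushforward U qm)); last first.
  by move=> A mA _; rewrite stieltjes_quantile.
rewrite integral_pushforward//; first exact/measurable_EFinP.
apply: integrable_sub; first exact: measurable_quantile_set.
by apply: (@bounded_integrable _ _ _ U K) => //; exact: measurableT_comp.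
Qed.

End PathIntegrals.

Section IndicatorIntegrals.
Context {R : realType} {d : measure_display} {W : measurableType d}.
Variable m : probability W R.
Implicit Types (f g : W -> R) (b : W -> bool).

Lemma measurable_boolR b : measurable [set w | b w] -> measurable_fun setT (fun w => (b w)%:R : R).
Proof.
move=> mb; rewrite (_ : (fun _ => _) = \1_[set w | b w]); first exact: measurable_indic.
apply/funext => w; rewrite indicE; case: (boolP (b w)) => bw; first by rewrite mem_set.
by rewrite memNset//=; apply/negP.
Qed.

Lemma Rintegral_boolR b : measurable [set w | b w] ->
  \int[m]_w (b w)%:R = fine (m [set w | b w]).
Proof.
move=> mb; rewrite (_ : (fun _ => _) = \1_[set w | b w]).
  by rewrite /Rintegral integral_indic// setIT.
apply/funext => w; rewrite indicE; case: (boolP (b w)) => bw; first by rewrite mem_set.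
by rewrite memNset//=; apply/negP.
Qed.

End IndicatorIntegrals.

(** * Sums over common jumps *)

Section JumpSum.
Context {R : realType}.
Variable T : R.
Hypothesis T0 : 0 < T.
Implicit Types (r z phi a : R -> R) (s t u c K : R) (D : set R).
Local Notation U := (@uniform01 R).
Local Notation RR := (measurableTypeR R).
Local Notation q := (quantile T).

Let mq z : monotone_path T z -> @measurable_fun _ _ RR RR setT (q z).
Proof. exact: (measurable_path_quantile T0). Qed.

(** Taken from the law of the quantile rather than from [jump], so that it is nonnegative everywhere
    and measurable on the whole line; on [0, T] the two agree. *)
Definition atom z t : R := fine (U [set u | q z u = t]).

Lemma atom_jump z t : monotone_path T z -> z T = 1 -> 0 <= t <= T -> atom z t = jump z t.
Proof. by move=> mz zT tT; rewrite /atom uniform_quantile_eq. Qed.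

Lemma atom_ge0 z t : 0 <= atom z t.
Proof. by rewrite fine_ge0. Qed.

Lemma measurable_atom z : monotone_path T z -> measurable_fun (setT : set RR) (atom z).
Proof.
move=> mz; have mqz : @measurable_fun _ _ RR R setT (q z) := measurable_path_quantile T0 mz.
pose qm : {mfun RR >-> R} := MeasurableFun.Pack (MeasurableFun.Class (isMeasurableFun.Build _ _ _ _ _ mqz)).
exact: (@pmf_measurable _ _ _ U qm).
Qed.

Lemma countable_atom z : monotone_path T z -> countable [set t | 0 < atom z t].
Proof.
move=> mz; have mqz : @measurable_fun _ _ RR R setT (q z) := measurable_path_quantile T0 mz.
pose qm : {mfun RR >-> R} := MeasurableFun.Pack (MeasurableFun.Class (isMeasurableFun.Build _ _ _ _ _ mqz)).
exact: (@pmf_gt0_countable _ _ _ U qm).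
Qed.

Let m1 (t : R) : measurable ([set t] : set RR).
Proof. exact: measurable_set1. Qed.

(** Both sides are carried by the countably many atoms of z. Over a single atom t, the integral is
    the constant a t * atom z t times the probability [atom r t]. *)
Lemma esum_atom a z r D : monotone_path T z -> monotone_path T r -> measurable (D : set RR) ->
  measurable_fun (setT : set RR) a -> (forall t, 0 <= a t) ->
  (\esum_(t in D) (a t * atom z t * atom r t)%:E =
   \int[U]_(u in q r @^-1` D) (a (q r u) * atom z (q r u))%:E)%E.
Proof.
move=> mz mr mD ma a0.
have /countable_injP[code code_inj] : countable (D `&` [set t | 0 < atom z t]).
  by apply: sub_countable (countable_atom mz); apply: subset_card_le => t [].
(* Injectivity of the code makes each F n empty or a singleton. *)
pose F n := [set t | (D `&` [set t | 0 < atom z t]) t /\ code t = n].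
have F1 n t : F n t -> F n = [set t].
  move=> [Ct ct]; apply/seteqP; split=> s /=; last by move=> ->.
  by move=> [Cs cs]; apply: code_inj; rewrite ?inE// cs.
have mF n : measurable (F n : set RR).
  have [[t Ft]|none] := pselect (exists t, F n t); first by rewrite (F1 _ _ Ft).
  by rewrite (_ : F n = set0)//; apply/seteqP; split=> // t Ft; apply: none; exists t.
have CF : D `&` [set t | 0 < atom z t] = \bigcup_n F n.
  by apply/seteqP; split=> t; [move=> Ct; exists (code t)|case=> n _ []].
have Ftriv : trivIset setT F by move=> i j _ _ [t [[_ <-] [_ <-]]].
transitivity (\esum_(t in D `&` [set t | 0 < atom z t]%R) (a t * atom z t * atom r t)%:E)%E.
  rewrite esum_mkcondr; apply: eq_esum => t _; case: ifPn => //.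
  rewrite notin_setE/= => /negP; rewrite -leNgt => z0.
  by have -> : atom z t = 0; [have := atom_ge0 z t; lra|rewrite mulr0 mul0r].
transitivity (\int[U]_(u in q r @^-1` (D `&` [set t | 0 < atom z t]%R))
   (a (q r u) * atom z (q r u))%:E)%E; last first.
  rewrite preimage_setI integral_mkcondr; apply: eq_integral => u _.
  rewrite /patch; case: ifPn => //; rewrite notin_setE/= => /negP; rewrite -leNgt => z0.
  by have -> : atom z (q r u) = 0; [have := atom_ge0 z (q r u); lra|rewrite mulr0].
have maz : measurable_fun (setT : set RR) (fun u => a (q r u) * atom z (q r u)).
  apply: measurable_funM; apply: measurableT_comp (mq mr) => //; exact: measurable_atom.
rewrite CF esum_bigcupT//; last first.
  by move=> t; rewrite lee_fin !mulr_ge0// ?atom_ge0.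
rewrite preimage_bigcup ge0_integral_bigcup//; first last.
- by move=> i j _ _ [u [ui uj]]; apply: (Ftriv i j I I); exists (q r u).
- by move=> u _; rewrite lee_fin mulr_ge0// atom_ge0.
- by apply: measurable_funTS; exact/measurable_EFinP.
- by move=> n; rewrite -[X in measurable X]setTI; exact: mq.
rewrite nneseries_esumT; last first.
  by move=> n; apply: integral_ge0 => u _; rewrite lee_fin mulr_ge0// atom_ge0.
apply: eq_esum => n _.
have [[t Ft]|none] := pselect (exists t, F n t); last first.
  rewrite (_ : F n = set0) ?esum_set0 ?preimage_set0 ?integral_set0//.
  by apply/seteqP; split=> // t Ft; apply: none; exists t.
rewrite (F1 _ _ Ft) esum_set1; last by rewrite lee_fin !mulr_ge0// ?atom_ge0.
rewrite (eq_integral (cst (a t * atom z t)%:E)); last first.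
  by move=> u; rewrite inE/= => ->.
rewrite integral_cst; last by rewrite -[X in measurable X]setTI; exact: mq.
rewrite [LHS]EFinM; congr (_ * _)%E; rewrite /atom fineK//; apply: fin_num_measure.
exact: (measurable_quantile_set T0 mr (m1 t)).
Qed.

Lemma real_sum_jump K phi z r D : monotone_path T z -> monotone_path T r ->
  z T = 1 -> r T = 1 -> measurable (D : set RR) -> D `<=` `[0, T] ->
  measurable_fun (setT : set RR) phi -> (forall t, `|phi t| <= K) ->
  real_sum D (fun t => phi t * jump z t * jump r t) =
  \int[U]_(u in q r @^-1` D) (phi (q r u) * atom z (q r u)).
Proof.
move=> mz mr zT rT mD DT mphi phiK.
rewrite /real_sum /Rintegral integralE; congr (fine (_ - _)).
- transitivity (\esum_(t in D) (Num.max (phi t) 0 * atom z t * atom r t)%:E)%E.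
    apply: eq_esum => t Dt; have /DT := Dt; rewrite /= in_itv/= => tT.
    rewrite funeposE/= -!mulrA -!atom_jump// -EFin_max; congr EFin.
    by rewrite maxr_pMl ?mul0r// mulr_ge0// atom_ge0.
  rewrite esum_atom//.
  + apply: eq_integral => u _; rewrite funeposE/= -EFin_max maxr_pMl ?mul0r//; exact: atom_ge0.
  + exact: measurable_maxr.
  + by move=> t; rewrite le_max lexx orbT.
- transitivity (\esum_(t in D) (Num.max (- phi t) 0 * atom z t * atom r t)%:E)%E.
    apply: eq_esum => t Dt; have /DT := Dt; rewrite /= in_itv/= => tT.
    rewrite funenegE/= -!mulrA -!atom_jump// -EFin_max; congr EFin.
    by rewrite maxr_pMl ?mul0r ?mulNr// mulr_ge0// atom_ge0.
  rewrite esum_atom//.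
  + apply: eq_integral => u _; rewrite funenegE/= -EFin_max maxr_pMl ?mul0r ?mulNr//; exact: atom_ge0.
  + apply: measurable_maxr => //; exact: measurable_funN.
  + by move=> t; rewrite le_max lexx orbT.
Qed.

End JumpSum.

(** * Pathwise payoffs *)

Section PathPayoff.
Context {R : realType}.
Variable T : R.
Hypothesis T0 : 0 < T.
Implicit Types (f g h r z phi : R -> R) (s t u v c th K : R) (D : set R).
Local Notation U := (@uniform01 R).
Local Notation RR := (measurableTypeR R).
Local Notation UU := (U \x U)%E.
Local Notation q := (quantile T).

Definition game f g h s t : R := if s < t then f s else if t < s then g t else h s.

Definition raw_payoff f g h th r z : R :=
  \int[stieltjes T r]_(t in `[th, T[) (f t * (1 - z t))
  + \int[stieltjes T z]_(t in `[th, T[) (g t * (1 - r t))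
  + real_sum `[th, T] (fun t => h t * jump z t * jump r t).

Let mq z : monotone_path T z -> @measurable_fun _ _ RR RR setT (q z).
Proof. exact: (measurable_path_quantile T0). Qed.

Let mq1 z : monotone_path T z -> @measurable_fun _ _ (RR * RR)%type RR setT (fun p => q z p.1).
Proof. by move=> mz; apply: measurableT_comp (mq mz) _; exact: measurable_fst. Qed.

Let mq2 z : monotone_path T z -> @measurable_fun _ _ (RR * RR)%type RR setT (fun p => q z p.2).
Proof. by move=> mz; apply: measurableT_comp (mq mz) _; exact: measurable_snd. Qed.

Let rng z u : 0 <= q z u <= T. Proof. exact: quantile_range. Qed.

Lemma game_split f g h s t :
  game f g h s t = f s * (s < t)%R%:R + g t * (t < s)%R%:R + h s * (s == t)%R%:R.
Proof. by rewrite /game; case: ltgtP => _; rewrite !(mulr1, mulr0, addr0, add0r). Qed.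

Lemma game_le K f g h s t : (forall t, `|f t| <= K) -> (forall t, `|g t| <= K) ->
  (forall t, `|h t| <= K) -> `|game f g h s t| <= K.
Proof. by move=> fK gK hK; rewrite /game; case: ltgtP. Qed.

Lemma ler_norm_boolR K a (b : bool) : `|a| <= K -> `|a * b%:R| <= K :> R.
Proof. by case: b => aK; rewrite ?mulr1// mulr0 normr0 (le_trans _ aK). Qed.

Variables (r z : R -> R).
Hypotheses (mr : monotone_path T r) (rT : r T = 1) (mz : monotone_path T z) (zT : z T = 1).

Let extend01 x t : monotone_path T x -> x T = 1 -> 0 <= extend_path T x t <= 1.
Proof.
move=> mx xT; have [t0|t0] := ltP t 0; first by rewrite extend_path_lt0// lexx ler01.
have [tT|tT] := leP t T; first by rewrite extend_path_in ?t0// (monotone_path_le1 mx)// t0.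
by rewrite extend_path_gt ?xT ?ler01 ?lexx// ltW.
Qed.

Lemma measurable_extend_path x : monotone_path T x -> measurable_fun (setT : set RR) (extend_path T x).
Proof. by move=> mx; apply: nondecreasing_measurable => //; exact: extend_path_mono. Qed.

(** The factor 1 - y t is the probability that the randomised time of y exceeds t. *)
Let integral_survival phi K th x y : monotone_path T x -> x T = 1 -> monotone_path T y -> y T = 1 ->
  measurable_fun (setT : set RR) phi -> (forall t, `|phi t| <= K) ->
  0 <= th <= T -> left_lim x th = 0 ->
  \int[stieltjes T x]_(t in `[th, T[) (phi t * (1 - y t)) =
  \int[U]_u (phi (q x u) * \int[U]_v (q x u < q y v)%R%:R).
Proof.
move=> mx xT my yT mphi phiK thT x0.
have inT t : `[th, T[%classic t -> 0 <= t <= T by rewrite /= in_itv/=; lra.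
(* Extending y beyond [0, T] makes the integrand bounded and measurable on the whole line. *)
pose psi t := phi t * (1 - extend_path T y t).
have mpsi : measurable_fun (setT : set RR) psi.
  by apply: measurable_funM => //; apply: measurable_funB => //; exact: measurable_extend_path.
have psiK t : `|psi t| <= K.
  rewrite normrM (le_trans _ (phiK t))// ler_piMr//.
  by rewrite ler_norml; have := extend01 t my yT; lra.
transitivity (\int[stieltjes T x]_(t in `[th, T[) psi t).
  by apply: eq_Rintegral => t; rewrite inE => /inT tT; rewrite /psi extend_path_in.
rewrite (Rintegral_stieltjes T0 (K := K))//.
rewrite Rintegral_mkcond.
have mqD : measurable (q x @^-1` `[th, T[ : set RR).
  by apply: (measurable_quantile_set T0 mx); exact: measurable_itv.
have surv u : \int[U]_v (q x u < q y v)%R%:R = 1 - y (q x u).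
  rewrite Rintegral_boolR; first by rewrite (uniform_quantile_gt T0 my yT).
  by apply: measurable_lt_set => //; exact: mq.
apply: ae_eq_Rintegral => //.
- apply/(measurable_restrictT _ _).1 => //; apply: measurable_funTS.
  by apply: measurableT_comp => //; exact: mq.
- rewrite (_ : (fun u => _) = (fun u => psi (q x u))); first by apply: measurableT_comp => //; exact: mq.
  by apply/funext => u; rewrite surv /psi extend_path_in.
- apply: filterS (quantile_ge_ae T0 mx xT thT x0) => u thu.
  rewrite surv patchE; case: ifPn => [_|]; first by rewrite /psi extend_path_in.
  (* Outside [th, T) the quantile equals T, where the factor 1 - y T vanishes; leaving T out of the
     domain loses nothing. *)
  rewrite notin_setE/= in_itv/= thu/= => /negP; rewrite -leNgt => Tq.
  have /andP[_ qT] := rng x u; have -> : q x u = T by apply/eqP; rewrite eq_le qT.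
  by rewrite yT subrr mulr0.
Qed.

(** The three terms correspond to player 1 stopping first, player 2 stopping first, and a tie. Each
    is integrated first over the device of the player who does not determine the payoff; given q r u
    = t, a tie has probability [atom z t], which gives the sum over jumps. *)
Lemma raw_payoffE f g h th K : 0 <= th <= T -> left_lim r th = 0 -> left_lim z th = 0 ->
  measurable_fun (setT : set RR) f -> measurable_fun (setT : set RR) g ->
  measurable_fun (setT : set RR) h ->
  (forall t, `|f t| <= K) -> (forall t, `|g t| <= K) -> (forall t, `|h t| <= K) ->
  raw_payoff f g h th r z = \int[UU]_p game f g h (q r p.1) (q z p.2).
Proof.
move=> thT r0 z0 mf mg mh fK gK hK.
have mlt12 : measurable [set p : (RR * RR)%type | q r p.1 < q z p.2].
  by apply: measurable_lt_set; [exact: mq1|exact: mq2].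
have mlt21 : measurable [set p : (RR * RR)%type | q z p.2 < q r p.1].
  by apply: measurable_lt_set; [exact: mq2|exact: mq1].
have meq12 : measurable [set p : (RR * RR)%type | q r p.1 == q z p.2].
  rewrite (_ : [set p | _] = [set p : (RR * RR)%type | q r p.1 = q z p.2]).
    by apply: measurable_eq_set; [exact: mq1|exact: mq2].
  by apply/seteqP; split=> p /= /eqP.
pose X1 (p : RR * RR) : R := f (q r p.1) * (q r p.1 < q z p.2)%R%:R.
pose X2 (p : RR * RR) : R := g (q z p.2) * (q z p.2 < q r p.1)%R%:R.
pose X3 (p : RR * RR) : R := h (q r p.1) * (q r p.1 == q z p.2)%R%:R.
have mX1 : measurable_fun setT X1.
  apply: measurable_funM; last exact: measurable_boolR.
  by apply: measurableT_comp mf _; exact: mq1.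
have mX2 : measurable_fun setT X2.
  apply: measurable_funM; last exact: measurable_boolR.
  by apply: measurableT_comp mg _; exact: mq2.
have mX3 : measurable_fun setT X3.
  apply: measurable_funM; last exact: measurable_boolR.
  by apply: measurableT_comp mh _; exact: mq1.
have X1K p : `|X1 p| <= K by exact: ler_norm_boolR.
have X2K p : `|X2 p| <= K by exact: ler_norm_boolR.
have X3K p : `|X3 p| <= K by exact: ler_norm_boolR.
have i1 := prod_bounded_integrable U U mX1 X1K.
have i2 := prod_bounded_integrable U U mX2 X2K.
have i3 := prod_bounded_integrable U U mX3 X3K.
have -> : \int[UU]_p game f g h (q r p.1) (q z p.2) =
    \int[UU]_p X1 p + \int[UU]_p X2 p + \int[UU]_p X3 p.
  rewrite -RintegralD//; first rewrite -RintegralD//; last first.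
    rewrite (_ : EFin \o _ = (EFin \o X1) \+ (EFin \o X2))%E//; exact: integrableD.
  by apply: eq_Rintegral => p _; rewrite game_split.
rewrite (Rintegral_prod1 U U mX1 X1K) (Rintegral_prod2 U U mX2 X2K) (Rintegral_prod1 U U mX3 X3K).
have ib (b : RR -> bool) : measurable [set v | b v] -> U.-integrable setT (EFin \o (fun v => (b v)%R%:R : R)).
  move=> mb; apply: (@bounded_integrable _ _ _ U 1); first exact: measurable_boolR.
  by move=> v; case: (b v); rewrite ?normr1// normr0.
congr (_ + _ + _).
- rewrite (integral_survival (K := K))//; apply: eq_Rintegral => u _; rewrite /X1/= RintegralZl//.
  by apply: ib; apply: measurable_lt_set => //; exact: mq.
- rewrite (integral_survival (K := K))//; apply: eq_Rintegral => u _; rewrite /X2/= RintegralZl//.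
  by apply: ib; apply: measurable_lt_set => //; exact: mq.
- rewrite (real_sum_jump T0 (K := K))//; last by move=> t; rewrite /= !in_itv/=; lra.
  have eqX3 u : \int[U]_v X3 (u, v) = h (q r u) * atom T z (q r u).
    have mqu : measurable ([set v | q z v = q r u] : set RR).
      by apply: measurable_eq_set => //; exact: mq.
    have eqs : [set v | q r u == q z v] = [set v | q z v = q r u].
      by apply/seteqP; split=> v /=; rewrite eq_sym => /eqP.
    rewrite /X3/= RintegralZl//; last by apply: ib; rewrite eqs.
    by rewrite Rintegral_boolR eqs.
  have mha : measurable_fun (setT : set RR) (fun u => h (q r u) * atom T z (q r u)).
    apply: measurable_funM; apply: measurableT_comp (mq mr) => //; exact: measurable_atom.
  rewrite Rintegral_mkcond; apply: ae_eq_Rintegral => //.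
  + apply/(measurable_restrictT _ _).1; last exact: measurable_funTS.
    by apply: (measurable_quantile_set T0 mr); exact: measurable_itv.
  + by under eq_fun do rewrite eqX3.
  + apply: filterS (quantile_ge_ae T0 mr rT thT r0) => u thu.
    rewrite eqX3 patchE; case: ifPn => //.
    by rewrite notin_setE/= in_itv/= thu/=; case/andP: (rng r u) => _ ->.
Qed.

End PathPayoff.

Lemma measure_eq_of_le {R : realType} (m1 m2 : {measure set (measurableTypeR R) -> \bar R}) :
  (forall t, m1 `]-oo, t]%classic = m2 `]-oo, t]%classic) -> (forall t, m1 `]-oo, t]%classic < +oo)%E ->
  forall A, measurable A -> m1 A = m2 A.
Proof.
move=> m12 m1oo A mA.
have oc (a b : R) (m : {measure set (measurableTypeR R) -> \bar R}) :
  (m `]-oo, b]%classic < +oo)%E -> a < b ->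
  m `]a, b]%classic = (m `]-oo, b]%classic - m `]-oo, a]%classic)%E.
  move=> moo ab; rewrite (_ : `]a, b]%classic = `]-oo, b] `\` `]-oo, a]).
    by rewrite measureD// setIidr// => x /=; rewrite !in_itv/=; lra.
  apply/seteqP; split=> x /=; rewrite !in_itv/=; first by move=> /andP[ax ->]; split=> //; lra.
  by case=> -> /negP; rewrite -ltNge => ->.
have := @measure_unique _ R (measurableTypeR R) (@ocitv R) (fun n => `](- n%:R), n%:R]%classic) erefl (@ocitvI R).
move=> /(_ _ _ m1 m2 _ _ A mA); apply.
- by move=> n; exact: is_ocitv.
- apply/seteqP; split=> // x _.
  have xb := archi_boundP (normr_ge0 x); exists (Num.bound `|x|) => //=.
  by move: xb; rewrite in_itv/= ltr_norml => /andP[-> /ltW].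
- move=> _ /ocitvP[->|[[a b]/= ab ->]]; first by rewrite !measure0.
  by rewrite !oc// -?m12// m1oo.
- move=> n; apply: le_lt_trans (m1oo n%:R); apply: le_measure; rewrite ?inE.
  + exact: measurable_itv.
  + exact: measurable_itv.
  + by move=> x /=; rewrite !in_itv/= => /andP[].
Qed.

Lemma measurable_if_lt {R : realType} {d : measure_display} {W : measurableType d} (a b F G H : W -> R) :
  measurable_fun setT a -> measurable_fun setT b -> measurable_fun setT F ->
  measurable_fun setT G -> measurable_fun setT H ->
  measurable_fun setT (fun w => if a w < b w then F w else if b w < a w then G w else H w).
Proof.
move=> ma mb mF mG mH; apply: measurable_fun_ifT => //; first exact: measurable_fun_ltr.
by apply: measurable_fun_ifT => //; exact: measurable_fun_ltr.
Qed.

Section ImageMeasure.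
Context {R : realType} (phi : measurableTypeR R -> measurableTypeR R).
Hypothesis mphi : measurable_fun setT phi.
Local Notation mphi_mfun :=
  (MeasurableFun.Pack (MeasurableFun.Class (isMeasurableFun.Build _ _ _ _ _ mphi))).

Definition image_measure : {measure set (measurableTypeR R) -> \bar R} :=
  distribution (@uniform01 R) mphi_mfun.

Lemma image_measureE A : image_measure A = @uniform01 R (phi @^-1` A).
Proof. by []. Qed.

End ImageMeasure.

(** * Truncated paths and splitting the payoff at a time *)

Section Truncation.
Context {R : realType}.
Variable T : R.
Hypothesis T0 : 0 < T.
Implicit Types (f g h r z phi : R -> R) (s t u v c th K : R) (D : set R).
Local Notation U := (@uniform01 R).
Local Notation RR := (measurableTypeR R).
Local Notation UU := (U \x U)%E.
Local Notation q := (quantile T).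

Definition truncated_path z th t : R :=
  if th <= t then div_or1 (z t - left_lim z th) (1 - left_lim z th) else 0.

Lemma truncated_path_lt z th t : t < th -> truncated_path z th t = 0.
Proof. by rewrite /truncated_path leNgt => ->. Qed.

Variables (z : R -> R) (th : R).
Hypotheses (mz : monotone_path T z) (zT : z T = 1) (thT : 0 <= th <= T).
Let L := left_lim z th.
Let L01 : 0 <= L <= 1. Proof. exact: (left_lim_le1 mz zT thT). Qed.
Let z' := truncated_path z th.

(** Multiplying by 1 - L absorbs the convention 0/0 = 1: if L = 1, then z equals 1 on [th, T] and
    both sides are 0. *)
Let truncatedE t : th <= t -> t <= T -> (1 - L) * z' t = z t - L.
Proof.
move=> tht tT; rewrite /z' /truncated_path tht /div_or1 -/L; case: eqP => [L1|/eqP L1].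
  have Lt : L <= z t.
    apply: (le_trans (left_lim_le mz thT)); have [_ _ mono] := mz.
    by apply: mono => //; rewrite in_itv/=; have := thT; lra.
  have tT' : 0 <= t <= T by have := thT; lra.
  have := monotone_path_le1 mz zT tT'; lra.
by rewrite mulrC divfK.
Qed.

Lemma truncated_path_T : z' T = 1.
Proof.
rewrite /z' /truncated_path; case/andP: thT => _ ->.
by rewrite zT /div_or1; case: eqP => // /eqP ne; rewrite divff.
Qed.

Lemma truncated_path_monotone : monotone_path T z'.
Proof.
have [[rc lc] z0 mono] := mz; have [th0 thT'] := andP thT; split; first split.
- move=> t /andP[t0 tT]; have [tth|tht] := ltP t th.
    rewrite [X in _ --> X](truncated_path_lt _ tth); apply: cvg_near_cst.
    by near=> s; apply: truncated_path_lt; near: s; exact: nbhs_right_lt.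
  apply: (@cvg_trans _ ((div_or1 (z s - L) (1 - L)) @[s --> t^'+])).
    apply: near_eq_cvg; near=> s; rewrite /z' /truncated_path.
    by rewrite (le_trans tht)//; near: s; exact: nbhs_right_ge.
  rewrite /z' /truncated_path tht -/L /div_or1; case: eqP => _; first exact: cvg_cst.
  apply: cvgM; last exact: cvg_cst.
  by apply: cvgB; [apply: rc; rewrite t0|exact: cvg_cst].
- move=> t /andP[t0 tT]; have [tth|tht] := leP t th.
    apply: (@is_cvg_near_cst _ _ 0).
    by near=> s; apply: truncated_path_lt; apply: lt_le_trans tth; near: s; exact: nbhs_left_lt.
  apply/cvg_ex; exists (div_or1 (left_lim z t - L) (1 - L)).
  apply: (@cvg_trans _ ((div_or1 (z s - L) (1 - L)) @[s --> t^'-])).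
    apply: near_eq_cvg; near=> s; rewrite /z' /truncated_path.
    have ths : th <= s by near: s; exact: nbhs_left_ge.
    by rewrite ths.
  rewrite /div_or1; case: eqP => _; first exact: cvg_cst.
  apply: cvgM; last exact: cvg_cst.
  by apply: cvgB; [|exact: cvg_cst]; apply: (@left_lim_cvg _ T) => //; apply/andP.
- rewrite /z' /truncated_path; case: ifP => // th00; rewrite -/L.
  have -> : L = 0 by rewrite /L /left_lim th00.
  by rewrite /div_or1 !subr0 oner_eq0 divr1.
- move=> s t; rewrite !in_itv/= => sT tT st; rewrite /z' /truncated_path.
  case: ifPn => ths; last first.
    case: ifPn => // tht; rewrite -/L /div_or1; case: eqP => // /eqP L1.
    apply: divr_ge0; last by case/andP: L01; rewrite subr_ge0.
    rewrite subr_ge0 (le_trans (left_lim_le mz thT))//.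
    by apply: mono; rewrite ?in_itv.
  rewrite (le_trans ths st) -/L /div_or1; case: eqP => // /eqP L1.
  rewrite ler_wpM2r ?invr_ge0 ?subr_ge0; [by []|by case/andP: L01|].
  by rewrite lerB// mono ?in_itv.
Unshelve. all: by end_near. Qed.

Lemma truncated_path_left_lim : left_lim z' th = 0.
Proof.
rewrite /left_lim; case: ifPn => // ; rewrite -ltNge => th0.
apply/cvg_lim => //; apply: cvg_near_cst.
by near=> s; apply: truncated_path_lt; near: s; exact: nbhs_left_lt.
Unshelve. all: by end_near. Qed.

Let mq x : monotone_path T x -> @measurable_fun _ _ RR RR setT (q x).
Proof. exact: (measurable_path_quantile T0). Qed.

Let mz' := truncated_path_monotone.
Let z'T := truncated_path_T.

(* dz agrees with (1 - z(th-)) dz' on [th, T]. *)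
Let truncated_le t : ((1 - L)%:E * U [set u | q z' u <= t]%R +
  U ([set u | q z u <= t]%R `&` [set u | q z u < th]%R))%E = U [set u | q z u <= t].
Proof.
rewrite (uniform_quantile_le T0 t mz' z'T) (uniform_quantile_le T0 t mz zT).
have [tth|tht] := ltP t th.
  rewrite setIidl; last by move=> u /= ut; apply: le_lt_trans tth.
  rewrite (uniform_quantile_le T0 t mz zT).
  suff -> : extend_path T z' t = 0 by rewrite mule0 add0e.
  rewrite /extend_path; case: ifP => // _; apply: truncated_path_lt.
  by rewrite gt_min tth.
rewrite setIidr; last by move=> u /= /ltW /le_trans; apply.
rewrite (uniform_quantile_lt T0 mz zT thT) -/L -EFinM -EFinD; congr EFin.
have [tT|Tt] := leP t T.
  have t0T : 0 <= t <= T by have := thT; lra.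
  by rewrite !extend_path_in// truncatedE// subrK.
by rewrite !extend_path_gt ?ltW// z'T zT mulr1 subrK.
Qed.

Let ltth := [set u | q z u < th].
Let mltth : measurable (ltth : set RR).
Proof. by apply: measurable_lt_set => //; exact: mq. Qed.

Lemma truncated_set (A : set RR) : measurable A ->
  ((1 - L)%:E * U (q z' @^-1` A) + U (q z @^-1` A `&` ltth))%E = U (q z @^-1` A).
Proof.
move=> mA; have L1 : 0 <= 1 - L by have := L01; lra.
have mqz := mq mz; have mqz' := mq mz'.
pose qz := image_measure mqz; pose qz' := image_measure mqz'.
pose mD := measurable_itv `]-oo, th[ : measurable (`]-oo, th[%classic : set RR).
(* The law of q z as a mixture: weight 1 - L on the law of q z', plus the part of the law of q z
   lying before th. By [truncated_le] it has the right mass on half-lines. *)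
pose m1 : {measure set RR -> \bar R} := measure_add (mscale (NngNum L1) qz') (mrestr qz mD).
have E (x : RR -> R) t : x @^-1` `]-oo, t]%classic = [set u | x u <= t].
  by apply/seteqP; split=> u /=; rewrite in_itv.
have E' (x : RR -> R) t : x @^-1` `]-oo, t[%classic = [set u | x u < t].
  by apply/seteqP; split=> u /=; rewrite in_itv.
have m1A B : m1 B = ((1 - L)%:E * U (q z' @^-1` B) + U (q z @^-1` (B `&` `]-oo, th[)))%E.
  by rewrite [LHS]measure_addE.
have m1E t : m1 `]-oo, t]%classic = qz `]-oo, t]%classic.
  rewrite m1A preimage_setI (E (q z)) (E (q z')) (E' (q z)) truncated_le.
  by rewrite /qz image_measureE (E (q z)).
have := @measure_eq_of_le _ m1 qz m1E _ A mA.
rewrite m1A preimage_setI (E' (q z)) /qz image_measureE; apply=> t.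
rewrite m1E image_measureE; apply: (@le_lt_trans _ _ 1%E); last exact: ltry.
apply: probability_le1.
by apply: (measurable_quantile_set T0 mz); exact: measurable_itv.
Qed.

Let ge0_truncated_integral (phi : RR -> \bar R) (D := `[th, +oo[%classic) :
  measurable_fun setT phi -> (forall t, 0 <= phi t)%E ->
  (\int[U]_(v in q z @^-1` D) phi (q z v) =
   (1 - L)%:E * \int[U]_(v in q z' @^-1` D) phi (q z' v))%E.
Proof.
move=> mphi phi0; have L1 : 0 <= 1 - L by have := L01; lra.
have mqz := mq mz; have mqz' := mq mz'.
have mD : measurable (D : set RR) by exact: measurable_itv.
have I (x : RR -> RR) (mx : measurable_fun setT x) :
  (\int[image_measure mx]_(t in D) phi t = \int[U]_(v in x @^-1` D) phi (x v))%E.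
  by rewrite /image_measure ge0_integral_pushforward//; exact: measurable_funTS.
rewrite -(I _ mqz) -(I _ mqz').
have -> : (1 - L)%:E = ((NngNum L1)%:num)%:E by [].
rewrite -ge0_integral_mscale//; last exact: measurable_funTS.
apply: eq_measure_integral => A mA AD.
have := truncated_set mA; rewrite (_ : q z @^-1` A `&` ltth = set0).
  by rewrite measure0 adde0.
apply/seteqP; split=> // v [/= /AD]; rewrite /D/= in_itv/= andbT /ltth/= => a b; lra.
Qed.

Lemma truncated_integral K phi : measurable_fun (setT : set RR) phi -> (forall t, `|phi t| <= K) ->
  (1 - L) * \int[U]_v phi (q z' v) + \int[U]_(v in ltth) phi (q z v) = \int[U]_v phi (q z v).
Proof.
move=> mphi phiK.
have iphi (x : RR -> RR) : measurable_fun setT x -> U.-integrable setT (EFin \o (fun v => phi (x v))).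
  by move=> mx; apply: (@bounded_integrable _ _ _ U K) => //; exact: measurableT_comp.
rewrite [RHS](Rintegral_split measurableT mltth (iphi _ (mq mz))) setTI addrC; congr (_ + _).
set D := `[th, +oo[%classic.
have -> : setT `\` ltth = q z @^-1` D.
  apply/seteqP; split=> v; rewrite /D /ltth/= in_itv/= andbT.
    by case=> _ /negP; rewrite -leNgt.
  by move=> h; split=> //; apply/negP; rewrite -leNgt.
have mqD' : measurable (q z' @^-1` D : set RR).
  by apply: (measurable_quantile_set T0 mz'); exact: measurable_itv.
(* The truncated path has left limit 0 at th, so its quantile is almost surely in [th, +oo). *)
have -> : \int[U]_v phi (q z' v) = \int[U]_(v in q z' @^-1` D) phi (q z' v).
  rewrite [RHS]Rintegral_mkcond; apply: ae_eq_Rintegral => //.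
  - exact: integrable_measurable (iphi _ (mq mz')).
  - apply/(measurable_restrictT _ _).1 => //; apply: measurable_funTS.
    exact: integrable_measurable (iphi _ (mq mz')).
  - apply: filterS (quantile_ge_ae T0 mz' z'T thT truncated_path_left_lim) => v vth _.
    by rewrite patchE mem_set//; rewrite /D/= in_itv/= vth.
have iD := integrable_sub mqD' (iphi _ (mq mz')).
have mE : measurable_fun (setT : set RR) (EFin \o phi) by exact/measurable_EFinP.
have intE (x : RR -> R) E : (\int[U]_(v in E) (phi (x v))%:E =
    \int[U]_(v in E) (EFin \o phi)^\+ (x v) - \int[U]_(v in E) (EFin \o phi)^\- (x v))%E.
  rewrite integralE; congr (_ - _)%E; apply: eq_integral => v _.
    by rewrite !funeposE.
  by rewrite !funenegE.
have Fp : (\int[U]_(v in q z' @^-1` D) (EFin \o phi)^\+ (q z' v))%E \is a fin_num.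
  have := integrable_fin_num mqD' (integrable_funepos mqD' iD).
  by congr (_ \is a fin_num); apply: eq_integral => v _; rewrite !funeposE.
have Fn : (\int[U]_(v in q z' @^-1` D) (EFin \o phi)^\- (q z' v))%E \is a fin_num.
  have := integrable_fin_num mqD' (integrable_funeneg mqD' iD).
  by congr (_ \is a fin_num); apply: eq_integral => v _; rewrite !funenegE.
rewrite /Rintegral !intE.
have mp := measurable_funepos mE; have mn := measurable_funeneg mE.
rewrite (ge0_truncated_integral mp) ?(ge0_truncated_integral mn)//.
rewrite -/D -muleBr//; last exact: fin_num_adde_defr.
by rewrite fineM// fin_numB Fp Fn.
Qed.

(** If the time of player 2 is at least th, its conditional law is that of the truncated path. If it
    is earlier, player 1, who stops from th on, has not stopped yet and the payoff is g. *)
Lemma truncated_payoff f g h r K : monotone_path T r -> r T = 1 -> left_lim r th = 0 ->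
  measurable_fun (setT : set RR) f -> measurable_fun (setT : set RR) g ->
  measurable_fun (setT : set RR) h ->
  (forall t, `|f t| <= K) -> (forall t, `|g t| <= K) -> (forall t, `|h t| <= K) ->
  (1 - L) * raw_payoff T f g h th r z' + \int[stieltjes T z]_(t in `[0, th[) g t =
  \int[UU]_p game f g h (q r p.1) (q z p.2).
Proof.
move=> mr rT r0 mf mg mh fK gK hK.
have mtu : measurable_fun setT (fun p : (RR * RR)%type => game f g h (q r p.2) p.1).
  apply: measurable_if_lt.
  - by apply: measurableT_comp (mq mr) _; exact: measurable_snd.
  - exact: measurable_fst.
  - by apply: measurableT_comp mf _; apply: measurableT_comp (mq mr) _; exact: measurable_snd.
  - by apply: measurableT_comp mg _; exact: measurable_fst.
  - by apply: measurableT_comp mh _; apply: measurableT_comp (mq mr) _; exact: measurable_snd.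
have gameK s t : `|game f g h s t| <= K by exact: game_le.
have msec t : measurable_fun (setT : set RR) (fun u => game f g h (q r u) t).
  exact: (@measurable_fun_pair2 _ _ _ RR RR R (fun p => game f g h (q r p.2) p.1) t mtu).
pose Phi (t : RR) : R := \int[U]_u game f g h (q r u) t.
have mPhi : measurable_fun setT Phi := measurable_Rintegral_section U mtu.
have PhiK t : `|Phi t| <= K.
  exact: bounded_Rintegral (msec t) _.
have prodE x : monotone_path T x ->
    \int[UU]_p game f g h (q r p.1) (q x p.2) = \int[U]_v Phi (q x v).
  move=> mx; rewrite (Rintegral_prod2 U U (X := fun p => game f g h (q r p.1) (q x p.2)) (K := K))//.
  pose sw (p : RR * RR) : RR * RR := (q x p.2, p.1).
  rewrite (_ : (fun _ => _) = (fun p : (RR * RR)%type => game f g h (q r p.2) p.1) \o sw)//.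
  apply: measurableT_comp mtu _; apply: measurable_fun_pair; last exact: measurable_fst.
  by apply: measurableT_comp (mq mx) _; exact: measurable_snd.
rewrite (raw_payoffE T0 mr rT mz' z'T thT r0 truncated_path_left_lim mf mg mh fK gK hK).
rewrite !prodE// -(truncated_integral mPhi PhiK); congr (_ + _).
have -> : ltth = q z @^-1` `[0, th[.
  by apply/seteqP; split=> v; rewrite /ltth/= in_itv/=; case/andP: (quantile_range T0 z v) => ->.
rewrite (Rintegral_stieltjes T0 mz zT _ mg gK); last exact: measurable_itv.
apply: eq_Rintegral => v; rewrite inE/= in_itv/= => /andP[_ vth].
rewrite /Phi (ae_eq_Rintegral (Y := cst (g (q z v)))) ?probability_Rintegral_cst//.
apply: filterS (quantile_ge_ae T0 mr rT thT r0) => u uth _.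
have vu := lt_le_trans vth uth.
by rewrite /game ltNge (ltW vu) vu.
Qed.

End Truncation.

(** * Exchanging the players *)

Section PayoffSymmetry.
Context {R : realType}.
Variable T : R.
Hypothesis T0 : 0 < T.
Local Notation U := (@uniform01 R).
Local Notation RR := (measurableTypeR R).
Local Notation q := (quantile T).
Implicit Types (f g h r z : R -> R).

Lemma eq_raw_payoff f1 f2 g1 g2 h1 h2 th r z : 0 <= th ->
  (forall t, 0 <= t <= T -> f1 t = f2 t) -> (forall t, 0 <= t <= T -> g1 t = g2 t) ->
  (forall t, 0 <= t <= T -> h1 t = h2 t) ->
  raw_payoff T f1 g1 h1 th r z = raw_payoff T f2 g2 h2 th r z.
Proof.
move=> th0 f12 g12 h12.
have inT t : `[th, T]%classic t -> 0 <= t <= T by rewrite /= in_itv/=; lra.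
have inT' t : t \in `[th, T[%classic -> 0 <= t <= T by rewrite inE/= in_itv/=; lra.
rewrite /raw_payoff; congr (_ + _ + _).
- by apply: eq_Rintegral => t /inT' tT; rewrite f12.
- by apply: eq_Rintegral => t /inT' tT; rewrite g12.
- rewrite /real_sum; congr (fine (_ - _)); apply: eq_esum => t /inT tT.
    by rewrite !funeposE/= h12.
  by rewrite !funenegE/= h12.
Qed.

Lemma bounded_RintegralN {d : measure_display} {W : measurableType d} (m : probability W R)
    (X : W -> R) K : measurable_fun setT X -> (forall w, `|X w| <= K) ->
  \int[m]_w (- X w) = - (\int[m]_w X w).
Proof.
move=> mX XK; under eq_Rintegral do rewrite -mulN1r.
by rewrite RintegralZl ?mulN1r//; exact: bounded_integrable XK.
Qed.

Lemma raw_payoff_swap f g h th r z K : 0 <= th <= T ->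
  monotone_path T r -> r T = 1 -> monotone_path T z -> z T = 1 ->
  left_lim r th = 0 -> left_lim z th = 0 ->
  measurable_fun (setT : set RR) f -> measurable_fun (setT : set RR) g ->
  measurable_fun (setT : set RR) h ->
  (forall t, `|f t| <= K) -> (forall t, `|g t| <= K) -> (forall t, `|h t| <= K) ->
  raw_payoff T (fun t => - g t) (fun t => - f t) (fun t => - h t) th z r =
  - raw_payoff T f g h th r z.
Proof.
move=> thT mr rT mz zT r0 z0 mf mg mh fK gK hK.
have mN (phi : R -> R) : measurable_fun (setT : set RR) phi -> measurable_fun (setT : set RR) (fun t => - phi t).
  by move=> mphi; exact: measurable_funN.
have NK (phi : R -> R) : (forall t, `|phi t| <= K) -> forall t, `|- phi t| <= K.
  by move=> phiK t; rewrite normrN.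
rewrite (raw_payoffE T0 mz zT mr rT thT z0 r0 (mN _ mg) (mN _ mf) (mN _ mh) (NK _ gK) (NK _ fK) (NK _ hK)).
rewrite (raw_payoffE T0 mr rT mz zT thT r0 z0 mf mg mh fK gK hK).
have gameN s t : game (fun t => - g t) (fun t => - f t) (fun t => - h t) s t = - game f g h t s.
  by rewrite /game; case: (ltgtP s t) => // ->.
have gK' s t : `|game f g h s t| <= K by exact: game_le.
have mq1 x : monotone_path T x -> measurable_fun setT (fun p : (RR * RR)%type => q x p.1).
  by move=> mx; apply: measurableT_comp (measurable_path_quantile T0 mx) _; exact: measurable_fst.
have mq2 x : monotone_path T x -> measurable_fun setT (fun p : (RR * RR)%type => q x p.2).
  by move=> mx; apply: measurableT_comp (measurable_path_quantile T0 mx) _; exact: measurable_snd.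
pose X (p : RR * RR) : R := game f g h (q r p.1) (q z p.2).
pose X' (p : RR * RR) : R := game f g h (q r p.2) (q z p.1).
have mX : measurable_fun setT X.
  apply: measurable_if_lt; [exact: mq1|exact: mq2| | |].
  - exact: measurableT_comp mf (mq1 _ mr).
  - exact: measurableT_comp mg (mq2 _ mz).
  - exact: measurableT_comp mh (mq1 _ mr).
have mX' : measurable_fun setT X'.
  apply: measurable_if_lt; [exact: mq2|exact: mq1| | |].
  - exact: measurableT_comp mf (mq2 _ mr).
  - exact: measurableT_comp mg (mq1 _ mz).
  - exact: measurableT_comp mh (mq2 _ mr).
under eq_Rintegral do rewrite gameN.
rewrite (@bounded_RintegralN _ _ (U \x U)%E X' K)//.
have -> : \int[(U \x U)%E]_p game f g h (q r p.1) (q z p.2) = \int[(U \x U)%E]_p X p by [].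
have XK p : `|X p| <= K by exact: gK'.
congr (- _); rewrite (Rintegral_prod1 (K := K) U U mX')//.
- exact: esym (Rintegral_prod2 U U mX XK).
- by move=> p; exact: gK'.
- by move=> p; exact: gK'.
Qed.

Lemma Rintegral_stieltjesN K r (D : set R) (phi : R -> R) : monotone_path T r -> r T = 1 ->
  measurable (D : set RR) -> measurable_fun (setT : set RR) phi ->
  (forall t, `|phi t| <= K) ->
  \int[stieltjes T r]_(t in D) (- phi t) = - (\int[stieltjes T r]_(t in D) phi t).
Proof.
move=> mr rT mD mphi phiK.
have mN : measurable_fun (setT : set RR) (fun t => - phi t) by exact: measurable_funN.
have NK t : `|- phi t| <= K by rewrite normrN.
have mqr : measurable_fun (setT : set RR) (quantile T r) := measurable_path_quantile T0 mr.
have mqD := measurable_quantile_set T0 mr mD.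
rewrite (Rintegral_stieltjes T0 mr rT mD mN NK) (Rintegral_stieltjes T0 mr rT mD mphi phiK).
under eq_Rintegral do rewrite -mulN1r.
rewrite RintegralZl ?mulN1r//; apply: integrable_sub => //.
by apply: (@bounded_integrable _ _ _ U K) => //; exact: measurableT_comp mphi mqr.
Qed.

End PayoffSymmetry.

(** * Mixed payoffs of controls *)

Section PayoffProcesses.
Context {R : realType} {d : measure_display} {Omega : measurableType d}.
Variables (P : probability Omega R) (T : R).
Hypothesis T0 : 0 < T.
Implicit Types (f g h X xi zeta : R -> Omega -> R) (theta : Omega -> R).
Local Notation U := (@uniform01 R).
Local Notation RR := (measurableTypeR R).
Local Notation UU := (U \x U)%E.
Local Notation q := (quantile T).
Local Notation intg X := (P.-integrable setT (EFin \o X)).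

(** Measurability and bounds of payoff processes are known on [0, T] only; the extension by zero has
    them on the whole line, so that integrals over quantiles need no side condition. *)
Definition on_time X t w : R := if 0 <= t <= T then X t w else 0.

Lemma on_time_in X t w : 0 <= t <= T -> on_time X t w = X t w.
Proof. by rewrite /on_time => ->. Qed.

Lemma measurable_on_time X d' (W : measurableType d') (a : W -> R) (p : W -> Omega) :
  class_Lb P T X -> measurable_fun setT a -> measurable_fun setT p ->
  measurable_fun setT (fun w => on_time X (a w) (p w)).
Proof.
move=> [_ mX _] ma mp.
have mTS : measurable (time_space T : set (RR * Omega)%type).
  by apply: measurableX => //; exact: measurable_itv.
rewrite (_ : (fun _ => _) = ((fun p : (RR * Omega)%type => X p.1 p.2) \_ (time_space T)) \o (fun w => (a w : RR, p w))).
  apply: (@measurableT_comp _ _ _ _ (RR * Omega)%type).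
    exact: (measurable_restrictT (fun p : (RR * Omega)%type => X p.1 p.2) mTS).1 mX.
  exact: measurable_fun_pair.
apply/funext => w; rewrite /= patchE /on_time; case: ifPn => aT.
  by rewrite mem_set//; split=> //=; rewrite in_itv.
by rewrite memNset//= => -[/=]; rewrite in_itv/= (negbTE aT).
Qed.

Definition envelope X w : \bar R := ereal_sup [set `|X t w|%:E | t in `[0, T]].

Lemma envelope_ge X t w : 0 <= t <= T -> (`|X t w|%:E <= envelope X w)%E.
Proof. by move=> tT; apply: ereal_sup_ubound; exists t => //=; rewrite in_itv. Qed.

Definition dyadic_seq (m : nat) : R :=
  let ni := odflt (0, 0)%N (unpickle m) in Num.min T (ni.2%:R * mesh T ni.1).

Lemma dyadic_seq_range m : 0 <= dyadic_seq m <= T.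
Proof.
rewrite /dyadic_seq le_min ge_min lexx/= (ltW T0)/= andbT.
by rewrite mulr_ge0// ltW// mesh_gt0.
Qed.

Lemma dyadic_seq_surj t : dyadic T t -> exists m, dyadic_seq m = t.
Proof.
move=> dt; have [n [i [_ te]]] := dt; exists (pickle (n, i)).
rewrite /dyadic_seq pickleK/= -te min_r//; by case/andP: (dyadic_range T0 dt).
Qed.

(** Needed for measurability, which a countable supremum inherits. Right-continuity handles t < T,
    and T itself is dyadic. *)
Lemma envelope_dyadic X : cadlag T X ->
  envelope X = fun w => ereal_sup (range (fun m => `|X (dyadic_seq m) w|%:E)).
Proof.
move=> cX; apply/funext => w; apply/eqP; rewrite eq_le; apply/andP; split; last first.
  apply: ge_ereal_sup => _ [m _ <-]; apply: envelope_ge; exact: dyadic_seq_range.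
apply: ge_ereal_sup => _ [t + <-]; rewrite /= in_itv/= => /andP[t0 tT].
set S := ereal_sup _.
have leS s : dyadic T s -> (`|X s w|%:E <= S)%E.
  by move=> /dyadic_seq_surj[m <-]; apply: ereal_sup_ubound; exists m.
have [tT'|Tt] := ltP t T; last first.
  have tE : t = T by apply/eqP; rewrite eq_le tT Tt.
  by rewrite tE; apply: leS; exact: dyadic_T.
have t0T : 0 <= t < T by rewrite t0.
rewrite leNgt; apply/negP => SX.
have S0 : (0 <= S)%E by apply: le_trans (leS T (dyadic_T T)); rewrite lee_fin.
have [c Sc] : exists c, S = c%:E by exists (fine S); rewrite fineK// ge0_fin_numE// (lt_trans SX) ?ltry.
have [rc _] := cX w; have cv : `|X s w| @[s --> t^'+] --> `|X t w| by apply: cvg_norm; exact: rc.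
move: SX; rewrite Sc lte_fin => cX'.
have /cvgr_gt /(_ _ cX') near_c := cv.
have cdy : right_dyadic T t (fun s => c < `|X s w|) by rewrite /right_dyadic /within/=; apply: filterS near_c => s.
have tT1 : t < T + 1 by lra.
have [s [cs ds _]] := right_dyadic_ex T0 t0T cdy tT1.
by have := leS s ds; rewrite Sc lee_fin leNgt cs.
Qed.

Lemma measurable_envelope X : cadlag T X -> (forall t, 0 <= t <= T -> measurable_fun setT (X t)) ->
  measurable_fun setT (envelope X).
Proof.
move=> cX mX; rewrite (envelope_dyadic cX).
rewrite (_ : (fun _ => _) = fun w => esups ((fun m w => `|X (dyadic_seq m) w|%:E) ^~ w) 0).
  apply: measurable_fun_esups => m; apply/measurable_EFinP; apply: measurableT_comp => //.
  by apply: mX; exact: dyadic_seq_range.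
apply/funext => w; rewrite /esups /sdrop; congr ereal_sup.
by apply/seteqP; split=> [_ [m _ <-]|_ [m _ <-]]; exists m.
Qed.

Lemma class_Lb_measurable X t : class_Lb P T X -> 0 <= t <= T -> measurable_fun setT (X t).
Proof.
move=> hX tT; rewrite (_ : X t = fun w => on_time X t w).
  by apply: measurable_on_time.
by apply/funext => w; rewrite on_time_in.
Qed.

Lemma envelope_ge0 X w : (0 <= envelope X w)%E.
Proof. by apply: le_trans (envelope_ge X w (t := 0) _); rewrite ?lee_fin// lexx ltW. Qed.

Lemma envelope_integrable X : class_Lb P T X ->
  intg (fun w => fine (envelope X w)) /\
  {ae P, forall w, forall t, `|on_time X t w| <= fine (envelope X w)}.
Proof.
move=> hX; have [cX _ Xoo] := hX.
have mE : measurable_fun setT (envelope X).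
  by apply: measurable_envelope => // t; exact: class_Lb_measurable.
have iE : P.-integrable setT (envelope X).
  apply/integrableP; split=> //; under eq_integral do rewrite gee0_abs ?envelope_ge0//.
  exact: Xoo.
have aefin : {ae P, forall w, envelope X w \is a fin_num}.
  by apply: filterS (integrable_ae measurableT iE) => w; apply.
split.
- apply: le_integrable iE => //.
    by apply/measurable_EFinP; exact: measurableT_comp.
  move=> w _ /=; rewrite !gee0_abs ?envelope_ge0 ?lee_fin ?fine_ge0 ?envelope_ge0//.
  have := envelope_ge0 X w; case: (envelope X w) => [r||]//=.
    by rewrite lee_fin => r0; rewrite ger0_norm.
  by move=> _; rewrite leey.
- apply: filterS aefin => w fE t; rewrite -lee_fin fineK// /on_time.
  by case: ifPn => tT; [exact: envelope_ge|rewrite normr0 envelope_ge0].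
Qed.

(** What the payoff asks of a control, without filtration and starting time: the opponent's control
    is adapted to another filtration than the one under study. *)
Record is_randomization xi : Prop := {
  randomization_measurable : forall t, 0 <= t <= T -> measurable_fun setT (xi t);
  randomization_monotone : forall w, monotone_path T (xi ^~ w);
  randomization_total : {ae P, forall w, xi T w = 1} }.

Lemma control_randomization G theta xi : usual_filtration P T G -> control P T G theta xi ->
  is_randomization xi.
Proof.
move=> [sG _ _ _] [ad cad mono _ xiT]; split=> //.
- move=> t tT; have [sg Gm] := sG t tT.
  by move=> _ B mB; rewrite setTI; apply: Gm; exact: ad.
- by move=> w; have [? ?] := mono w.
Qed.

Variables (f g h : R -> Omega -> R).
Hypotheses (hf : class_Lb P T f) (hg : class_Lb P T g) (hh : class_Lb P T h).

Definition bound_payoff w : R :=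
  fine (envelope f w) + fine (envelope g w) + fine (envelope h w).

Lemma bound_payoff_integrable : intg bound_payoff.
Proof.
have [fi _] := envelope_integrable hf; have [gi _] := envelope_integrable hg.
have [hi _] := envelope_integrable hh.
rewrite (_ : EFin \o _ = (EFin \o (fun w => fine (envelope f w))) \+
  (EFin \o (fun w => fine (envelope g w))) \+ (EFin \o (fun w => fine (envelope h w))))%E//.
by apply: integrableD => //; exact: integrableD.
Qed.

Lemma bound_payoff_ae : {ae P, forall w, forall t, [/\ `|on_time f t w| <= bound_payoff w,
  `|on_time g t w| <= bound_payoff w & `|on_time h t w| <= bound_payoff w]}.
Proof.
have [_ fi] := envelope_integrable hf; have [_ gi] := envelope_integrable hg.
have [_ hi] := envelope_integrable hh.
apply: filterS3 fi gi hi => w fw gw hw t; rewrite /bound_payoff.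
have f0 := le_trans (normr_ge0 _) (fw t); have g0 := le_trans (normr_ge0 _) (gw t).
have h0 := le_trans (normr_ge0 _) (hw t); move: (fw t) (gw t) (hw t) => ? ? ?.
by split; lra.
Qed.

Definition timed_game w := game (on_time f ^~ w) (on_time g ^~ w) (on_time h ^~ w).

Lemma measurable_timed_game d' (W : measurableType d') (a b : W -> R) (p : W -> Omega) :
  measurable_fun setT a -> measurable_fun setT b -> measurable_fun setT p ->
  measurable_fun setT (fun w => timed_game (p w) (a w) (b w)).
Proof. by move=> ma mb mp; apply: measurable_if_lt => //; exact: measurable_on_time. Qed.

Lemma timed_game_le : {ae P, forall w, forall s t, `|timed_game w s t| <= bound_payoff w}.
Proof.
apply: filterS bound_payoff_ae => w hw s t; apply: game_le => u; by have [] := hw u.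
Qed.

(* The expected payoff of the pair of randomised stopping times given by xi and zeta,
   conditional on everything but the randomisation devices. *)
Definition mixed_payoff xi zeta w : R :=
  \int[UU]_p timed_game w (q (xi ^~ w) p.1) (q (zeta ^~ w) p.2).

Let measurable_q xi d' (W : measurableType d') (p : W -> Omega) (v : W -> RR) : is_randomization xi ->
  measurable_fun setT p -> measurable_fun setT v ->
  measurable_fun setT (fun w => q (xi ^~ (p w)) (v w)).
Proof.
move=> hxi mp mv; apply: (measurable_quantile T0 (X := fun t w => xi t (p w))) => //.
- by move=> t tT; apply: measurableT_comp mp; exact: (randomization_measurable hxi).
- by move=> w; exact: (randomization_monotone hxi).
Qed.

Lemma measurable_mixed xi zeta (a : Omega -> R -> R) : is_randomization xi -> is_randomization zeta ->
  measurable_fun setT (fun p : Omega * RR => a p.1 p.2) ->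
  measurable_fun setT (fun p : (Omega * (RR * RR))%type =>
    timed_game p.1 (a p.1 (q (xi ^~ p.1) p.2.1)) (q (zeta ^~ p.1) p.2.2)).
Proof.
move=> hxi hzeta ma; apply: measurable_timed_game; last exact: measurable_fst.
- suff mp : measurable_fun setT (fun p : (Omega * (RR * RR))%type => (p.1, q (xi ^~ p.1) p.2.1) : Omega * RR).
    exact: measurableT_comp ma mp.
  apply: measurable_fun_pair; first exact: measurable_fst.
  apply: (@measurable_q xi _ (Omega * (RR * RR))%type fst (fun p => p.2.1) hxi measurable_fst).
  by apply: measurableT_comp measurable_fst _; exact: measurable_snd.
- apply: (@measurable_q zeta _ (Omega * (RR * RR))%type fst (fun p => p.2.2) hzeta measurable_fst).
  by apply: measurableT_comp measurable_snd _; exact: measurable_snd.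
Qed.

Lemma measurable_mixed_payoff xi zeta : is_randomization xi -> is_randomization zeta ->
  measurable_fun setT (mixed_payoff xi zeta).
Proof.
move=> hxi hzeta; apply: (measurable_Rintegral_section UU
  (X := fun p => timed_game p.1 (q (xi ^~ p.1) p.2.1) (q (zeta ^~ p.1) p.2.2))).
by apply: (measurable_mixed (a := fun w s => s)) => //; exact: measurable_snd.
Qed.

Lemma mixed_payoff_le xi zeta : is_randomization xi -> is_randomization zeta ->
  {ae P, forall w, `|mixed_payoff xi zeta w| <= bound_payoff w}.
Proof.
move=> hxi hzeta; apply: filterS timed_game_le => w hw.
apply: bounded_Rintegral => //.
exact: (@measurable_fun_pair2 _ _ _ Omega (RR * RR)%type R (fun p => timed_game p.1 (q (xi ^~ p.1) p.2.1) (q (zeta ^~ p.1) p.2.2)) w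
  (measurable_mixed (a := fun w s => s) hxi hzeta measurable_snd)).
Qed.

End PayoffProcesses.

(** * Restarting and pasting controls *)

Section Restart.
Context {R : realType}.
Variable T : R.
Hypothesis T0 : 0 < T.
Implicit Types (r : R -> R) (s t u th : R).
Local Notation q := (quantile T).

(** Unlike truncation this does not renormalise: the mass accumulated before th is moved into the
    jump at th, so that a stopping time tau becomes max(tau, th). *)
Definition restart_path r th t : R := if th <= t then r t else 0.

Lemma restart_path_lt r th t : t < th -> restart_path r th t = 0.
Proof. by rewrite /restart_path leNgt => ->. Qed.

Lemma restart_path_monotone r th : monotone_path T r -> monotone_path T (restart_path r th).
Proof.
move=> [[rc lc] r0 mono]; split; first split.
- move=> t tT; have [tth|tht] := ltP t th.
    rewrite [X in _ --> X](restart_path_lt _ tth); apply: cvg_near_cst.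
    by near=> s; apply: restart_path_lt; near: s; exact: nbhs_right_lt.
  apply: (@cvg_trans _ (r s @[s --> t^'+])).
    apply: near_eq_cvg; near=> s; rewrite /restart_path.
    by rewrite (le_trans tht)//; near: s; exact: nbhs_right_ge.
  by rewrite /restart_path tht; exact: rc.
- move=> t tT; have [tth|tht] := leP t th.
    apply: (@is_cvg_near_cst _ _ 0).
    by near=> s; apply: restart_path_lt; apply: lt_le_trans tth; near: s; exact: nbhs_left_lt.
  have /cvg_ex[l rl] := lc t tT; apply/cvg_ex; exists l.
  apply: cvg_trans rl; apply: near_eq_cvg; near=> s; rewrite /restart_path.
  have ths : th <= s by near: s; exact: nbhs_left_ge.
  by rewrite ths.
- by rewrite /restart_path; case: ifP.
- move=> s t sT tT st; rewrite /restart_path; case: ifPn => ths.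
    by rewrite (le_trans ths st) mono.
  case: ifPn => // tht; apply: (le_trans r0); apply: mono => //.
    by rewrite in_itv/= lexx ltW.
  by move: tT; rewrite in_itv/= => /andP[].
Unshelve. all: by end_near. Qed.

Lemma restart_path_left_lim r th : left_lim (restart_path r th) th = 0.
Proof.
rewrite /left_lim; case: ifPn => // ; rewrite -ltNge => th0.
apply/cvg_lim => //; apply: cvg_near_cst.
by near=> s; apply: restart_path_lt; near: s; exact: nbhs_left_lt.
Unshelve. all: by end_near. Qed.

(** Both sides are compared through their lower sets. Positivity of u matters: a level u <= 0 is
    reached by the restarted path already at time 0. *)
Lemma quantile_restart r th u : monotone_path T r -> 0 <= th <= T -> 0 < u ->
  q (restart_path r th) u = Num.max (q r u) th.
Proof.
move=> mr thT u0; have m' := restart_path_monotone th mr.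
have iff t : 0 <= t <= T -> (q (restart_path r th) u <= t) = (Num.max (q r u) th <= t).
  move=> tT; rewrite ge_max !quantile_le//; case: (eqVneq t T) => [->|tneT] /=.
    by case/andP: thT.
  rewrite /restart_path; case: ifPn => tht; rewrite ?andbT// andbF.
  by apply/negbTE; rewrite -ltNge.
have qr := quantile_range T0 r u; have q'r := quantile_range T0 (restart_path r th) u.
apply/eqP; rewrite eq_le iff//; last first.
  by rewrite le_max ge_max; case/andP: thT => -> ->; case/andP: qr => -> ->.
by rewrite lexx -iff// lexx.
Qed.

Lemma restart_path_id r th t : monotone_path T r -> 0 <= th <= T -> left_lim r th = 0 ->
  0 <= t <= T -> restart_path r th t = r t.
Proof.
move=> mr thT L0 tT; rewrite /restart_path; case: ifPn => //; rewrite -ltNge => tth.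
have [_ r0 mono] := mr; apply/eqP; rewrite eq_le; apply/andP; split.
  by apply: (le_trans r0); apply: mono; [rewrite in_itv/= lexx ltW|rewrite in_itv|case/andP: tT].
rewrite -L0; apply: (left_lim_ge mr); last by case/andP: thT.
by rewrite tth; case/andP: tT => ->.
Qed.

Lemma eq_quantile r1 r2 : (forall t, 0 <= t <= T -> r1 t = r2 t) -> q r1 = q r2.
Proof.
move=> r12; apply/funext => u; rewrite /quantile; congr inf.
by apply/seteqP; split=> t /= [tT]; rewrite r12.
Qed.

End Restart.

Lemma sub_measurable_if {R : realType} {d : measure_display} {Omega : measurableType d}
    (H : set (set Omega)) (b : Omega -> bool) (X Y : Omega -> R) :
  sub_sigma H -> H [set w | b w] -> sub_measurable H X -> sub_measurable H Y ->
  sub_measurable H (fun w => if b w then X w else Y w).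
Proof.
move=> sH hb hX hY B mB.
rewrite (_ : _ @^-1` B = ([set w | b w] `&` X @^-1` B) `|` (~` [set w | b w] `&` Y @^-1` B)).
  apply: (sub_sigmaU sH); first exact: (sub_sigmaI sH hb (hX _ mB)).
  exact: (sub_sigmaI sH (sub_sigmaC sH hb) (hY _ mB)).
apply/seteqP; split=> w /=; first by case: ifP => bw; [left|right].
by case=> -[] bw; [rewrite bw|case: ifP].
Qed.

Section RestartedControls.
Context {R : realType} {d : measure_display} {Omega : measurableType d}.
Variables (P : probability Omega R) (T : R) (G : R -> set (set Omega)).
Hypotheses (T0 : 0 < T) (hG : usual_filtration P T G).
Implicit Types (theta : Omega -> R) (A : set Omega) (xi : R -> Omega -> R).
Local Notation stopping := (stopping_time T G).
Local Notation alg := (stopped_algebra T G).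

(** With xi1 = xi2 it delays a control to theta; with two different controls it pastes them along
    A. *)
Definition restart theta A xi1 xi2 t w : R :=
  restart_path (if w \in A then xi1 ^~ w else xi2 ^~ w) (theta w) t.

Lemma monotone_path_cst1 : monotone_path T (cst 1).
Proof.
split; [split|exact: ler01|by []].
  by move=> t _; exact: cvg_cst.
by move=> t _; exact: is_cvg_cst.
Qed.

Lemma control_monotone theta xi w : control P T G theta xi -> monotone_path T (xi ^~ w).
Proof. by move=> [_ cad mono _ _]; have [? ?] := mono w. Qed.

Lemma control_one : control P T G (cst 0) (fun _ _ => 1).
Proof.
split.
- move=> t tT; have sH := filtration_sub_sigma hG tT; exact: sub_measurable_cst.
- by move=> w; have [] := monotone_path_cst1.
- by move=> w; have [] := monotone_path_cst1.
- by apply: aeW => w; rewrite /left_lim lexx.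
- exact: aeW.
Qed.

(** The path is 0 before theta, so membership in A is consulted only from theta on, when an event of
    the stopped algebra is known. This yields adaptedness. *)
Lemma restart_control theta theta1 theta2 A xi1 xi2 : stopping theta -> alg theta A ->
  control P T G theta1 xi1 -> control P T G theta2 xi2 ->
  control P T G theta (restart theta A xi1 xi2).
Proof.
move=> st hA c1 c2; have [ad1 _ _ _ x1T] := c1; have [ad2 _ _ _ x2T] := c2.
have mp w : monotone_path T (restart theta A xi1 xi2 ^~ w).
  by apply: restart_path_monotone => //; case: ifPn => _; [exact: control_monotone c1|exact: control_monotone c2].
split.
- move=> t tT; have sH := filtration_sub_sigma hG tT.
  rewrite (_ : restart _ _ _ _ t = fun w => if (theta w <= t) && (w \in A) then xi1 t w
      else if theta w <= t then xi2 t w else 0); last first.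
    by apply/funext => w; rewrite /restart /restart_path; case: (theta w <= t) => //=; case: (w \in A).
  have thG : G t [set w | theta w <= t] by have [_] := st; apply.
  apply: sub_measurable_if => //.
  + rewrite (_ : [set w | _] = A `&` [set w | theta w <= t]); first exact: hA.
    by apply/seteqP; split=> w /=; [move=> /andP[-> /set_mem]|case=> /mem_set -> ->].
  + exact: ad1.
  + by apply: sub_measurable_if => //; [exact: ad2|exact: sub_measurable_cst].
- by move=> w; have [] := mp w.
- by move=> w; have [] := mp w.
- by apply: aeW => w; exact: restart_path_left_lim.
- apply: filterS2 x1T x2T => w x1 x2; rewrite /restart /restart_path.
  by have /andP[_ ->] := proj1 st w; case: ifP.
Qed.

End RestartedControls.

(** * The cost of delaying a control *)

Section Delay.
Context {R : realType}.

Lemma dominated_cvg0 {d : measure_display} {W : measurableType d} (m : probability W R)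
    (X : nat -> W -> R) (B : W -> R) : (forall n, measurable_fun setT (X n)) ->
  m.-integrable setT (EFin \o B) -> {ae m, forall w, forall n, `|X n w| <= B w} ->
  {ae m, forall w, X n w @[n --> \oo] --> 0} -> \int[m]_w X n w @[n --> \oo] --> 0.
Proof.
move=> mX iB XB X0.
have X0' : {ae m, forall w, setT w -> (X n w)%:E @[n --> \oo] --> 0%E}.
  by apply: filterS X0 => w Xw _; apply: cvg_EFin => //; exact: nearW.
have XB' : {ae m, forall w, forall n, setT w -> (`|(X n w)%:E| <= (B w)%:E)%E}.
  by apply: filterS XB => w Xw n _; rewrite lee_fin.
have mX' n : measurable_fun setT (fun w => (X n w)%:E) by exact/measurable_EFinP.
have [_ _] := dominated_convergence measurableT mX' (measurable_cst 0%E) X0' iB XB'.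
by rewrite integral0 => /fine_cvg.
Qed.

Implicit Types (f g h : R -> R) (s t th : R).

(** If s > th, then eventually th_n < s and nothing changes. If s = th, an opponent at t < th still
    collects g, one at t > th meets f (th_n) -> f th, and at t = th the payoff h is kept or drops to
    g. The last case is why only the positive part converges. *)
Lemma game_delay f g h (T : R) (th_ : nat -> R) th s t :
  (forall n, th <= th_ n) -> th_ n @[n --> \oo] --> th ->
  (th < T -> f x @[x --> th^'+] --> f th) -> g th <= h th -> th <= s -> t <= T ->
  Num.max (game f g h (Num.max s (th_ n)) t - game f g h s t) 0 @[n --> \oo] --> 0.
Proof.
move=> th_ge th_cvg f_right gh ths tT.
apply/cvgrPdist_le => e e0.
suff : \forall n \near \oo, game f g h (Num.max s (th_ n)) t - game f g h s t <= e.
  apply: filterS => n le_e; rewrite sub0r normrN ger0_norm ?le_max ?lexx ?orbT//.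
  by rewrite ge_max le_e ltW.
have [{}ths|sth] := ltP th s.
  have : \forall n \near \oo, th_ n < s by exact: (cvgr_lt _ th_cvg).
  by apply: filterS => n lt; rewrite max_l ?subrr ?ltW// ltW.
have {sth ths}-> : s = th by apply/eqP; rewrite eq_le sth.
have maxE n : Num.max th (th_ n) = th_ n by rewrite max_r.
have [tth|tht|tE] := ltgtP t th.
- near=> n; rewrite maxE /game !ltNge (ltW (lt_le_trans tth (th_ge n))) (ltW tth)/=.
  by rewrite -!ltNge (lt_le_trans tth) ?th_ge// tth subrr ltW.
- have cv := f_right (lt_le_trans tht tT).
  have : \forall n \near \oo, th_ n < t by exact: (cvgr_lt _ th_cvg).
  have fe : \forall x \near th^'+, f x - f th <= e.
    have /cvgrPdist_le /(_ _ e0) := cv; apply: filterS => x.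
    by rewrite distrC; apply: le_trans; exact: ler_norm.
  move: fe; rewrite near_withinE => /nbhs_ballP[del /= del0 hdel].
  have /cvgrPdist_lt /(_ _ del0) := th_cvg.
  apply: filterS2 => n close ltt; rewrite maxE /game ltt tht.
  have [->|ne] := eqVneq (th_ n) th; first by rewrite subrr ltW.
  by apply: hdel => //; rewrite lt_neqAle eq_sym ne th_ge.
- near=> n; rewrite maxE /game tE !ltxx; case: ltgtP (th_ge n) => // [_ _|-> _].
    by rewrite (le_trans _ (ltW e0))// subr_le0.
  by rewrite subrr ltW.
Unshelve. all: by end_near. Qed.

End Delay.

Lemma ae_prod_fst {R : realType} {d1 d2 : measure_display} {W1 : measurableType d1}
    {W2 : measurableType d2} (m1 : probability W1 R) (m2 : probability W2 R) (Q : W1 -> Prop) :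
  {ae m1, forall x, Q x} -> {ae (m1 \x m2)%E, forall p, Q p.1}.
Proof.
move=> [N [mN N0 QN]]; exists (N `*` setT); split.
- exact: measurableX.
- transitivity (m1 N * m2 setT)%E; first exact: product_measure1E.
  by rewrite N0 mul0e.
- by move=> p /= nQ; split=> //; exact: QN.
Qed.

Section DelayedControls.
Context {R : realType} {d : measure_display} {Omega : measurableType d}.
Variables (P : probability Omega R) (T : R).
Hypothesis T0 : 0 < T.
Local Notation U := (@uniform01 R).
Local Notation RR := (measurableTypeR R).
Local Notation UU := (U \x U)%E.
Local Notation q := (quantile T).
Local Notation intg X := (P.-integrable setT (EFin \o X)).
Variables (f g h xi zeta : R -> Omega -> R).
Hypotheses (hf : class_Lb P T f) (hg : class_Lb P T g) (hh : class_Lb P T h).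
Hypotheses (hxi : is_randomization P T xi) (hzeta : is_randomization P T zeta).
Hypothesis gh : {ae P, forall w t, 0 <= t <= T -> g t w <= h t w}.
Variables (theta_ : nat -> Omega -> R) (theta : Omega -> R).
Hypotheses (mtheta_ : forall n, measurable_fun setT (theta_ n)).
Hypotheses (theta_T : forall n w, 0 <= theta_ n w <= T) (thetaT : forall w, 0 <= theta w <= T).
Hypothesis dec : decreasing_to P theta_ theta.
Hypothesis xi0 : {ae P, forall w, left_lim (xi ^~ w) (theta w) = 0}.
Hypothesis hrestart : forall n, is_randomization P T (restart (theta_ n) setT xi xi).

Let tg := timed_game T f g h.
Let K := bound_payoff T f g h.
Let delayed n w (p : RR * RR) : R :=
  tg w (Num.max (q (xi ^~ w) p.1) (theta_ n w)) (q (zeta ^~ w) p.2).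
Let base w (p : RR * RR) : R := tg w (q (xi ^~ w) p.1) (q (zeta ^~ w) p.2).
Let excess n w p : R := Num.max (delayed n w p - base w p) 0.

Let mdelayed n : measurable_fun setT (fun p : (Omega * (RR * RR))%type => delayed n p.1 p.2).
Proof.
apply: (measurable_mixed T0 hf hg hh (a := fun w s => Num.max s (theta_ n w))) => //.
apply: measurable_maxr; first exact: measurable_snd.
by apply: measurableT_comp (mtheta_ n) _; exact: measurable_fst.
Qed.

Let mbase : measurable_fun setT (fun p : (Omega * (RR * RR))%type => base p.1 p.2).
Proof. by apply: (measurable_mixed T0 hf hg hh (a := fun w s => s)) => //; exact: measurable_snd. Qed.

Let mexcess n : measurable_fun setT (fun p : (Omega * (RR * RR))%type => excess n p.1 p.2).
Proof. by apply: measurable_maxr => //; exact: measurable_funB. Qed.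

Let section w (X : Omega -> (RR * RR) -> R) : measurable_fun setT (fun p : (Omega * (RR * RR))%type => X p.1 p.2) ->
  measurable_fun setT (X w).
Proof.
move=> mX; exact: (@measurable_fun_pair2 _ _ _ Omega (RR * RR)%type R (fun p => X p.1 p.2) w mX).
Qed.

Let excess_le : {ae P, forall w n p, `|excess n w p| <= 2 * K w}.
Proof.
apply: filterS (timed_game_le T0 hf hg hh) => w tgK n p.
rewrite /excess ger0_norm ?le_max ?lexx ?orbT// ge_max.
have /ler_normlP[_ ?] := tgK (Num.max (q (xi ^~ w) p.1) (theta_ n w)) (q (zeta ^~ w) p.2).
have /ler_normlP[? _] := tgK (q (xi ^~ w) p.1) (q (zeta ^~ w) p.2).
have K0 := le_trans (normr_ge0 _) (tgK 0 0).
by apply/andP; split; rewrite /delayed /base /tg /K; lra.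
Qed.

Let excess_cvg : {ae P, forall w, \int[UU]_p excess n w p @[n --> \oo] --> 0}.
Proof.
have good : {ae P, forall w, left_lim (xi ^~ w) (theta w) = 0 /\ xi T w = 1}.
  by apply: filterS2 xi0 (randomization_total hxi).
have good' : {ae P, forall w, (left_lim (xi ^~ w) (theta w) = 0 /\ xi T w = 1) /\
    forall t, 0 <= t <= T -> g t w <= h t w}.
  by apply: filterS2 good gh.
apply: filterS3 good' dec excess_le => w [[x0 xT] ghw] [decw cvw] bw.
have mx := randomization_monotone hxi w.
have th_ge n : theta w <= theta_ n w.
  have nd : nonincreasing_seq (theta_ ^~ w) by apply/nonincreasing_seqP.
  have <- : lim (theta_ n w @[n --> \oo]) = theta w by exact/cvg_lim.
  by apply: nonincreasing_cvgn_ge => //; apply/cvg_ex; exists (theta w).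
apply: (@dominated_cvg0 _ _ _ UU (fun n => excess n w) (cst (2 * K w))).
- by move=> n; exact: (section w (mexcess n)).
- exact: finite_measure_integrable_cst.
- by apply: aeW => p n; exact: bw.
- have : {ae UU, forall p, theta w <= q (xi ^~ w) p.1}.
    exact: (ae_prod_fst U (quantile_ge_ae T0 mx xT (thetaT w) x0)).
  apply: (@filterS _ _ (ae_filter_ringOfSetsType (U \x U)%E)) => p thq.
  apply: (@game_delay _ _ _ _ T (theta_ ^~ w) (theta w)) => //.
  + move=> thT'; have [cf _ _] := hf; have [rc _] := cf w.
    have th01 : 0 <= theta w < T by rewrite thT'; case/andP: (thetaT w) => ->.
    rewrite on_time_in//; apply: cvg_trans (rc _ th01); apply: near_eq_cvg; near=> s.
    rewrite on_time_in//; apply/andP; split.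
      by apply: (@le_trans _ _ (theta w)); [case/andP: th01|near: s; exact: nbhs_right_ge].
    by near: s; exact: nbhs_right_le.
  + by rewrite !on_time_in//; exact: ghw.
  + by case/andP: (quantile_range T0 (zeta ^~ w) p.2).
Unshelve. all: by end_near. Qed.

Let delayed_le n : {ae P, forall w, mixed_payoff T f g h (restart (theta_ n) setT xi xi) zeta w <=
  mixed_payoff T f g h xi zeta w + \int[UU]_p excess n w p}.
Proof.
apply: filterS2 excess_le (timed_game_le T0 hf hg hh) => w bw tgK.
have mx := randomization_monotone hxi w.
have -> : mixed_payoff T f g h (restart (theta_ n) setT xi xi) zeta w = \int[UU]_p delayed n w p.
  apply: ae_eq_Rintegral => //.
  - apply: (section w (X := fun w p => tg w (q (restart (theta_ n) setT xi xi ^~ w) p.1) (q (zeta ^~ w) p.2))).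
    by apply: (measurable_mixed T0 hf hg hh (a := fun w s => s)) => //; exact: measurable_snd.
  - exact: section (mdelayed n).
  - have := ae_prod_fst U uniform_prob_ae01; apply: filterS => p /andP[p0 _] _.
    rewrite /delayed -quantile_restart//; congr (tg w (q _ _) _).
    by apply/funext => t; rewrite /restart mem_set.
have ib : UU.-integrable setT (EFin \o base w).
  by apply: (@bounded_integrable _ _ _ UU (K w)); [exact: section mbase|move=> p; exact: tgK].
have ie : UU.-integrable setT (EFin \o excess n w).
  by apply: (@bounded_integrable _ _ _ UU (2 * K w)); [exact: section (mexcess n)|exact: bw].
have id_ : UU.-integrable setT (EFin \o delayed n w).
  by apply: (@bounded_integrable _ _ _ UU (K w)); [exact: section (mdelayed n)|move=> p; exact: tgK].
rewrite -RintegralD//; apply: le_Rintegral => //.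
  by rewrite (_ : EFin \o _ = (EFin \o base w) \+ (EFin \o excess n w))%E//; exact: integrableD.
by move=> p _; rewrite -lerBlDl /excess le_max lexx.
Qed.

(** Dominated convergence is applied twice with the bound 2 K: over the two devices for fixed w,
    which gives [excess_cvg], and then over Omega. *)
Lemma mixed_payoff_delay e : 0 < e ->
  \forall n \near \oo, \int[P]_w mixed_payoff T f g h (restart (theta_ n) setT xi xi) zeta w <=
    \int[P]_w mixed_payoff T f g h xi zeta w + e.
Proof.
move=> e0; have iK : intg K by exact: bound_payoff_integrable.
have i2K : intg (fun w => 2 * K w).
  by rewrite (_ : EFin \o _ = fun w => 2%:E * (K w)%:E)%E//; exact: integrableZl.
have mE n : measurable_fun setT (fun w => \int[UU]_p excess n w p).
  exact: (measurable_Rintegral_section UU (X := fun p => excess n p.1 p.2)).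
have Ebound : {ae P, forall w n, `|\int[UU]_p excess n w p| <= 2 * K w}.
  apply: filterS excess_le => w bw n; apply: bounded_Rintegral (bw n).
  exact: section (mexcess n).
have := dominated_cvg0 mE i2K Ebound excess_cvg.
move=> /cvgrPdist_le /(_ _ e0); apply: filterS => n; rewrite sub0r normrN => le_e.
have iE : intg (fun w => \int[UU]_p excess n w p).
  by apply: ae_le_integrable i2K => //; apply: filterS Ebound => w; apply.
have iY x : is_randomization P T x -> intg (mixed_payoff T f g h x zeta).
  move=> hx; apply: ae_le_integrable iK; first exact: mixed_payoff_le.
  exact: (measurable_mixed_payoff T0 hf hg hh hx hzeta).
apply: (@le_trans _ _ (\int[P]_w (mixed_payoff T f g h xi zeta w + \int[UU]_p excess n w p))).
  apply: ae_le_Rintegral => //; first exact: iY.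
    exact: (integrableD measurableT (iY xi hxi) iE).
  by apply: filterS (delayed_le n) => w.
rewrite RintegralD//; last exact: iY.
by rewrite lerD2l (le_trans _ le_e)// ler_norm.
Qed.

End DelayedControls.

(** * Running minima *)

Section RunningMin.
Context {R : realType} {W : Type}.
Implicit Types (y : nat -> W -> R).

Fixpoint running_min y n w : R :=
  if n is m.+1 then Num.min (running_min y m w) (y m.+1 w) else y 0%N w.

Lemma running_min_nonincreasing y w : nonincreasing_seq (running_min y ^~ w).
Proof. by apply/nonincreasing_seqP => n /=; rewrite ge_min lexx. Qed.

Lemma running_min_le y n j w : (j <= n)%N -> running_min y n w <= y j w.
Proof.
elim: n => [|n IH]; first by rewrite leqn0 => /eqP ->.
rewrite leq_eqVlt => /predU1P[->|/IH le] /=; first by rewrite ge_min lexx orbT.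
by rewrite ge_min le.
Qed.

Lemma le_running_min y n w x : (forall j, (j <= n)%N -> x <= y j w) -> x <= running_min y n w.
Proof.
elim: n => [|n IH] h; first exact: h.
by rewrite /= le_min h// andbT; apply: IH => j jn; apply: h; rewrite (leq_trans jn).
Qed.

End RunningMin.

Lemma running_min_measurable {R : realType} {d : measure_display} {Omega : measurableType d}
    (H : set (set Omega)) (y : nat -> Omega -> R) n :
  sub_sigma H -> (forall j, sub_measurable H (y j)) -> sub_measurable H (running_min y n).
Proof.
move=> [sH _] my; apply/sub_measurableP => //; elim: n => [|n IH].
  exact: (proj1 (sub_measurableP _ sH) (my 0%N)).
apply: measurable_minr => //; exact: (proj1 (sub_measurableP _ sH) (my n.+1)).
Qed.

(** * The value systems of the game *)

Section EssentialInfimumValue.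
Context {R : realType} {d : measure_display} {Omega : measurableType d}.
Variables (P : probability Omega R) (H : set (set Omega)).
Hypotheses (hH : sub_sigma H) (nullH : forall N, P.-negligible N -> H N).
Local Notation intg X := (P.-integrable setT (EFin \o X)).
Variables (I : Type) (Adm : set I) (J : I -> Omega -> \bar R) (Y : I -> Omega -> R).
Variables (C D V : Omega -> \bar R) (c e K : Omega -> R).
Hypothesis Adm_ex : Adm !=set0.
Hypotheses (Cc : {ae P, forall w, C w = (c w)%:E}) (De : {ae P, forall w, D w = (e w)%:E}).
Hypothesis e0 : {ae P, forall w, 0 <= e w}.
Hypothesis mJ : forall i, Adm i -> sub_measurable H (J i).
Hypothesis Jy : forall i, Adm i -> exists y, [/\ sub_measurable H y, intg y,
  forall A, H A -> \int[P]_(w in A) y w = \int[P]_(w in A) Y i w &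
  {ae P, forall w, (C w + D w * J i w = (y w)%:E)%E}].
Hypothesis Vinf : is_essinf P [set J i | i in Adm] V.
Hypotheses (iK : intg K) (YK : forall i, Adm i -> {ae P, forall w, `|Y i w| <= K w}).
Hypothesis mY : forall i, Adm i -> measurable_fun setT (Y i).
Hypothesis paste : forall A i j, H A -> Adm i -> Adm j -> exists2 k, Adm k &
  {ae P, forall w, Y k w = if w \in A then Y i w else Y j w}.

Let S w : \bar R := (C w + D w * V w)%E.

Let mfun_of (d' : measure_display) (T' : measurableType d') (X : Omega -> T') : sub_measurable H X -> measurable_fun setT X.
Proof. exact: sub_measurable_fun. Qed.

Let iY i : Adm i -> intg (Y i).
Proof. by move=> hi; apply: ae_le_integrable iK; [exact: YK|exact: mY]. Qed.

(** The essential infimum is an infimum along a sequence, and its running minima are realised by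
    pasted actions. Hence the infimum and the expectation can be exchanged, although single members
    of the family need not be close to the infimum. *)
Lemma essinf_value_exists : exists s, [/\ sub_measurable H s, intg s,
  {ae P, forall w, S w = (s w)%:E},
  forall i A, Adm i -> H A -> \int[P]_(w in A) s w <= \int[P]_(w in A) Y i w &
  forall eps, 0 < eps -> exists2 i, Adm i & \int[P]_w Y i w <= \int[P]_w s w + eps].
Proof.
have mJT X : [set J i | i in Adm] X -> measurable_fun setT X.
  by move=> [i hi <-]; apply: mfun_of; exact: mJ.
have [|u [uJ uinf]] := @essinf_seq_ex _ _ _ P [set J i | i in Adm] _ mJT.
  by have [i hi] := Adm_ex; exists (J i); exists i.
have [i_ hi_] : exists i_ : nat -> I, forall n, Adm (i_ n) /\ J (i_ n) = u n.
  suff /choice[i_ hi_] : forall n, exists i, Adm i /\ J i = u n by exists i_.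
  by move=> n; have [i hi <-] := uJ n; exists i.
have Vu := is_essinf_unique Vinf uinf.
have [y_ hy_] : exists y_ : nat -> Omega -> R, forall n, [/\ sub_measurable H (y_ n), intg (y_ n),
    forall A, H A -> \int[P]_(w in A) y_ n w = \int[P]_(w in A) Y (i_ n) w &
    {ae P, forall w, (C w + D w * u n w = (y_ n w)%:E)%E}].
  suff /choice[y_ hy_] : forall n, exists y, [/\ sub_measurable H y, intg y,
    forall A, H A -> \int[P]_(w in A) y w = \int[P]_(w in A) Y (i_ n) w &
    {ae P, forall w, (C w + D w * u n w = (y w)%:E)%E}] by exists y_.
  by move=> n; have [hi <-] := hi_ n; exact: Jy.
have mKneg : measurable_fun setT (EFin \o (fun w => - K w)).
  by apply/measurable_EFinP; apply: measurable_funN; exact: integrable_measurable iK.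
have iNK : intg (fun w => - K w).
  apply: ae_le_integrable (integrable_norm iK); last exact/measurable_EFinP.
  by apply: aeW => w /=; rewrite normrN.
(* The variable k, a version of E[-K | H], bounds every y_n from below, which keeps the limit of the
   running minima finite and integrable. *)
have [k [mk ik intk _]] := condexp_integrable hH iNK mKneg (aeW _ (fun w => erefl)).
have y_ge n : {ae P, forall w, k w <= y_ n w}.
  have [my iy inty _] := hy_ n; have [hi _] := hi_ n.
  apply: (sub_le_ae hH) => // A hA; rewrite intk// inty//.
  have mA := hH.2 _ hA; apply: ae_le_Rintegral => //; first exact: iY.
  by apply: filterS (YK hi) => w; rewrite ler_norml => /andP[].
pose m_ := running_min y_.
have yall : {ae P, forall w, forall n, (C w + D w * u n w = (y_ n w)%:E)%E /\ k w <= y_ n w}.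
  by apply: ae_foralln => n; have [_ _ _ Cy] := hy_ n; apply: filterS2 Cy (y_ge n).
have CDe : {ae P, forall w, [/\ C w = (c w)%:E, D w = (e w)%:E & 0 <= e w]}.
  by apply: filterS3 Cc De e0.
pose s w := lim (m_ n w @[n --> \oo]).
have m_cvg : {ae P, forall w, m_ n w @[n --> \oo] --> s w /\ forall n, k w <= s w <= m_ n w}.
  apply: filterS yall => w yw.
  have mk_ n : k w <= m_ n w by apply: le_running_min => j _; have [] := yw j.
  have nd : nonincreasing_seq (m_ ^~ w) by exact: running_min_nonincreasing.
  have cv : cvgn (m_ ^~ w).
    apply: nonincreasing_is_cvgn => //; exists (k w) => _ [n _ <-]; exact: mk_.
  split=> // n; apply/andP; split; last exact: nonincreasing_cvgn_ge.
  by apply: limr_ge => //; exact: nearW.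
have Ss : {ae P, forall w, S w = (s w)%:E}.
  have good : {ae P, forall w, V w = seq_inf u w /\ forall n, (C w + D w * u n w = (y_ n w)%:E)%E /\ k w <= y_ n w}.
    by apply: filterS2 Vu yall.
  apply: filterS3 good CDe m_cvg => w [Vw yw] [Cw Dw ew] [cv sm].
  rewrite /S Cw Dw Vw.
  have yn n : ((c w)%:E + (e w)%:E * u n w = (y_ n w)%:E)%E by have [] := yw n; rewrite Cw Dw.
  have sy n : s w <= y_ n w.
    by have /andP[_ sn] := sm n; apply: (le_trans sn); exact: running_min_le.
  (* If e w = 0, the product with V w is 0 even for infinite V w, and all y_n w equal c w. Otherwise
     u n arises from y_n by an increasing affine map, which commutes with infima. *)
  have [e00|en0] := eqVneq (e w) 0.
    rewrite e00 mul0e adde0; congr EFin; apply/eqP; rewrite eq_le.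
    have y_c n : y_ n w = c w by apply: EFin_inj; rewrite -yn e00 mul0e adde0.
    rewrite -{2}(y_c 0%N) sy andbT; apply: (limr_ge); first by apply/cvg_ex; exists (s w).
    by apply: nearW => n; apply: le_running_min => j _; rewrite y_c.
  have ep : 0 < e w by rewrite lt_neqAle eq_sym en0.
  have un n : u n w = ((y_ n w - c w) / e w)%:E.
    have := yn n; case: (u n w) => [x||]; rewrite /= ?gt0_muley ?gt0_muleNy ?lte_fin//.
    move=> h; have -> : y_ n w = c w + e w * x by apply: EFin_inj; rewrite -h.
    by congr EFin; rewrite addrAC subrr add0r mulrC mulKf.
  have inf_ge : (((s w - c w) / e w)%:E <= seq_inf u w)%E.
    by apply: le_seq_inf => n; rewrite un lee_fin ler_pM2r ?invr_gt0// lerB.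
  have inf_le n : (seq_inf u w <= ((y_ n w - c w) / e w)%:E)%E by rewrite -un; exact: seq_inf_le.
  move: inf_ge inf_le; case: (seq_inf u w) => [v||]; [|by move=> _ /(_ 0%N)|by []].
  rewrite lee_fin => inf_ge inf_le; rewrite -EFinM -EFinD; congr EFin.
  apply/eqP; rewrite eq_le; apply/andP; split.
    apply: limr_ge; first by apply/cvg_ex; exists (s w).
    apply: nearW => n; apply: le_running_min => j _; have := inf_le j.
    by rewrite lee_fin ler_pdivlMr//; lra.
  by move: inf_ge; rewrite ler_pdivrMr//; lra.
have mm n : sub_measurable H (m_ n).
  by apply: (running_min_measurable n hH) => j; have [] := hy_ j.
have ms : sub_measurable H s.
  by apply: (sub_measurable_cvg hH nullH mm); apply: filterS m_cvg => w [].
pose B w := `|k w| + `|y_ 0%N w|.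
have iB : intg B.
  by have [_ i0 _ _] := hy_ 0%N; exact: (integrableD measurableT (integrable_norm ik) (integrable_norm i0)).
have m0B n : {ae P, forall w, `|m_ n w| <= B w /\ `|s w| <= B w}.
  apply: filterS m_cvg => w [_ sm]; have /andP[ks sn] := sm n.
  have mn0 : m_ n w <= y_ 0%N w by exact: running_min_le.
  have nk := ler_norm (- k w); have nk' := ler_norm (k w); have ny := ler_norm (y_ 0%N w).
  have ny' := ler_norm (- y_ 0%N w); rewrite !normrN in nk ny'.
  by rewrite /B !ler_norml; split; apply/andP; split; lra.
have im n : intg (m_ n).
  apply: ae_le_integrable iB; first by apply: filterS (m0B n) => w [].
  exact: mfun_of.
have is_ : intg s.
  apply: ae_le_integrable iB; first by apply: filterS (m0B 0%N) => w [].
  exact: mfun_of.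
exists s; split => //.
  move=> i A hi hA; have [y [my iy inty yC]] := Jy hi; rewrite -inty//.
  have [_ /(_ (J i)) VJ _] := Vinf.
  apply: ae_le_Rintegral => //; first exact: hH.2.
  have VJi : {ae P, forall w, (V w <= J i w)%E} by apply: VJ; exists i.
  have good : {ae P, forall w, S w = (s w)%:E /\ (C w + D w * J i w = (y w)%:E)%E}.
    by apply: filterS2 Ss yC.
  apply: filterS3 good CDe VJi => w [Sw yw] [Cw Dw ew] VJw.
  by rewrite -lee_fin -Sw -yw /S Cw Dw leeD2l// lee_wpmul2l// lee_fin.
move=> eps eps0.
(* The action attaining the previous minimum is kept where that minimum is not above y_{n+1}, and
   replaced by the new action elsewhere; this event belongs to H. *)
have pasted n : exists2 i, Adm i & forall A, H A -> \int[P]_(w in A) Y i w = \int[P]_(w in A) m_ n w.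
  elim: n => [|n [i hi IH]].
    by have [hi _] := hi_ 0%N; exists (i_ 0%N) => // A hA; have [_ _ <-] := hy_ 0%N.
  have [hj _] := hi_ n.+1; have [mj ij intj _] := hy_ n.+1.
  have hA : H (~` [set w | y_ n.+1 w < m_ n w]) by apply: (sub_sigmaC hH); exact: sub_measurable_ltr.
  have [l hl Yl] := paste hA hi hj; exists l => // A' hA'.
  have mA : measurable (~` [set w | y_ n.+1 w < m_ n w]) := hH.2 _ hA.
  have mA' := hH.2 _ hA'.
  rewrite (Rintegral_split mA' mA (iY hl)) (Rintegral_split mA' mA (im n.+1)).
  have hI := sub_sigmaI hH hA' hA; have hDf := sub_sigmaD hH hA' hA.
  congr (_ + _).
    transitivity (\int[P]_(w in A' `&` ~` [set w | y_ n.+1 w < m_ n w]) Y i w).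
      apply: ae_eq_Rintegral; [exact: hH.2|exact: mY|exact: mY|].
      by apply: filterS Yl => w Yw [_ Aw]; rewrite Yw mem_set.
    rewrite IH//; apply: eq_Rintegral => w; rewrite inE => -[_ /negP]; rewrite -leNgt => le.
    by rewrite /m_ /= min_l.
  transitivity (\int[P]_(w in A' `\` ~` [set w | y_ n.+1 w < m_ n w]) Y (i_ n.+1) w).
    apply: ae_eq_Rintegral; [exact: hH.2|exact: mY|exact: mY|].
    by apply: filterS Yl => w Yw [_ Aw]; rewrite Yw memNset.
  rewrite -intj//; apply: eq_Rintegral => w; rewrite inE => -[_ /contrapT lt].
  by rewrite /m_ /= min_r// ltW.
have X0 : {ae P, forall w, m_ n w - s w @[n --> \oo] --> 0}.
  by apply: filterS m_cvg => w [cv _]; apply/subr_cvg0.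
have XB : {ae P, forall w, forall n, `|m_ n w - s w| <= B w + B w}.
  apply: ae_foralln => n; apply: filterS (m0B n) => w [mB sB].
  by apply: le_trans (ler_normB _ _) _; exact: lerD.
have iBB : intg (fun w => B w + B w) := integrableD measurableT iB iB.
have mX n : measurable_fun setT (fun w => m_ n w - s w).
  by apply: measurable_funB; exact: mfun_of.
have := dominated_cvg0 mX iBB XB X0.
move=> /cvgrPdist_le /(_ _ eps0) [n _ /(_ n (leqnn n))] /=; rewrite sub0r normrN => le_e.
have [i hi inti] := pasted n; exists i => //.
rewrite inti; last exact: sub_sigmaT.
rewrite -lerBlDl -RintegralB//; apply: le_trans le_e; exact: ler_norm.
Qed.

End EssentialInfimumValue.

(** Completeness of P enters here: the integrands in the definitions of the systems agree only a.e.
    with expressions of known measurability. *)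
Lemma ae_measurable {R : realType} d (Omega : measurableType d) (P : probability Omega R)
    d' (W : measurableType d') (X Y : Omega -> W) : measure_is_complete P ->
  {ae P, forall w, X w = Y w} -> measurable_fun setT X -> measurable_fun setT Y.
Proof.
move=> completeP XY mX _ B mB; rewrite setTI.
have sub : sub_sigma (measurable : set (set Omega)).
  by split=> //; split=> [|A mA|F mF]; [exact: measurable0|rewrite setTD; exact: measurableC|exact: bigcup_measurable].
apply: (sub_measurable_ae sub completeP XY) mB => B' mB'.
by rewrite -[X in measurable X]setTI; exact: mX.
Qed.

Section GameValue.
Context {R : realType} {d : measure_display} {Omega : measurableType d}.
Variables (P : probability Omega R) (T : R) (G : R -> set (set Omega)).
Hypotheses (T0 : 0 < T) (completeP : measure_is_complete P) (hG : usual_filtration P T G).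
Variables (f g h zeta : R -> Omega -> R).
Hypotheses (hf : class_Lb P T f) (hg : class_Lb P T g) (hh : class_Lb P T h).
Hypothesis gh : {ae P, forall w t, 0 <= t <= T -> g t w <= h t w}.
Hypothesis hzeta : is_randomization P T zeta.
Implicit Types (theta : Omega -> R) (xi : R -> Omega -> R) (A : set Omega).
Local Notation stopping := (stopping_time T G).
Local Notation alg := (stopped_algebra T G).
Local Notation intg X := (P.-integrable setT (EFin \o X)).
Local Notation U := (@uniform01 R).
Local Notation RR := (measurableTypeR R).
Local Notation UU := (U \x U)%E.
Local Notation q := (quantile T).
Local Notation K := (bound_payoff T f g h).
Local Notation mixed := (mixed_payoff T f g h).

Lemma stopping_measurable theta : stopping theta -> measurable_fun setT theta.
Proof.
move=> [rng sth] mT; apply: (measurability _ (RGenOInfty.measurableE R)) => //.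
move=> _ [_ [t ->] <-]; rewrite setTI.
have sm s : 0 <= s <= T -> measurable [set w | theta w <= s].
  by move=> sT; have [_] := filtration_sub_sigma hG sT; apply; exact: sth.
rewrite (_ : _ @^-1` _ = ~` [set w | theta w <= t]); last first.
  by apply/seteqP; split=> w /=; rewrite in_itv/= andbT ltNge => /negP.
apply: measurableC; have [t0|t0] := ltP t 0.
  rewrite (_ : [set w | _] = set0)//; apply/seteqP; split=> // w /=.
  by have /andP[] := rng w; lra.
have [tT|tT] := leP t T; first by apply: sm; rewrite t0.
rewrite (_ : [set w | _] = setT)//; apply/seteqP; split=> // w _ /=.
by have /andP[] := rng w; lra.
Qed.

(* Correcting zeta on the null event where zeta T w <> 1 makes all paths
   distribution functions. *)
Let clean t w : R := if zeta T w == 1 then zeta t w else 1.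

Let clean_ae : {ae P, forall w, clean ^~ w = zeta ^~ w}.
Proof.
by apply: filterS (randomization_total hzeta) => w zT; apply/funext => t; rewrite /clean zT eqxx.
Qed.

Let cleanT w : clean T w = 1.
Proof. by rewrite /clean; case: eqP. Qed.

Let clean_monotone w : monotone_path T (clean ^~ w).
Proof.
rewrite /clean; case: (_ == _); last exact: monotone_path_cst1.
exact: (randomization_monotone hzeta).
Qed.

Let clean_randomization : is_randomization P T clean.
Proof.
split=> [t tT|//|]; last exact: aeW.
have TT : 0 <= T <= T by rewrite lexx ltW.
apply: measurable_fun_ifT => //; last exact: (randomization_measurable hzeta).
apply: (measurable_fun_bool true); rewrite setTI.
rewrite (_ : _ @^-1` _ = [set w | zeta T w = 1]); last by apply/seteqP; split=> w /= /eqP.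
by apply: measurable_eq_set => //; exact: (randomization_measurable hzeta).
Qed.

Let measurable_inv_ge0 (X : Omega -> R) : measurable_fun setT X -> (forall w, 0 <= X w) ->
  measurable_fun setT (fun w => (X w)^-1).
Proof.
move=> mX X0; rewrite (_ : (fun _ => _) = fun w => X w `^ (-1)).
  exact: (measurableT_comp (measurable_powR (-1)) mX).
by apply/funext => w; rewrite powR_inv1.
Qed.

Section AtTime.
Variable theta : Omega -> R.
Hypothesis sth : stopping theta.
Let mtheta := stopping_measurable sth.
Let thT w : 0 <= theta w <= T. Proof. by have [rng _] := sth; exact: rng. Qed.

Let before (p : Omega * RR) : R := (q (clean ^~ p.1) p.2 < theta p.1)%R%:R.

Let mq : measurable_fun setT (fun p : Omega * RR => q (clean ^~ p.1) p.2).
Proof.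
apply: (measurable_quantile T0 (X := fun t (p : Omega * RR) => clean t p.1) (V := snd)) => //.
- move=> t tT; apply: measurableT_comp measurable_fst.
  exact: (randomization_measurable clean_randomization).
Qed.

Let mbefore_set : measurable [set p : Omega * RR | q (clean ^~ p.1) p.2 < theta p.1].
Proof. by apply: measurable_lt_set => //; exact: (measurableT_comp mtheta measurable_fst). Qed.

Let mbefore : measurable_fun setT before.
Proof. exact: (measurable_boolR (b := fun p : Omega * RR => q (clean ^~ p.1) p.2 < theta p.1) mbefore_set). Qed.

Let L w := left_lim (clean ^~ w) (theta w).

(** A left limit at a random time is not visibly measurable. It becomes so as the uniform measure of
    {q < theta}, a section integral of a jointly measurable function. *)
Let mL : measurable_fun setT L.
Proof.
rewrite (_ : L = fun w => \int[U]_v before (w, v)); first exact: (measurable_Rintegral_section U mbefore).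
apply/funext => w; rewrite /before Rintegral_boolR; last first.
  have mqw : measurable_fun (setT : set RR) (q (clean ^~ w)) := measurable_path_quantile T0 (clean_monotone w).
  exact: (@measurable_lt_set R _ RR (q (clean ^~ w)) (cst (theta w)) mqw (measurable_cst _)).
by rewrite (uniform_quantile_lt T0 (clean_monotone w) (cleanT w) (thT w)).
Qed.

Let L01 w : 0 <= L w <= 1.
Proof. exact: (left_lim_le1 (clean_monotone w) (cleanT w) (thT w)). Qed.

Let trunc := truncated clean theta.

Let trunc_randomization : is_randomization P T trunc.
Proof.
split=> [t tT|w|].
- have mc := randomization_measurable clean_randomization tT.
  rewrite (_ : trunc t = fun w => if theta w <= t then
      (if 1 - L w == 0 then 1 else (clean t w - L w) * (1 - L w)^-1) else 0)//.
  apply: measurable_fun_ifT => //; first exact: measurable_fun_ler.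
  have m1L : measurable_fun setT (fun w => 1 - L w) by exact: (measurable_funB (measurable_cst (1 : R)) mL).
  apply: measurable_fun_ifT => //.
    apply: (measurable_fun_bool true); rewrite setTI.
    rewrite (_ : _ @^-1` _ = [set w | 1 - L w = 0]); last by apply/seteqP; split=> w /= /eqP.
    exact: measurable_eq_set.
  apply: measurable_funM; first exact: (measurable_funB mc mL).
  by apply: measurable_inv_ge0 => // w; have := L01 w; lra.
- exact: (truncated_path_monotone (clean_monotone w) (cleanT w) (thT w)).
- by apply: aeW => w; exact: (truncated_path_T (cleanT w) (thT w)).
Qed.

(** A measurable stand-in for the integral of g over [0, theta) against zeta, with which it agrees
    a.e. *)
Let x1 w : R := \int[U]_v (on_time T g (q (clean ^~ w) v) w * before (w, v)).

Let mx1_joint : measurable_fun setT (fun p : Omega * RR => on_time T g (q (clean ^~ p.1) p.2) p.1 * before p).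
Proof.
apply: measurable_funM; last exact: mbefore.
exact: (measurable_on_time (a := fun p : Omega * RR => q (clean ^~ p.1) p.2) hg mq measurable_fst).
Qed.

Let mx1 : measurable_fun setT x1.
Proof.
exact: (measurable_Rintegral_section U
  (X := fun p : Omega * RR => on_time T g (q (clean ^~ p.1) p.2) p.1 * before p) mx1_joint).
Qed.

Let mon_time (X : R -> Omega -> R) w : class_Lb P T X -> measurable_fun (setT : set RR) (on_time T X ^~ w).
Proof.
move=> hX; have mid : @measurable_fun _ _ RR R setT id := @measurable_id _ RR setT.
exact: (measurable_on_time hX mid (measurable_cst w)).
Qed.

Let x1E : {ae P, forall w, x1 w = \int[stieltjes T (zeta ^~ w)]_(t in `[0, theta w[) g t w}.
Proof.
apply: filterS2 clean_ae (bound_payoff_ae T0 hf hg hh) => w cw Kw.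
have gK t : `|on_time T g t w| <= K w by have [_ ? _] := Kw t.
rewrite -cw; transitivity (\int[stieltjes T (clean ^~ w)]_(t in `[0, theta w[) on_time T g t w); last first.
  apply: eq_Rintegral => t; rewrite inE/= in_itv/= => /andP[t0 tth].
  by rewrite on_time_in// t0; have := thT w; lra.
rewrite (Rintegral_stieltjes T0 (clean_monotone w) (cleanT w) _ (mon_time w hg) gK); last exact: measurable_itv.
rewrite Rintegral_mkcond; apply: eq_Rintegral => v _; rewrite patchE /before/=.
have /andP[q0 _] := quantile_range T0 (clean ^~ w) v.
have -> : (v \in quantile T (clean ^~ w) @^-1` `[0, theta w[) = (q (clean ^~ w) v < theta w).
  by apply/idP/idP => [/set_mem|lt]; [|apply/mem_set]; rewrite /= in_itv/= q0.
by case: ifP; rewrite ?mulr1 ?mulr0.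
Qed.

Let survE : {ae P, forall w, survival zeta theta w = 1 - L w}.
Proof. by apply: filterS clean_ae => w cw; rewrite /survival /L cw. Qed.

Let raw xi w : R := raw_payoff T (f ^~ w) (g ^~ w) (h ^~ w) (theta w) (xi ^~ w) (truncated zeta theta ^~ w).

Let raw_on_time xi z w :
  raw_payoff T (on_time T f ^~ w) (on_time T g ^~ w) (on_time T h ^~ w) (theta w) (xi ^~ w) z =
  raw_payoff T (f ^~ w) (g ^~ w) (h ^~ w) (theta w) (xi ^~ w) z.
Proof.
have /andP[th0 _] := thT w.
by apply: eq_raw_payoff => // t tT; rewrite on_time_in.
Qed.

Let good xi : control P T G theta xi -> {ae P, forall w, [/\ clean ^~ w = zeta ^~ w,
  left_lim (xi ^~ w) (theta w) = 0, xi T w = 1 &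
  forall t, [/\ `|on_time T f t w| <= K w, `|on_time T g t w| <= K w & `|on_time T h t w| <= K w]]}.
Proof.
move=> [_ _ _ xi0 xiT].
have xiae : {ae P, forall w, left_lim (xi ^~ w) (theta w) = 0 /\ xi T w = 1} by apply: filterS2 xi0 xiT.
by apply: filterS3 xiae clean_ae (bound_payoff_ae T0 hf hg hh) => w [].
Qed.

Let raw_mixed xi : control P T G theta xi -> {ae P, forall w, raw xi w = mixed xi trunc w}.
Proof.
move=> hxi; apply: filterS (good hxi) => w [cw x0 xT Kw].
have mx := control_monotone w hxi.
rewrite /raw -raw_on_time.
rewrite (_ : truncated zeta theta ^~ w = truncated_path (clean ^~ w) (theta w)); last by rewrite cw.
apply: (raw_payoffE (K := K w) T0 mx xT _ _ (thT w) x0) => //; try exact: mon_time.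
- exact: (truncated_path_monotone (clean_monotone w) (cleanT w) (thT w)).
- exact: (truncated_path_T (cleanT w) (thT w)).
- exact: truncated_path_left_lim.
- by move=> t; have [] := Kw t.
- by move=> t; have [] := Kw t.
- by move=> t; have [] := Kw t.
Qed.

Let surv_mixed xi : control P T G theta xi ->
  {ae P, forall w, (1 - L w) * mixed xi trunc w + x1 w = mixed xi zeta w}.
Proof.
move=> hxi; apply: filterS3 (good hxi) (raw_mixed hxi) x1E => w [cw x0 xT Kw] rw x1w.
have mx := control_monotone w hxi.
have fK t : `|on_time T f t w| <= K w by have [] := Kw t.
have gK t : `|on_time T g t w| <= K w by have [] := Kw t.
have hK t : `|on_time T h t w| <= K w by have [] := Kw t.
have := truncated_payoff T0 (clean_monotone w) (cleanT w) (thT w) mx xT x0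
  (mon_time w hf) (mon_time w hg) (mon_time w hh) fK gK hK.
rewrite /mixed_payoff /timed_game cw -/(timed_game T f g h w) => <-; rewrite raw_on_time.
rewrite -/(raw xi w) rw x1w /L cw -/(mixed xi trunc w); congr (_ + _).
apply: eq_Rintegral => t; rewrite inE/= in_itv/= => /andP[t0 tth].
by rewrite on_time_in// t0; have := thT w; lra.
Qed.

Let x1K : {ae P, forall w, `|x1 w| <= K w}.
Proof.
apply: filterS (bound_payoff_ae T0 hf hg hh) => w Kw; apply: bounded_Rintegral.
  exact: (@measurable_fun_pair2 _ _ _ Omega RR R (fun p : Omega * RR => on_time T g (q (clean ^~ p.1) p.2) p.1 * before p) w mx1_joint).
by move=> v; apply: ler_norm_boolR; have [] := Kw (q (clean ^~ w) v).
Qed.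

Let C := condexp P (alg theta) (fun w => (\int[stieltjes T (zeta ^~ w)]_(t in `[0, theta w[) g t w)%R%:E).
Let D := condexp P (alg theta) (EFin \o survival zeta theta).
Let J xi := cond_payoff P T f g h (weight P T zeta G theta) theta xi (truncated zeta theta) (alg theta).
Let sH : sub_sigma (alg theta) := stopped_sub_sigma T0 hG sth.

Let iK : intg K := bound_payoff_integrable T0 hf hg hh.

Let mixed_integrable xi z : is_randomization P T xi -> is_randomization P T z -> intg (mixed xi z).
Proof.
move=> hxi hz; apply: ae_le_integrable iK; first exact: mixed_payoff_le.
exact: (measurable_mixed_payoff T0 hf hg hh hxi hz).
Qed.

Let CE : exists c, [/\ sub_measurable (alg theta) c, intg c,
  forall A, alg theta A -> \int[P]_(w in A) c w = \int[P]_(w in A) x1 w &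
  {ae P, forall w, C w = (c w)%:E}].
Proof.
have x1ae : {ae P, forall w, ((\int[stieltjes T (zeta ^~ w)]_(t in `[0, theta w[) g t w)%R%:E = (x1 w)%:E)%E}.
  by apply: filterS x1E => w ->.
apply: (condexp_integrable sH) => //.
  by apply: ae_le_integrable iK => //; exact: x1K.
apply: (ae_measurable completeP (X := EFin \o x1)); last exact/measurable_EFinP.
by apply: filterS x1E => w /= ->.
Qed.

Let surv w : R := 1 - L w.
Let msurv : measurable_fun setT surv. Proof. exact: (measurable_funB (measurable_cst (1 : R)) mL). Qed.
Let surv01 w : 0 <= surv w <= 1. Proof. by have := L01 w; rewrite /surv; lra. Qed.
Let isurv : intg surv.
Proof.
apply: (@bounded_integrable _ _ _ P 1) => // w.
by have := surv01 w; rewrite ler_norml; lra.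
Qed.

Let DE : exists e, [/\ sub_measurable (alg theta) e, intg e,
  forall A, alg theta A -> \int[P]_(w in A) e w = \int[P]_(w in A) surv w,
  {ae P, forall w, D w = (e w)%:E} & {ae P, forall w, 0 <= e w}].
Proof.
have [||e [me ie inte De]] := condexp_integrable sH (X := EFin \o survival zeta theta) isurv.
- apply: (ae_measurable completeP (X := EFin \o surv)); last exact/measurable_EFinP.
  by apply: filterS survE => w /= ->.
- by apply: filterS survE => w /= ->.
exists e; split=> //; have iz : intg (cst 0) by exact: finite_measure_integrable_cst.
apply: (sub_le_ae sH) => //; first exact: sub_measurable_cst.
move=> A hA; rewrite inte// Rintegral_cst; last exact: sH.2.
by rewrite mul0r; apply: Rintegral_ge0 => w _; have := surv01 w; lra.
Qed.

(* On the event where the weight has a zero denominator the survival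
   probability vanishes almost surely, so that event does not contribute. *)
Let game_condexp_fin xi : control P T G theta xi -> exists y, [/\ sub_measurable (alg theta) y, intg y,
  forall A, alg theta A -> \int[P]_(w in A) y w = \int[P]_(w in A) mixed xi zeta w,
  {ae P, forall w, (C w + D w * J xi w = (y w)%:E)%E} &
  {ae P, forall w, J xi w \is a fin_num} /\
  measurable_fun setT (fun w => (weight P T zeta G theta w * raw xi w)%:E)].
Proof.
move=> hxi; have rxi := control_randomization hG hxi.
have [c [mc ic intc Cc]] := CE; have [e [me ie inte De e0]] := DE.
have [sa _] := sH.
pose del w := fine (D w).
have mdel : sub_measurable (alg theta) del by apply: (sub_measurable_fine sH); exact: condexp_measurable.
have Z : alg theta [set w | del w == 0].
  rewrite (_ : [set w | _] = del @^-1` [set 0]); first exact: mdel.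
  by apply/seteqP; split=> w /= /eqP.
have mZ := sH.2 _ Z.
have mdelb : measurable_fun setT (fun w => del w == 0).
  by apply: (measurable_fun_bool true); rewrite setTI.
(* The reciprocal of the weight's denominator, with the value 1 of the convention at zero. The
   absolute value makes it nonnegative everywhere, whereas [del] is so only a.e. *)
pose cc w : R := if del w == 0 then 1 else `|del w|^-1.
have mcc : sub_measurable (alg theta) cc.
  apply: (sub_measurable_if sH) => //; first exact: sub_measurable_cst.
  rewrite (_ : (fun _ => _) = (fun x : R => `|x| `^ (-1)) \o del); last first.
    by apply/funext => w; rewrite /= powR_inv1.
  have mpow : measurable_fun setT (fun x : R => `|x| `^ (-1)).
    exact: (measurableT_comp (measurable_powR (-1)) (@normr_measurable R setT)).
  move=> B mB; rewrite comp_preimage; apply: mdel.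
  by rewrite -[X in measurable X]setTI; exact: mpow.
have cc0 w : 0 <= cc w by rewrite /cc; case: ifP => // _; rewrite ?invr_ge0.
pose Q := mixed xi trunc.
have mQ : measurable_fun setT Q by exact: (measurable_mixed_payoff T0 hf hg hh rxi trunc_randomization).
have iQ : intg Q := mixed_integrable rxi trunc_randomization.
have isQ : intg (fun w => surv w * Q w).
  apply: (ae_le_integrable (Y := fun w => `|Q w|)); last exact: (integrable_norm iQ).
    by apply: aeW => w; rewrite normrM ler_piMl// ger0_norm; have := surv01 w; lra.
  exact: measurable_funM.
(* What remains of the weighted payoff once [cc] is taken out. Being dominated by |Q| it is
   integrable, so [condexp_mul] applies. *)
pose X0 w : R := if del w == 0 then Q w else surv w * Q w.
have mX0 : measurable_fun setT X0 by apply: measurable_fun_ifT => //; exact: measurable_funM.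
have iX0 : intg X0.
  apply: (ae_le_integrable (Y := fun w => `|Q w|)) => //; last exact: (integrable_norm iQ).
  apply: aeW => w; rewrite /X0; case: ifP => // _.
  by rewrite normrM ler_piMl// ger0_norm; have := surv01 w; lra.
have del_e : {ae P, forall w, del w = e w} by apply: filterS De => w Dw; rewrite /del Dw.
pose X w : \bar R := (weight P T zeta G theta w * raw xi w)%:E.
have XE : {ae P, forall w, X w = (cc w * X0 w)%:E}.
  have good2 : {ae P, forall w, del w = e w /\ 0 <= e w} by apply: filterS2 del_e e0.
  apply: filterS3 good2 survE (raw_mixed hxi) => w [de ew] sw rw.
  rewrite /X rw /weight -/(del w) /div_or1 sw /cc /X0 -/(Q w); case: ifP => [_|d0]; first by [].
  by rewrite -/(surv w) ger0_norm ?de//; congr EFin; rewrite mulrA [surv w / _]mulrC.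
have mX : measurable_fun setT X.
  apply: (ae_measurable completeP (X := EFin \o (fun w => cc w * X0 w))).
    by apply: filterS XE => w /= ->.
  by apply/measurable_EFinP; apply: measurable_funM => //; exact: (sub_measurable_fun sH mcc).
have [Y0 [mY0 iY0 intY0 JY]] := condexp_mul sH mcc cc0 iX0 mX XE.
pose y w := c w + (if del w == 0 then 0 else Y0 w).
have mif : sub_measurable (alg theta) (fun w => if del w == 0 then 0 else Y0 w).
  by apply: (sub_measurable_if sH) => //; exact: sub_measurable_cst.
have iif : intg (fun w => if del w == 0 then 0 else Y0 w).
  apply: (ae_le_integrable (Y := fun w => `|Y0 w|)); last exact: (integrable_norm iY0).
    by apply: aeW => w; case: ifP; rewrite ?normr0.
  exact: (sub_measurable_fun sH mif).
exists y; split.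
- apply/(sub_measurableP _ sa); apply: measurable_funD; exact/(sub_measurableP _ sa).
- exact: (integrableD measurableT ic iif).
- move=> A hA; have mA := sH.2 _ hA.
  (* The event {del = 0} lies in the stopped algebra, so the integral of [surv] over it equals that
     of its conditional expectation, which is zero there. *)
  have surv0 : {ae P, forall w, del w == 0 -> surv w = 0}.
    have hZ0 : measurable [set w | 0 < surv w] by exact: measurable_lt_set.
    have neg : P.-negligible ([set w | del w == 0] `&` [set w | 0 < surv w]).
      apply: (Rintegral_pos_null _ isurv); [exact: measurableI|by move=> w []|].
      have : \int[P]_(w in [set w | del w == 0]) surv w = 0.
        rewrite -inte// -[RHS](Rintegral_set0 P e) (_ : \int[P]_(w in [set w | del w == 0]) e w = \int[P]_(w in [set w | del w == 0]) 0).
          by rewrite Rintegral_cst// mul0r Rintegral_set0.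
        apply: ae_eq_Rintegral => //; first exact: integrable_measurable ie.
        by apply: filterS del_e => w <- /eqP.
      rewrite (Rintegral_split mZ hZ0 isurv) => E0.
      have : 0 <= \int[P]_(w in [set w | del w == 0] `\` [set w | 0 < surv w]) surv w.
        by apply: Rintegral_ge0 => w _; have := surv01 w; lra.
      lra.
    apply: negligibleS neg => w /= /not_implyP[d0 /eqP s0]; split=> //.
    by rewrite lt_neqAle eq_sym s0; have /andP[] := surv01 w.
  rewrite RintegralD//; [|exact: integrable_sub..].
  rewrite intc//.
  have -> : \int[P]_(w in A) (if del w == 0 then 0 else Y0 w) = \int[P]_(w in A) (surv w * Q w).
    rewrite (Rintegral_split mA mZ iif) (Rintegral_split mA mZ isQ); congr (_ + _).
      apply: ae_eq_Rintegral; [exact: measurableI|exact: (sub_measurable_fun sH mif)|exact: measurable_funM|].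
      by apply: filterS surv0 => w s0 [_ /= d0]; rewrite d0 s0// mul0r.
    transitivity (\int[P]_(w in A `\` [set w | del w == 0]) Y0 w).
      by apply: eq_Rintegral => w; rewrite inE => -[_ /= /negP/negbTE ->].
    rewrite intY0; last exact: (sub_sigmaD sH hA Z).
    by apply: eq_Rintegral => w; rewrite inE => -[_ /= /negP/negbTE d0]; rewrite /X0 d0.
  have ix1 : intg x1 by apply: ae_le_integrable iK => //; exact: x1K.
  rewrite -RintegralD//; [|exact: integrable_sub..].
  apply: ae_eq_Rintegral => //.
  + by apply: measurable_funD => //; exact: measurable_funM.
  + exact: (measurable_mixed_payoff T0 hf hg hh rxi hzeta).
  + by apply: filterS (surv_mixed hxi) => w <- _; rewrite addrC.
- have good2 : {ae P, forall w, del w = e w /\ 0 <= e w} by apply: filterS2 del_e e0.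
  have good3 : {ae P, forall w, C w = (c w)%:E /\ D w = (e w)%:E} by apply: filterS2 Cc De.
  apply: filterS3 good2 good3 JY => w [de ew] [Cw Dw] Jw.
  rewrite Cw Dw (_ : J xi w = condexp P (alg theta) X w)// Jw -EFinM -EFinD /y /cc; congr EFin; congr (_ + _).
  rewrite -de; case: (eqVneq (del w) 0) => [->|d0]; first by rewrite mul0r.
  have dw : 0 <= del w by rewrite de.
  by rewrite (ger0_norm dw) mulVKf.
- split; last exact: mX.
  by apply: filterS JY => w Jw; rewrite (_ : J xi w = condexp P (alg theta) X w)// Jw.
Qed.

Let game_condexp xi : control P T G theta xi -> exists y, [/\ sub_measurable (alg theta) y, intg y,
  forall A, alg theta A -> \int[P]_(w in A) y w = \int[P]_(w in A) mixed xi zeta w &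
  {ae P, forall w, (C w + D w * J xi w = (y w)%:E)%E}].
Proof. by move=> /game_condexp_fin[y [? ? ? ? _]]; exists y. Qed.

Lemma cond_payoff_fin xi : control P T G theta xi -> {ae P, forall w, J xi w \is a fin_num}.
Proof. by move=> /game_condexp_fin[y [_ _ _ _ []]]. Qed.

Lemma weighted_payoff_measurable xi : control P T G theta xi ->
  measurable_fun setT (fun w => (weight P T zeta G theta w * raw xi w)%:E).
Proof. by move=> /game_condexp_fin[y [_ _ _ _ []]]. Qed.

Lemma survival_integral_fin : [/\ {ae P, forall w, C w \is a fin_num},
  {ae P, forall w, D w \is a fin_num} &
  measurable_fun setT (fun w => (\int[stieltjes T (zeta ^~ w)]_(t in `[0, theta w[) g t w)%R%:E)].
Proof.
have [c [_ _ _ Cc]] := CE; have [e [_ _ _ De _]] := DE; split.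
- by apply: filterS Cc => w ->.
- by apply: filterS De => w ->.
- apply: (ae_measurable completeP (X := EFin \o x1)); last exact/measurable_EFinP.
  by apply: filterS x1E => w /= ->.
Qed.

Lemma raw_payoff_swap_ae xi : control P T G theta xi ->
  {ae P, forall w, raw_payoff T (fun t => - g t w) (fun t => - f t w) (fun t => - h t w) (theta w)
    (truncated zeta theta ^~ w) (xi ^~ w) = - raw xi w}.
Proof.
move=> hxi; apply: filterS (good hxi) => w [cw x0 xT Kw].
have mx := control_monotone w hxi.
have mt := truncated_path_monotone (clean_monotone w) (cleanT w) (thT w).
have tT : truncated_path (clean ^~ w) (theta w) T = 1 := truncated_path_T (cleanT w) (thT w).
have fK t : `|on_time T f t w| <= K w by have [] := Kw t.
have gK t : `|on_time T g t w| <= K w by have [] := Kw t.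
have hK t : `|on_time T h t w| <= K w by have [] := Kw t.
rewrite /raw -raw_on_time (_ : truncated zeta theta ^~ w = truncated_path (clean ^~ w) (theta w)); last by rewrite cw.
have /andP[th0 _] := thT w.
rewrite -(raw_payoff_swap T0 (thT w) mx xT mt tT x0 _ (mon_time w hf) (mon_time w hg) (mon_time w hh) fK gK hK); last first.
  exact: truncated_path_left_lim.
by apply: eq_raw_payoff => // t t0T; rewrite on_time_in.
Qed.

Lemma stieltjes_opp_ae : {ae P, forall w,
  \int[stieltjes T (zeta ^~ w)]_(t in `[0, theta w[) (- g t w) =
  - (\int[stieltjes T (zeta ^~ w)]_(t in `[0, theta w[) g t w)}.
Proof.
have gae : {ae P, forall w t, `|on_time T g t w| <= K w}.
  by apply: filterS (bound_payoff_ae T0 hf hg hh) => w Kw t; have [] := Kw t.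
apply: filterS2 clean_ae gae => w cw gK; rewrite -cw.
have inT t : t \in `[0, theta w[%classic -> 0 <= t <= T.
  by rewrite inE/= in_itv/= => /andP[t0 tth]; have := thT w; lra.
transitivity (\int[stieltjes T (clean ^~ w)]_(t in `[0, theta w[) (- on_time T g t w)).
  by apply: eq_Rintegral => t /inT tT; rewrite on_time_in.
rewrite (Rintegral_stieltjesN T0 (clean_monotone w) (cleanT w) _ (mon_time w hg) gK); last exact: measurable_itv.
by congr (- _); apply: eq_Rintegral => t /inT tT; rewrite on_time_in.
Qed.

Variable V : Omega -> \bar R.
Hypothesis Vinf : is_essinf P [set J xi | xi in control P T G theta] V.

Lemma game_value_exists : exists s, [/\ sub_measurable (alg theta) s, intg s,
  {ae P, forall w, (C w + D w * V w = (s w)%:E)%E},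
  forall xi A, control P T G theta xi -> alg theta A ->
    \int[P]_(w in A) s w <= \int[P]_(w in A) mixed xi zeta w &
  forall eps, 0 < eps -> exists2 xi, control P T G theta xi &
    \int[P]_w mixed xi zeta w <= \int[P]_w s w + eps].
Proof.
have [c [_ _ _ Cc]] := CE; have [e [_ _ _ De e0]] := DE.
apply: (essinf_value_exists sH _ _ Cc De e0 _ game_condexp Vinf iK).
- by move=> N; exact: (stopped_null hG).
- exists (restart theta setT (fun _ _ => 1) (fun _ _ => 1)).
  by apply: (restart_control T0 hG sth (sub_sigmaT sH)); exact: (control_one hG).
- by move=> xi _; exact: condexp_measurable.
- by move=> xi hxi; apply: mixed_payoff_le => //; exact: control_randomization hG hxi.
- move=> xi hxi; exact: (measurable_mixed_payoff T0 hf hg hh (control_randomization hG hxi) hzeta).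
- move=> A xi1 xi2 hA h1 h2; exists (restart theta A xi1 xi2); first exact: (restart_control T0 hG sth hA h1 h2).
  have [_ _ _ l1 _] := h1; have [_ _ _ l2 _] := h2.
  apply: filterS2 l1 l2 => w l1w l2w; rewrite /mixed_payoff /restart.
  case: ifPn => wA.
    rewrite (eq_quantile (r1 := restart_path (xi1 ^~ w) (theta w)) (r2 := xi1 ^~ w))// => t tT.
    exact: (restart_path_id T0 (control_monotone w h1)).
  rewrite (eq_quantile (r1 := restart_path (xi2 ^~ w) (theta w)) (r2 := xi2 ^~ w))// => t tT.
  exact: (restart_path_id T0 (control_monotone w h2)).
Qed.

End AtTime.

Variable V : (Omega -> R) -> Omega -> \bar R.
Hypothesis Vinf : forall theta, stopping theta -> is_essinf P
  [set cond_payoff P T f g h (weight P T zeta G theta) theta xi (truncated zeta theta) (alg theta)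
  | xi in control P T G theta] (V theta).

Let S theta w : \bar R :=
  (condexp P (alg theta) (fun w' => (\int[stieltjes T (zeta ^~ w')]_(t in `[0, theta w'[) g t w')%R%:E) w
   + condexp P (alg theta) (EFin \o survival zeta theta) w * V theta w)%E.

Lemma control_le theta1 theta2 : stopping theta1 -> stopping theta2 ->
  {ae P, forall w, theta1 w <= theta2 w} -> control P T G theta2 `<=` control P T G theta1.
Proof.
move=> s1 s2 le12 xi hxi; have [ad cad mono l2 xiT] := hxi; split=> //.
apply: filterS2 l2 le12 => w l2w; rewrite le_eqVlt => /predU1P[->//|lt12].
have mx := control_monotone w hxi; have [_ x0 _] := mx.
have /andP[t10 t1T] := (proj1 s1 w); have /andP[_ t2T] := (proj1 s2 w).
apply/eqP; rewrite eq_le (left_lim_ge0 mx)// andbT -l2w.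
apply: (le_trans (left_lim_le mx _)); first by rewrite t10.
by apply: (left_lim_ge mx) => //; rewrite t10.
Qed.

Lemma game_is_value : exists2 s, is_value P T G s (mixed ^~ zeta) (control P T G) K &
  forall theta, stopping theta -> {ae P, forall w, S theta w = (s theta w)%:E}.
Proof.
have /choice[s hs] : forall theta, exists s, stopping theta -> [/\ sub_measurable (alg theta) s, intg s,
  {ae P, forall w, S theta w = (s w)%:E},
  forall xi A, control P T G theta xi -> alg theta A ->
    \int[P]_(w in A) s w <= \int[P]_(w in A) mixed xi zeta w &
  forall eps, 0 < eps -> exists2 xi, control P T G theta xi &
    \int[P]_w mixed xi zeta w <= \int[P]_w s w + eps].
  move=> theta; have [sth|nsth] := pselect (stopping theta); last by exists (cst 0).
  by have [s hs] := game_value_exists sth (Vinf sth); exists s.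
exists s; last by move=> theta /hs[].
split.
- by move=> theta /hs[].
- by move=> theta /hs[].
- by move=> theta xi A /hs[_ _ _ + _]; apply.
- by move=> theta e /hs[_ _ _ _]; apply.
- move=> theta xi _ hxi; exact: (measurable_mixed_payoff T0 hf hg hh (control_randomization hG hxi) hzeta).
- by move=> theta xi _ hxi; apply: mixed_payoff_le => //; exact: control_randomization hG hxi.
- exact: bound_payoff_integrable.
- exact: control_le.
- move=> theta1 theta2 A xi s1 s2 A12 hA hxi.
  (* On A the two times coincide and xi vanishes before them, so restarting changes nothing; off A
     only admissibility from theta1 on is asked. *)
  exists (restart theta1 setT xi xi).
    exact: (restart_control T0 hG s1 (sub_sigmaT (stopped_sub_sigma T0 hG s1)) hxi hxi).
  have [_ _ _ l2 _] := hxi; apply: filterS l2 => w l2w Aw; rewrite /mixed_payoff /restart mem_set//.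
  have mx := control_monotone w hxi.
  rewrite (eq_quantile (r1 := restart_path (xi ^~ w) (theta1 w)) (r2 := xi ^~ w))// => t tT.
  by rewrite (A12 _ Aw); apply: (restart_path_id T0 mx) => //; have [rng _] := s2; exact: rng.
- move=> theta_ theta xi st_ sth dec hxi.
  have hr n : control P T G (theta_ n) (restart (theta_ n) setT xi xi).
    exact: (restart_control T0 hG (st_ n) (sub_sigmaT (stopped_sub_sigma T0 hG (st_ n))) hxi hxi).
  exists (fun n => restart (theta_ n) setT xi xi) => // e e0.
  have [_ _ _ l _] := hxi.
  apply: (mixed_payoff_delay T0 hf hg hh (control_randomization hG hxi) hzeta gh _ _ _ dec l) => //.
  + by move=> n; exact: stopping_measurable.
  + by move=> n; have [] := st_ n.
  + by have [] := sth.
  + by move=> n; exact: control_randomization hG (hr n).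
Qed.

Lemma game_value_measurable theta : stopping theta -> sub_measurable (alg theta) (S theta).
Proof.
move=> sth; have [s [ms _ Ss _ _]] := game_value_exists sth (Vinf sth).
apply: (sub_measurable_ae (stopped_sub_sigma T0 hG sth) _ (X := EFin \o s)).
- by move=> N; exact: (stopped_null hG).
- by apply: filterS Ss => w Sw; rewrite /S Sw.
- exact: (sub_measurable_EFin (stopped_sub_sigma T0 hG sth) ms).
Qed.

End GameValue.

(** * Change of sign *)

Section Negation.
Context {R : realType} {d : measure_display} {Omega : measurableType d}.
Variables (P : probability Omega R) (T : R).
Implicit Types (H : set (set Omega)) (X Y : Omega -> \bar R) (G : R -> set (set Omega)).

(** The equality holds at every point: a.e. equal variables have the same set of versions, from
    which [xget] makes the same choice. *)
Lemma condexp_ae H X Y : sub_sigma H -> measurable_fun setT X -> measurable_fun setT Y ->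
  {ae P, forall w, X w = Y w} -> condexp P H X = condexp P H Y.
Proof.
move=> [_ sH] mX mY XY.
have E (X' Y' : Omega -> \bar R) : measurable_fun setT X' -> measurable_fun setT Y' ->
    {ae P, forall w, X' w = Y' w} -> nonneg_condexp P H X' = nonneg_condexp P H Y'.
  move=> mX' mY' XY'; rewrite /nonneg_condexp; congr xget.
  have I A : H A -> (\int[P]_(w in A) X' w = \int[P]_(w in A) Y' w)%E.
    move=> hA; apply: ae_eq_integral; [exact: sH|exact: measurable_funTS|exact: measurable_funTS|].
    by apply: filterS XY' => w.
  apply/seteqP; split=> Z [Z0 mZ ZI]; split=> // A hA; first by rewrite ZI// I.
  by rewrite ZI// I.
rewrite /condexp (E X^\+%E Y^\+%E) ?(E X^\-%E Y^\-%E)//; try exact: measurable_funepos; try exact: measurable_funeneg.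
- by apply: filterS XY => w h; rewrite !funenegE h.
- by apply: filterS XY => w h; rewrite !funeposE h.
Qed.

(** Finiteness excludes the difference of two infinities, whose conventional value does not change
    sign when the two terms are exchanged. *)
Lemma condexpN H X w : sub_sigma H -> condexp P H X w \is a fin_num ->
  (condexp P H (fun w => - X w) w = - condexp P H X w)%E.
Proof.
move=> hH; rewrite /condexp (_ : (fun w => - X w)^\+%E = X^\-%E); last first.
  by apply/funext => w'; rewrite funeposE funenegE.
rewrite (_ : (fun w => - X w)^\-%E = X^\+%E); last first.
  by apply/funext => w'; rewrite funeposE funenegE oppeK.
rewrite /=; have := nonneg_condexp_ge0 P H X^\+%E w; have := nonneg_condexp_ge0 P H X^\-%E w.
case: (nonneg_condexp P H X^\+%E w) => [a||]; case: (nonneg_condexp P H X^\-%E w) => [b||] //= _ _ _.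
by rewrite opprB -EFinD.
Qed.

Lemma eq_is_essinf (I : Type) (A : set I) (J1 J2 : I -> Omega -> \bar R) V :
  (forall i, A i -> {ae P, forall w, J1 i w = J2 i w}) ->
  is_essinf P [set J1 i | i in A] V -> is_essinf P [set J2 i | i in A] V.
Proof.
move=> J12 [mV leV geV]; split=> //.
- move=> _ [i Ai <-].
  have VJ : {ae P, forall w, (V w <= J1 i w)%E} by apply: leV; exists i.
  by apply: filterS2 VJ (J12 i Ai) => w le <-.
- move=> Z mZ hZ; apply: geV => // _ [i Ai <-].
  have ZJ : {ae P, forall w, (Z w <= J2 i w)%E} by apply: hZ; exists i.
  by apply: filterS2 ZJ (J12 i Ai) => w le ->.
Qed.

Lemma cadlag_pathN r : cadlag_path T r -> cadlag_path T (fun t => - r t).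
Proof.
move=> [rc lc]; split=> t tT; first by apply: cvgN; exact: rc.
by apply: is_cvgN; exact: lc.
Qed.

Lemma class_LbN (X : R -> Omega -> R) : class_Lb P T X -> class_Lb P T (fun t w => - X t w).
Proof.
move=> [cX mX Xoo]; split.
- by move=> w; exact: cadlag_pathN (cX w).
- exact: measurable_funN.
- by under eq_integral do (under eq_imagel do rewrite normrN).
Qed.

Lemma adaptedN G (X : R -> Omega -> R) : adapted T G X -> adapted T G (fun t w => - X t w).
Proof.
move=> aX t tT B mB; rewrite (_ : _ @^-1` B = X t @^-1` (-%R @^-1` B))//.
by apply: aX => //; rewrite -[X in measurable X]setTI; exact: oppr_measurable.
Qed.

Lemma optionalN G (M : R -> Omega -> R) : optional T G M -> optional T G (fun t w => - M t w).
Proof.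
move=> oM B mB; rewrite (_ : [set p | B _] = [set p | (-%R @^-1` B) (M p.1 p.2)])//.
by apply: oM; rewrite -[X in measurable X]setTI; exact: oppr_measurable.
Qed.

Lemma sub_measurableN H X : sub_sigma H -> sub_measurable H X -> sub_measurable H (fun w => - X w)%E.
Proof.
move=> [sH _] mX; apply/(sub_measurableP _ sH); apply: (measurableT_comp (@oppe_measurable R setT)).
exact/(sub_measurableP _ sH).
Qed.

Variables (G : R -> set (set Omega)) (S : (Omega -> R) -> Omega -> \bar R).
Hypotheses (T0 : 0 < T) (hG : usual_filtration P T G).
Local Notation NS := (fun theta w => - S theta w)%E.
Local Notation stopping := (stopping_time T G).

Lemma is_systemN : is_system P T G S -> is_system P T G NS.
Proof.
move=> [m l]; split=> [theta sth|theta1 theta2 s1 s2].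
  exact: (sub_measurableN (stopped_sub_sigma T0 hG sth) (m theta sth)).
by apply: filterS (l _ _ s1 s2) => w h /h ->.
Qed.

Lemma submartingale_systemN : submartingale_system P T G S -> supermartingale_system P T G NS.
Proof.
move=> [sys int sub]; split.
- exact: is_systemN.
- by move=> theta sth; apply: integrableN; exact: int.
- move=> theta1 theta2 s1 s2 le12; have hH := stopped_sub_sigma T0 hG s1.
  have iN := int _ s2; have mN := measurable_int _ iN.
  have iNf : P.-integrable setT (EFin \o (fun w => fine (S theta2 w))).
    apply: le_integrable iN => //; first by apply/measurable_EFinP; exact: measurableT_comp.
    by move=> w _ /=; case: (S theta2 w) => [r||]//=; rewrite ?normr0 ?leey.
  have aeN : {ae P, forall w, S theta2 w = (fine (S theta2 w))%:E}.
    by apply: filterS (integrable_ae measurableT iN) => w /(_ I) fw; rewrite fineK.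
  have [y [_ _ _ Ey]] := condexp_integrable hH iNf mN aeN.
  apply: filterS2 (sub _ _ s1 s2 le12) Ey => w le cy.
  by rewrite (condexpN hH) ?cy// leeN2 -cy.
Qed.

Lemma right_continuous_in_expectationN :
  integrable_system P T G S -> right_continuous_in_expectation P T G S ->
  right_continuous_in_expectation P T G NS.
Proof.
move=> int rc theta_ theta st_ sth dec.
have E th : stopping th -> (\int[P]_w (- S th w) = - \int[P]_w S th w)%E.
  by move=> sth'; rewrite integralN//; exact: integrable_add_def (int _ sth').
rewrite E// (_ : (fun n => _) = (fun n => - \int[P]_w S (theta_ n) w)%E); last first.
  by apply/funext => n; rewrite E.
by apply: cvgeN; exact: (rc _ _ st_ sth dec).
Qed.

Lemma class_DN : class_D P T G S -> class_D P T G NS.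
Proof.
rewrite /class_D.
have E (theta : Omega -> R) (K : R) :
    (\int[P]_(w in [set w | K%:E < `|- S theta w|]) `|- S theta w| =
     \int[P]_(w in [set w | K%:E < `|S theta w|]) `|S theta w|)%E.
  rewrite (_ : [set w | _] = [set w | K%:E < `|S theta w|]%E); last first.
    by apply/funext => w /=; rewrite abseN.
  by under eq_integral do rewrite abseN.
rewrite (_ : (fun K : R => ereal_sup [set (\int[P]_(w in [set w | K%:E < `|- S theta w|]) `|- S theta w|)%E
            | theta in stopping]) = (fun K : R => ereal_sup [set (\int[P]_(w in [set w | K%:E < `|S theta w|]) `|S theta w|)%E
            | theta in stopping]))//.
by apply/funext => K; congr ereal_sup; apply/seteqP; split=> _ [theta sth <-]; exists theta.
Qed.

Lemma uniquely_aggregatedN : uniquely_aggregated P T (submartingale P T) G S ->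
  uniquely_aggregated P T (supermartingale P T) G NS.
Proof.
move=> [M [cM [aM iM sM] [oM MS] uM]]; exists (fun t w => - M t w); split.
- by move=> w; exact: cadlag_pathN (cM w).
- split.
  + exact: adaptedN.
  + by move=> t tT; exact: integrableN (iM t tT).
  + move=> s t s0 st tT; have sT : 0 <= s <= T by rewrite s0 (le_trans st).
    have tT' : 0 <= t <= T by rewrite tT (le_trans s0).
    have hH := filtration_sub_sigma hG sT.
    have mM : measurable_fun setT (EFin \o M t) by exact: measurable_int (iM t tT').
    have [y [_ _ _ Ey]] := condexp_integrable hH (iM t tT') mM (aeW _ (fun w => erefl)).
    apply: filterS2 (sM s t s0 st tT) Ey => w le cy.
    have -> : EFin \o (fun w => - M t w) = (fun w => - (EFin \o M t) w)%E by apply/funext.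
    by rewrite (condexpN hH) ?cy// EFinN leeN2 -cy.
- split; first exact: optionalN.
  by move=> theta sth; apply: filterS (MS theta sth) => w ->; rewrite EFinN.
- move=> M' cM' [oM' M'S].
  have cN : cadlag T (fun t w => - M' t w) by move=> w; exact: cadlag_pathN (cM' w).
  have aN : aggregates P T G (fun t w => - M' t w) S.
    split; first exact: optionalN.
    by move=> theta sth; apply: filterS (M'S theta sth) => w h; rewrite EFinN -h oppeK.
  by apply: filterS (uM _ cN aN) => w h t tT; rewrite h// opprK.
Qed.

End Negation.

(** * The systems of the two players *)

Section GameSystem.
Context {R : realType} {d : measure_display} {Omega : measurableType d}.
Variables (P : probability Omega R) (T : R) (G : R -> set (set Omega)).
Hypotheses (T0 : 0 < T) (completeP : measure_is_complete P) (hG : usual_filtration P T G).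
Variables (f g h : R -> Omega -> R).
Hypotheses (hf : class_Lb P T f) (hg : class_Lb P T g) (hh : class_Lb P T h).
Hypothesis ghf : {ae P, forall w, forall t, 0 <= t <= T -> g t w <= h t w <= f t w}.
Local Notation stopping := (stopping_time T G).
Local Notation alg := (stopped_algebra T G).

Lemma control_inhabited theta : stopping theta -> control P T G theta !=set0.
Proof.
move=> sth; exists (restart theta setT (fun _ _ => 1) (fun _ _ => 1)).
by apply: (restart_control T0 hG sth (sub_sigmaT (stopped_sub_sigma T0 hG sth))); exact: (control_one hG).
Qed.

Lemma is_essinf_value1 zeta theta : stopping theta -> is_essinf P
  [set cond_payoff P T f g h (weight P T zeta G theta) theta xi (truncated zeta theta) (alg theta)
  | xi in control P T G theta] (value1 P T G f g h zeta theta).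
Proof.
move=> sth; have [x0 hx0] := control_inhabited sth; apply: essinfP.
  by eexists; exists x0.
move=> _ [xi _ <-]; apply: (sub_measurable_fun (stopped_sub_sigma T0 hG sth)).
by have sH := stopped_sub_sigma T0 hG sth; exact: condexp_measurable.
Qed.

Theorem system_M0_submartingale zeta : is_randomization P T zeta ->
  [/\ submartingale_system P T G (system_M0 P T G f g h zeta),
      right_continuous_in_expectation P T G (system_M0 P T G f g h zeta),
      class_D P T G (system_M0 P T G f g h zeta) &
      uniquely_aggregated P T (submartingale P T) G (system_M0 P T G f g h zeta)].
Proof.
move=> hzeta; have Vinf := is_essinf_value1 zeta.
have gh : {ae P, forall w t, 0 <= t <= T -> g t w <= h t w}.
  by apply: filterS ghf => w le t tT; have /andP[] := le t tT.
have [s val Ss] := game_is_value T0 completeP hG hf hg hh gh hzeta Vinf.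
have mS := game_value_measurable T0 completeP hG hf hg hh hzeta Vinf.
split.
- exact: (value_submartingale_system T0 hG val mS Ss).
- exact: (value_right_continuous_in_expectation T0 hG val mS Ss).
- exact: (value_class_D T0 hG val mS Ss).
- exact: (value_uniquely_aggregated T0 hG val Ss).
Qed.

Section Opponent.
Variable xi : R -> Omega -> R.
Hypothesis hxi : is_randomization P T xi.
Local Notation f' := (fun t w => - g t w).
Local Notation g' := (fun t w => - f t w).
Local Notation h' := (fun t w => - h t w).

Let hf' : class_Lb P T f'. Proof. exact: class_LbN. Qed.
Let hg' : class_Lb P T g'. Proof. exact: class_LbN. Qed.
Let hh' : class_Lb P T h'. Proof. exact: class_LbN. Qed.

(** The raw payoff of the exchanged game is a.e. the opposite of the original one; a.e. finiteness
    of the conditional payoff then lets the sign pass through [condexp]. *)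
Let cond_payoffN zeta theta : stopping theta -> control P T G theta zeta ->
  {ae P, forall w, cond_payoff P T f' g' h' (weight P T xi G theta) theta zeta (truncated xi theta) (alg theta) w =
    (- cond_payoff P T f g h (weight P T xi G theta) theta (truncated xi theta) zeta (alg theta) w)%E}.
Proof.
move=> sth hzeta; have sH := stopped_sub_sigma T0 hG sth.
have mX := weighted_payoff_measurable T0 completeP hG hf' hg' hh' hxi sth hzeta.
have swap := raw_payoff_swap_ae T0 hf' hg' hh' hxi sth hzeta.
have fin := cond_payoff_fin T0 completeP hG hf' hg' hh' hxi sth hzeta.
pose W w := (weight P T xi G theta w * raw_payoff T (f ^~ w) (g ^~ w) (h ^~ w) (theta w) (truncated xi theta ^~ w) (zeta ^~ w))%:E.
pose W' w := (weight P T xi G theta w * raw_payoff T (f' ^~ w) (g' ^~ w) (h' ^~ w) (theta w) (zeta ^~ w) (truncated xi theta ^~ w))%:E.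
have opp (phi : R -> Omega -> R) w : (fun t => - - phi t w) = phi ^~ w.
  by apply/funext => t; rewrite opprK.
have WE : {ae P, forall w, (- W' w)%E = W w}.
  by apply: filterS swap => w; rewrite !opp /W /W' => ->; rewrite mulrN EFinN.
apply: filterS fin => w Jw; rewrite -[LHS]oppeK; congr (- _)%E.
rewrite -(condexpN sH Jw); apply: (congr1 (fun X => X w)); apply: (condexp_ae sH _ _ WE).
  exact: (measurableT_comp (@oppe_measurable R setT)).
apply: (ae_measurable completeP WE).
exact: (measurableT_comp (@oppe_measurable R setT)).
Qed.

Lemma is_essinf_value2 theta : stopping theta -> is_essinf P
  [set cond_payoff P T f' g' h' (weight P T xi G theta) theta zeta (truncated xi theta) (alg theta)
  | zeta in control P T G theta] (fun w => - value2 P T G f g h xi theta w)%E.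
Proof.
move=> sth; have [x0 hx0] := control_inhabited sth.
pose J zeta := cond_payoff P T f g h (weight P T xi G theta) theta (truncated xi theta) zeta (alg theta).
have : is_esssup P [set J zeta | zeta in control P T G theta] (value2 P T G f g h xi theta).
  apply: esssupP; first by eexists; exists x0.
  move=> _ [zeta _ <-]; apply: (sub_measurable_fun (stopped_sub_sigma T0 hG sth)).
  by have sH := stopped_sub_sigma T0 hG sth; exact: condexp_measurable.
move=> /is_esssupN; rewrite image_comp; apply: eq_is_essinf => zeta hzeta.
by apply: filterS (cond_payoffN sth hzeta) => w ->.
Qed.

Theorem system_N0_supermartingale :
  [/\ supermartingale_system P T G (system_N0 P T G f g h xi),
      right_continuous_in_expectation P T G (system_N0 P T G f g h xi),
      class_D P T G (system_N0 P T G f g h xi) &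
      uniquely_aggregated P T (supermartingale P T) G (system_N0 P T G f g h xi)].
Proof.
have gh : {ae P, forall w t, 0 <= t <= T -> g' t w <= h' t w}.
  by apply: filterS ghf => w le t tT; have /andP[_] := le t tT; rewrite lerN2.
have [s val Ss'] := game_is_value T0 completeP hG hf' hg' hh' gh hxi is_essinf_value2.
have mS' := game_value_measurable T0 completeP hG hf' hg' hh' hxi is_essinf_value2.
pose S theta w := (- system_N0 P T G f g h xi theta w)%E.
have Ss theta : stopping theta -> {ae P, forall w, S theta w = (s theta w)%:E}.
  move=> sth; have sH := stopped_sub_sigma T0 hG sth.
  have [finC finD mC] := survival_integral_fin T0 completeP hG hf' hg' hh' hxi sth.
  have int_opp := stieltjes_opp_ae T0 hf' hg' hh' hxi sth.
  pose X w := (\int[stieltjes T (xi ^~ w)]_(t in `[0, theta w[) f t w)%R%:E.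
  pose X' w := (\int[stieltjes T (xi ^~ w)]_(t in `[0, theta w[) (- f t w))%R%:E.
  have XE : {ae P, forall w, (- X' w)%E = X w}.
    apply: filterS int_opp => w; rewrite /X /X' -EFinN => <-; congr EFin.
    by apply: eq_Rintegral => t _; rewrite opprK.
  have mX'N : measurable_fun setT (fun w => - X' w)%E.
    exact: (measurableT_comp (@oppe_measurable R setT)).
  have CX := condexp_ae sH mX'N (ae_measurable completeP XE mX'N) XE.
  apply: filterS3 finC finD (Ss' _ sth) => w Cw Dw <-.
  rewrite /S /system_N0 -/X -/X' -CX (condexpN sH Cw).
  (* The first summand is finite, so the opposite of the sum is the sum of the opposites whatever
     the second one is. *)
  rewrite muleN; move: Cw (condexp _ _ _ w * value2 _ _ _ _ _ _ _ _ _)%E; rewrite -/X'.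
  by case: (condexp _ _ X' w) => // c _ [v||] //=; rewrite opprD opprK.
have mS theta : stopping theta -> sub_measurable (alg theta) (S theta).
  move=> sth; apply: (sub_measurable_ae (stopped_sub_sigma T0 hG sth) _ _ (mS' _ sth)).
  - by move=> N; exact: (stopped_null hG).
  - by apply: filterS2 (Ss _ sth) (Ss' _ sth) => w -> ->.
have NN : (fun theta w => - S theta w)%E = system_N0 P T G f g h xi.
  by apply/funext => theta; apply/funext => w; rewrite /S oppeK.
have sub := value_submartingale_system T0 hG val mS Ss.
have [_ int _] := sub.
rewrite -NN; split.
- exact: (submartingale_systemN T0 hG sub).
- exact: (right_continuous_in_expectationN int (value_right_continuous_in_expectation T0 hG val mS Ss)).
- exact: (class_DN (value_class_D T0 hG val mS Ss)).
- exact: (uniquely_aggregatedN hG (value_uniquely_aggregated T0 hG val Ss)).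
Qed.

End Opponent.
End GameSystem.

Unset Implicit Arguments.
Set Strict Implicit.
Set Printing Implicit Defensive.

Theorem proposition3p7 (R : realType) (d : measure_display)
    (Omega : measurableType d) (P : probability Omega R) (T : R)
    (F F1 F2 : R -> set (set Omega)) (f g h xi zeta : R -> Omega -> R) :
  0 < T ->
  measure_is_complete P ->
  usual_filtration P T F -> F T `<` measurable ->
  usual_filtration P T F1 -> usual_filtration P T F2 ->
  (forall t, 0 <= t <= T -> <<s F1 t `|` F2 t >> `<=` F t) ->
  class_Lb P T f -> class_Lb P T g -> class_Lb P T h ->
  adapted T F f -> adapted T F g -> adapted T F h ->
  {ae P, forall w, forall t, 0 <= t <= T -> g t w <= h t w <= f t w} ->
  control P T F1 (cst 0) xi -> control P T F2 (cst 0) zeta ->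
  optimal P T F F1 F2 f g h xi zeta ->
  let M0 := system_M0 P T F1 f g h zeta in
  let N0 := system_N0 P T F2 f g h xi in
  [/\ submartingale_system P T F1 M0 /\ supermartingale_system P T F2 N0,
      right_continuous_in_expectation P T F1 M0 /\
        right_continuous_in_expectation P T F2 N0,
      class_D P T F1 M0 /\ class_D P T F2 N0,
      uniquely_aggregated P T (submartingale P T) F1 M0 &
      uniquely_aggregated P T (supermartingale P T) F2 N0].
Proof.
move=> T0 completeP _ _ hF1 hF2 _ hf hg hh _ _ _ ghf hxi hzeta _ M0 N0.
have [a1 a2 a3 a4] := system_M0_submartingale T0 completeP hF1 hf hg hh ghf (control_randomization hF2 hzeta).
have [b1 b2 b3 b4] := system_N0_supermartingale T0 completeP hF2 hf hg hh ghf (control_randomization hF1 hxi).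
exact: And5 (conj a1 b1) (conj a2 b2) (conj a3 b3) a4 b4.
Qed.
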